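(* Let $A\in L(\ell^2(\mathcal H))$ be self-adjoint and positive definite. Let $F\in L^2(\mu_A)$ with chaos decomposition $F=\sum_{n=0}^\infty\langle f^{(n)},\colon\cdot^{\otimes n}\colon\rangle$, $f^{(n)}\in\ell_A^2(\mathcal H)^{\widehat\otimes n}$. Let $m\in\mathbb N$, let $\{\psi_1,\dots,\psi_m\}$ be an orthonormal system in $\ell_A^2(\mathcal H)$, let $\mathcal G:=\sigma(\langle\psi_k,\cdot\rangle,\ k=1,\dots,m)$, and let $\mathcal P_\psi:\ell_A^2(\mathcal H)\to\mathrm{span}\{\psi_1,\dots,\psi_m\}$ be the orthogonal projection. Then $$\mathbb E[F|\mathcal G]=\sum_{n=0}^\infty\big\langle\mathcal P_\psi^{\otimes n}f^{(n)},\colon\cdot^{\otimes n}\colon\big\rangle .$$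
   Context: Setting. $\mathcal H$ is a real separable infinite-dimensional Hilbert space and $\mathcal N\subset\mathcal H\subset\mathcal N'$ a Gel'fand triple, i.e. $\mathcal N$ is a real topological vector space whose topology is given by increasing, compatible Hilbert norms $\|\cdot\|_p$, $p\in\mathbb N_0$ (compatible: a sequence $\|\cdot\|_p$-converging to $0$ and $\|\cdot\|_q$-Cauchy also $\|\cdot\|_q$-converges to $0$), $\mathcal N$ is complete as a metrizable space, its completions $\mathcal N_p$ with respect to $\|\cdot\|_p$ satisfy $\mathcal N_0=\mathcal H$, and the inclusions $\mathcal N_{p+1}\hookrightarrow\mathcal N_p$ are Hilbert–Schmidt. $\ell^2(\mathcal H)$ is the Hilbert space of square summable sequences in $\mathcal H$; $\ell^2_p(\mathcal N_p)=\{f\in\mathcal N_p^{\mathbb N}:\sum_k k^{2p}\|f_k\|_p^2<\infty\}$; $s(\mathcal N):=\bigcap_{p\in\mathbb N_0}\ell_p^2(\mathcal N_p)$ with the topology given by these norms; $s'(\mathcal N)$ is its topological dual with dual pairing $\langle\phi,\omega\rangle=\omega(\phi)$, equipped with the $\sigma$-algebra generated by the maps $\omega\mapsto\langle\phi,\omega\rangle$, $\phi\in s(\mathcal N)$. For self-adjoint positive definite $A\in L(\ell^2(\mathcal H))$ (i.e. $(f,Af)>0$ for $f\neq0$), $(f,g)_A:=(f,Ag)_{\ell^2(\mathcal H)}$, $\|f\|_A:=\sqrt{(f,f)_A}$, and $\mu_A$ is the unique probability measure on $s'(\mathcal N)$ with $\int\exp(i\langle\phi,\omega\rangle)\,d\mu_A(\omega)=\exp(-\tfrac12(\phi,\phi)_A)$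 for all $\phi\in s(\mathcal N)$ (Bochner–Minlos). $L^2(\mu_A)$ is the real space $L^2(s'(\mathcal N),\mu_A;\mathbb R)$. $\ell_A^2(\mathcal H)$ is the completion of $\ell^2(\mathcal H)$ with respect to $(\cdot,\cdot)_A$; $s(\mathcal N)$ is dense in it. For $f\in\ell_A^2(\mathcal H)$, $\langle f,\cdot\rangle\in L^2(\mu_A)$ is the $L^2(\mu_A)$-limit of $\langle\phi_k,\cdot\rangle$ for any $\phi_k\in s(\mathcal N)$ with $\phi_k\to f$ in $\ell_A^2(\mathcal H)$. Tensor powers. $s(\mathcal N)^{\otimes n}$ is the algebraic tensor power, $s(\mathcal N)^{\widehat\otimes n}$ its subspace of symmetric tensors. $\ell_A^2(\mathcal H)^{\otimes n}$ is the Hilbert space tensor power (completion with respect to $(f_1\otimes\cdots\otimes f_n,g_1\otimes\cdots\otimes g_n)_A=\prod_k(f_k,g_k)_A$), and $\ell_A^2(\mathcal H)^{\widehat\otimes n}$ is the closure in it of the span of $\{f^{\otimes n}\}$; the $0$-th powers are $\mathbb R$. For a bounded operator $L$ on $\ell_A^2(\mathcal H)$, $L^{\otimes n}$ is the bounded extension to $\ell_A^2(\mathcal H)^{\otimes n}$ of $f_1\otimes\cdots\otimes f_n\mapsto Lf_1\otimes\cdots\otimes Lf_n$, and $L^{\otimes0}=\mathrm{id}_{\mathbb R}$. Wick powers. $\tau_A:s(\mathcal N)^{\otimes2}\to\mathbb R$ is the linear map with $\tau_A(\phi\otimes\psi)=(\phi,\psi)_A$. For $\omega\in s'(\mathcal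 N)$ define linear functionals $\colon\omega^{\otimes n}\colon$ on $s(\mathcal N)^{\otimes n}$ by $\colon\omega^{\otimes0}\colon=\mathrm{id}_{\mathbb R}$, $\colon\omega^{\otimes1}\colon=\omega$, $\colon\omega^{\otimes n}\colon=\omega\widehat\otimes\colon\omega^{\otimes n-1}\colon-(n-1)\tau_A\widehat\otimes\colon\omega^{\otimes n-2}\colon$ for $n\ge2$, where $F\widehat\otimes G$ is the tensor product functional $F\otimes G$ composed with symmetrization of tensors. For $f^{(n)}\in\ell_A^2(\mathcal H)^{\widehat\otimes n}$, $\langle f^{(n)},\colon\cdot^{\otimes n}\colon\rangle\in L^2(\mu_A)$ is the $L^2(\mu_A)$-limit of $\omega\mapsto\langle\phi_k^{(n)},\colon\omega^{\otimes n}\colon\rangle$ for any sequence $\phi_k^{(n)}\in s(\mathcal N)^{\widehat\otimes n}$ converging to $f^{(n)}$ in $\ell_A^2(\mathcal H)^{\otimes n}$ (the limit exists and does not depend on the sequence). Chaos decomposition: every $F\in L^2(\mu_A)$ is uniquely of the form $F=\sum_{n=0}^\infty\langle f^{(n)},\colon\cdot^{\otimes n}\colon\rangle$ (convergence in $L^2(\mu_A)$) with $f^{(n)}\in\ell_A^2(\mathcal H)^{\widehat\otimes n}$. Conditional expectations of elements of $L^2(\mu_A)$ are regarded as elements of $L^2(\mu_A)$. The $\sigma$-algebra generated by equivalence classes of random variables is formed from arbitrary representatives; the conditional expectation, as an element of $L^2(\mu_A)$, does not depend on this choice. *)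

(* Defs.v *)
From HB Require Import structures.
From mathcomp Require Import all_boot all_order all_algebra.
From mathcomp Require Import fingroup perm ring.
From mathcomp Require Import all_classical all_reals all_analysis.

Set Implicit Arguments.
Unset Strict Implicit.
Unset Printing Implicit Defensive.

Import Order.TTheory GRing.Theory Num.Theory.
Import numFieldNormedType.Exports.

Local Open Scope classical_set_scope.
Local Open Scope ring_scope.

HB.mixin Record CompleteNormedModule_isHilbert (R : realType) V
    of CompleteNormedModule R V := {
  hdot : {dot V for idfun} ;
  hdotE : forall x : V, hdot x x = `|x| ^+ 2
}.

#[short(type="hilbertType")]
HB.structure Definition Hilbert (R : realType) :=
  {V of CompleteNormedModule_isHilbert R V & CompleteNormedModule R V}.

Section LinearAlgebra.
Context {R : realType} {V : lmodType R}.

Definition subspace (S : set V) :=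
  S 0 /\ forall (a : R) x y, S x -> S y -> S (a *: x + y).

Definition lspan (X : set V) : set V := smallest subspace X.

Lemma lspan_subspace X : subspace (lspan X).
Proof.
split=> [S [[S0 _] _] //|a x y Xx Xy S [sS XS]].
by apply: sS.2; [exact: Xx|exact: Xy].
Qed.

Lemma sub_lspan X : X `<=` lspan X.
Proof. by move=> x Xx S [_]; apply. Qed.

Definition linear_independent n (v : 'I_n -> V) :=
  forall c : 'I_n -> R, \sum_i c i *: v i = 0 -> forall i, c i = 0.

Definition ipnorm (ip : V -> V -> R) (x : V) : R := Num.sqrt (ip x x).

Definition ip_cvg (ip : V -> V -> R) (u : nat -> V) (x : V) :=
  (fun k => ipnorm ip (u k - x)) @ \oo --> (0 : R).

Definition ip_cauchy (ip : V -> V -> R) (u : nat -> V) :=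
  forall e : R, 0 < e -> exists n, forall k l, (n <= k)%N -> (n <= l)%N ->
    ipnorm ip (u k - u l) < e.

(* [K], together with the isometric embedding [i], is the completion of [V]
   for the inner product [ip]. *)
Definition is_completion (ip : V -> V -> R) (K : hilbertType R)
    (i : {linear V -> K}) :=
  (forall x y, hdot (i x) (i y) = ip x y) /\ dense (range i).

End LinearAlgebra.

Section HilbertOperators.
Context {R : realType}.

Definition orthonormal_system (K : hilbertType R) (I : eqType) (e : I -> K) :=
  forall i j, hdot (e i) (e j) = (i == j)%:R.

Definition orthonormal_basis (K : hilbertType R) (e : nat -> K) :=
  orthonormal_system e /\ dense (lspan (range e)).

Definition hilbert_schmidt (K L : hilbertType R) (T : {linear K -> L}) :=
  exists2 e : nat -> K, orthonormal_basis e &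
    cvgn (series (fun k => `|T (e k)| ^+ 2)).

Definition is_orthogonal_projection (K : hilbertType R) (S : set K)
    (P : K -> K) :=
  forall x, S (P x) /\ forall y, S y -> hdot (x - P x) y = 0.

End HilbertOperators.

Section Multilinear.
Context {R : realType}.

Definition multilinear (V : lmodType R) n (m : ('I_n -> V) -> R) :=
  forall (v : 'I_n -> V) (i : 'I_n) (a : R) (x y : V),
    m [eta v with i |-> a *: x + y] =
    a * m [eta v with i |-> x] + m [eta v with i |-> y].

Record mform (V : lmodType R) n := MForm {
  mform_fun :> ('I_n -> V) -> R ;
  mform_multilinear : multilinear mform_fun }.

Lemma comp_multilinear (U V : lmodType R) (j : {linear U -> V}) n
  (m : mform V n) : multilinear (fun u : 'I_n -> U => m (j \o u)).
Proof.
have jE (v : 'I_n -> U) i x :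
    j \o [eta v with i |-> x] = [eta j \o v with i |-> j x].
  by apply/funext => k /=; case: ifP.
by move=> v i a x y; rewrite !jE linearP; exact: mform_multilinear.
Qed.

Definition mform_comp (U V : lmodType R) (j : {linear U -> V}) n
  (m : mform V n) : mform U n := MForm (comp_multilinear j m).

(* The algebraic tensor power of [V] is realized as the span, in the dual of
   the space of [n]-linear forms, of the functionals
   [v_1 (x) ... (x) v_n : m |-> m (v_1, ..., v_n)].
   Linear functionals on it are thus the same thing as [n]-linear forms [m],
   the value of [m] at a tensor [t] being [t m]. *)
Definition eval_tensor (V : lmodType R) n (v : 'I_n -> V) : mform V n -> R^o :=
  fun m => m v.

Definition tensor_pred (V : lmodType R) n : {pred mform V n -> R^o} :=
  fun t => `[< lspan (range (@eval_tensor V n)) t >].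

Lemma tensor_submod_closed (V : lmodType R) n :
  submod_closed (@tensor_pred V n).
Proof.
have [l0 lD] := lspan_subspace (range (@eval_tensor V n)).
by split=> [|a x y /asboolP lx /asboolP ly]; apply/asboolP; [|exact: lD].
Qed.

HB.instance Definition _ (V : lmodType R) n :=
  GRing.isSubmodClosed.Build R (mform V n -> R^o) (@tensor_pred V n)
    (@tensor_submod_closed V n).

Record tensor (V : lmodType R) n := Tensor {
  tensor_fun :> mform V n -> R^o ;
  tensorP : tensor_fun \in @tensor_pred V n }.

HB.instance Definition _ (V : lmodType R) n :=
  [isSub for @tensor_fun V n].
HB.instance Definition _ (V : lmodType R) n :=
  [Choice of tensor V n by <:].
HB.instance Definition _ (V : lmodType R) n :=
  [SubChoice_isSubLmodule of tensor V n by <:].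

Lemma pure_in (V : lmodType R) n (v : 'I_n -> V) :
  eval_tensor v \in @tensor_pred V n.
Proof. by apply/asboolP; apply: sub_lspan; exists v. Qed.

Definition pure (V : lmodType R) n (v : 'I_n -> V) : tensor V n :=
  Tensor (pure_in v).

Lemma tensor_map_in (U V : lmodType R) (j : {linear U -> V}) n
    (t : tensor U n) :
  (fun m => t (mform_comp j m)) \in @tensor_pred V n.
Proof.
apply/asboolP => S [[S0 SD] XS]; case: t => t /asboolP /= tX.
apply: (tX [set t | S (fun m => t (mform_comp j m))]); split.
  by split=> //= a x y Sx Sy; exact: SD.
by move=> _ [v _ <-] /=; apply: XS; exists (j \o v).
Qed.

Definition tensor_map (U V : lmodType R) (j : {linear U -> V}) n
  (t : tensor U n) : tensor V n := Tensor (tensor_map_in j t).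

Definition perm_mform_fun (V : lmodType R) n (s : 'S_n)
  (m : mform V n) : ('I_n -> V) -> R := fun v => m (v \o s).

Lemma perm_mform_multilinear (V : lmodType R) n (s : 'S_n) (m : mform V n) :
  multilinear (perm_mform_fun s m).
Proof.
have sE (v : 'I_n -> V) i x :
    [eta v with i |-> x] \o s = [eta v \o s with (s^-1)%g i |-> x].
  by apply/funext => k /=; rewrite -{1}(permKV s i) (inj_eq perm_inj).
by move=> v i a x y; rewrite /perm_mform_fun !sE; exact: mform_multilinear.
Qed.

Definition perm_mform (V : lmodType R) n (s : 'S_n) (m : mform V n) :
  mform V n := MForm (perm_mform_multilinear s m).

Definition symmetric_tensor (V : lmodType R) n (t : tensor V n) :=
  forall (s : 'S_n) (m : mform V n), t (perm_mform s m) = t m.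

(* [T], together with [i], is the Hilbert space tensor power of [K]: the
   completion of the algebraic one for the inner product determined by
   [(f_1 (x) ... (x) f_n, g_1 (x) ... (x) g_n) = \prod_k (f_k, g_k)]. *)
Definition is_hilbert_tensor_power (K : hilbertType R) n (T : hilbertType R)
    (i : {linear tensor K n -> T}) :=
  (forall v w : 'I_n -> K,
     hdot (i (pure v)) (i (pure w)) = \prod_k hdot (v k) (w k)) /\
  dense (range i).

Definition hilbert_symmetric_tensors (K : hilbertType R) n (T : hilbertType R)
    (i : {linear tensor K n -> T}) : set T :=
  closure (lspan (range (fun x : K => i (pure (fun=> x))))).

Definition is_tensor_power_operator (K : hilbertType R) n (T : hilbertType R)
    (i : {linear tensor K n -> T}) (L : K -> K) (Ln : T -> T) :=
  continuous Ln /\ forall v : 'I_n -> K, Ln (i (pure v)) = i (pure (L \o v)).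

End Multilinear.

Section MultilinearOps.
Context {R : realType} {V : lmodType R}.

Lemma mone_multilinear : multilinear (fun _ : 'I_0 -> V => 1 : R).
Proof. by move=> v []. Qed.

(* the functional [id] on the [0]-th tensor power, i.e. on the scalars *)
Definition mone : mform V 0 := MForm mone_multilinear.

Lemma mlin_multilinear (F : {scalar V}) :
  multilinear (fun v : 'I_1 -> V => F (v ord0)).
Proof. by move=> v i a x y; rewrite (ord1 i) /= linearP. Qed.

Definition mlin (F : {scalar V}) : mform V 1 := MForm (mlin_multilinear F).

Lemma mbilin_multilinear (b : V -> V -> R) :
  (forall y, scalar (b^~ y)) -> (forall x, scalar (b x)) ->
  multilinear (fun v : 'I_2 -> V => b (v ord0) (v ord_max)).
Proof.
move=> bl br v i a x y /=.
have [->|ni] := eqVneq i ord0; first by rewrite /= bl.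
have -> : i = ord_max.
  by apply/val_inj; case: i ni => [[|[|//]]].
by rewrite /= br.
Qed.

Definition mbilin (b : V -> V -> R) (bl : forall y, scalar (b^~ y))
  (br : forall x, scalar (b x)) : mform V 2 := MForm (mbilin_multilinear bl br).

Definition mtensor_fun k l (F : mform V k) (G : mform V l) :
    ('I_(k + l) -> V) -> R :=
  fun v => F (v \o @lshift k l) * G (v \o @rshift k l).

Lemma mtensor_multilinear k l (F : mform V k) (G : mform V l) :
  multilinear (mtensor_fun F G).
Proof.
move=> v i a x y; rewrite /mtensor_fun; case: (split_ordP i) => j ->.
- have El z : [eta v with lshift l j |-> z] \o @lshift k l =
      [eta v \o @lshift k l with j |-> z].
    by apply/funext => h /=; rewrite (inj_eq (@lshift_inj _ _)).
  have Er z : [eta v with lshift l j |-> z] \o @rshift k l = v \o @rshift k l.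
    by apply/funext => h /=; rewrite eq_rlshift.
  by rewrite !El !Er mform_multilinear mulrDl mulrA.
- have El z : [eta v with rshift k j |-> z] \o @rshift k l =
      [eta v \o @rshift k l with j |-> z].
    by apply/funext => h /=; rewrite (inj_eq (@rshift_inj _ _)).
  have Er z : [eta v with rshift k j |-> z] \o @lshift k l = v \o @lshift k l.
    by apply/funext => h /=; rewrite eq_lrshift.
  by rewrite !El !Er mform_multilinear mulrDr mulrCA.
Qed.

Definition mtensor k l (F : mform V k) (G : mform V l) : mform V (k + l) :=
  MForm (mtensor_multilinear F G).

Lemma msym_multilinear n (F : mform V n) :
  multilinear (fun v => (n`!%:R)^-1 * \sum_(s : 'S_n) perm_mform s F v).
Proof.
move=> v i a x y; rewrite mulrCA -mulrDr [a * _]mulr_sumr -big_split /=.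
by congr (_ * _); apply: eq_bigr => s _; exact: perm_mform_multilinear.
Qed.

(* composition of the functional [F] with symmetrization of tensors *)
Definition msym n (F : mform V n) : mform V n := MForm (msym_multilinear F).

Lemma msub_multilinear n (F G : mform V n) (c : R) :
  multilinear (fun v => F v - c * G v).
Proof.
move=> v i a x y; rewrite !mform_multilinear mulrDr mulrBr opprD mulrCA.
by rewrite addrACA.
Qed.

Definition msubZ n (F : mform V n) (c : R) (G : mform V n) : mform V n :=
  MForm (msub_multilinear F G c).

Definition symtensor k l (F : mform V k) (G : mform V l) : mform V (k + l) :=
  msym (mtensor F G).

(* Wick powers of [omega] for the covariance form [tau]; by computation,
   [1 + n.+1] and [2 + n] are both [n.+2]. *)
Fixpoint wick_power (tau : mform V 2) (omega : mform V 1) (n : nat) :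
    mform V n :=
  match n with
  | 0 => mone
  | n1.+1 =>
    match n1 return mform V n1 -> mform V n1.+1 with
    | 0 => fun=> omega
    | n2.+1 => fun W => msubZ (symtensor omega W) n2.+1%:R
                          (symtensor tau (wick_power tau omega n2))
    end (wick_power tau omega n1)
  end.

End MultilinearOps.

Definition separable (T : topologicalType) :=
  exists2 D : set T, countable D & dense D.

(* [gspace G p] is the completion of the space [nuc G] for its [p]-th norm, and
   the central space of the triple is [gspace G 0]. The maps [gincl G p]
   are the inclusions; they are injective by compatibility of the norms, see
   [gincl_eq0]. *)
Record gelfand_triple (R : realType) := GelfandTriple {
  nuc : lmodType R ;
  nuc_ip : nat -> {dot nuc for idfun} ;
  nuc_ip_increasing : forall p x, ipnorm (nuc_ip p) x <= ipnorm (nuc_ip p.+1) x ;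
  nuc_ip_compatible : forall p q (u : nat -> nuc),
    ip_cvg (nuc_ip p) u 0 -> ip_cauchy (nuc_ip q) u -> ip_cvg (nuc_ip q) u 0 ;
  nuc_complete : forall u : nat -> nuc, (forall p, ip_cauchy (nuc_ip p) u) ->
    exists x, forall p, ip_cvg (nuc_ip p) u x ;
  gspace : nat -> hilbertType R ;
  gemb : forall p, {linear nuc -> gspace p} ;
  gemb_completion : forall p, is_completion (nuc_ip p) (gemb p) ;
  gincl : forall p, {linear gspace p.+1 -> gspace p} ;
  gincl_continuous : forall p, continuous (gincl p) ;
  gincl_emb : forall p x, gincl p (gemb p.+1 x) = gemb p x ;
  gincl_hilbert_schmidt : forall p, hilbert_schmidt (gincl p) ;
  gspace0_separable : separable (gspace 0) ;
  gspace0_infinite_dim :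
    forall n, exists v : 'I_n -> gspace 0, linear_independent v
}.

Lemma gincl_eq0 (R : realType) (G : gelfand_triple R) p x :
  gincl G p x = 0 -> x = 0.
Proof.
move=> x0.
have D := (gemb_completion G p.+1).2.
have /choice [u Hu] : forall k : nat, exists y : nuc G,
    `|gemb G p.+1 y - x| < k.+1%:R^-1.
  move=> k; have [||z [/= Bz [y _ yz]]] := D [set z | `|z - x| < k.+1%:R^-1].
  - by exists x => /=; rewrite subrr normr0 invr_gt0.
  - have -> : [set z | `|z - x| < k.+1%:R^-1] = ball x (k.+1%:R^-1).
      by apply/seteqP; rewrite -ball_normE; split=> z /=; rewrite distrC.
    by apply: ball_open; rewrite invr_gt0.
  - by exists y; rewrite yz.
have nE q y : ipnorm (nuc_ip G q) y = `|gemb G q y|.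
  by rewrite /ipnorm -(gemb_completion G q).1 hdotE sqrtr_sqr normr_id.
have ux : (fun k => gemb G p.+1 (u k)) @ \oo --> x.
  apply/cvgrPdist_lt => e e0; near=> k; rewrite distrC (lt_trans (Hu k)) //.
  near: k; exact: near_infty_natSinv_lt (PosNum e0).
have up : ip_cvg (nuc_ip G p) u 0.
  rewrite /ip_cvg; under eq_fun do rewrite subr0 nE -gincl_emb.
  rewrite -(normr0 (gspace G p)) -x0.
  apply: cvg_norm.
  by apply: (cvg_comp _ _ ux); exact: gincl_continuous.
have uc : ip_cauchy (nuc_ip G p.+1) u.
  move=> e e0.
  have e2 : 0 < e / 2 by rewrite divr_gt0.
  move/cvgrPdist_lt : ux => /(_ _ e2) [N _ HN]; exists N => k l Nk Nl.
  rewrite nE linearB -(subrKA x) (le_lt_trans (ler_normD _ _)) // (splitr e).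
  by rewrite ltrD // ?(HN l) // distrC (HN k).
have := nuc_ip_compatible up uc.
rewrite /ip_cvg; under eq_fun do rewrite subr0 nE.
move=> c0; have c1 := cvg_norm ux.
apply/normr0_eq0; rewrite -(cvg_lim (@norm_hausdorff _ R) (c1 _)).
by rewrite (cvg_lim (@norm_hausdorff _ R) c0).
Unshelve. all: by end_near. Qed.

Section SquareSummable.
Context {R : realType}.

Lemma hdotC (V : hilbertType R) (x y : V) : hdot x y = hdot y x.
Proof. by rewrite hermC expr0 mul1r. Qed.

Lemma hdot_polar (V : hilbertType R) (x y : V) :
  hdot x y = 2^-1 * `|x + y| ^+ 2 + - 2^-1 * (`|x| ^+ 2 + `|y| ^+ 2).
Proof.
rewrite -!hdotE linearDl /= !linearDr /= (hdotC y x).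
move: (hdot x x) (hdot x y) (hdot y y) => p q r; by field.
Qed.

Lemma is_cvg_series_lin (u v : nat -> R) (c d : R) :
  cvgn (series u) -> cvgn (series v) ->
  cvgn (series (fun k => c * u k + d * v k)).
Proof.
by move=> cu cv; apply: (@is_cvg_seriesD R (c *: u) (d *: v));
  exact: is_cvg_seriesZ.
Qed.

Lemma lim_series_lin (u v : nat -> R) (c : R) :
  cvgn (series u) -> cvgn (series v) ->
  limn (series (fun k => c * u k + v k)) =
  c * limn (series u) + limn (series v).
Proof.
move=> cu cv; have ccu := @is_cvg_seriesZ R u c cu.
exact: (etrans (lim_seriesD ccu cv) (congr1 (+%R^~ _) (lim_seriesZ c cu))).
Qed.

Lemma wsummable_lin (V : hilbertType R) (w : nat -> R) (a : R)
    (f g : nat -> V) : (forall k, 0 <= w k) ->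
  cvgn (series (fun k => w k * `|f k| ^+ 2)) ->
  cvgn (series (fun k => w k * `|g k| ^+ 2)) ->
  cvgn (series (fun k => w k * `|a *: f k + g k| ^+ 2)).
Proof.
move=> w0 cf cg; have cc := is_cvg_series_lin (c := 2 * a ^+ 2) (d := 2) cf cg.
apply: (series_le_cvg _ _ _ cc) => k.
- by rewrite mulr_ge0 ?w0 ?sqr_ge0.
- have fk := mulr_ge0 (w0 k) (sqr_ge0 `|f k|).
  have gk := mulr_ge0 (w0 k) (sqr_ge0 `|g k|).
  by apply: addr_ge0; apply: mulr_ge0 => //; apply: mulr_ge0; rewrite ?sqr_ge0.
- rewrite (_ : _ + _ = w k * (2 * a ^+ 2 * `|f k| ^+ 2 + 2 * `|g k| ^+ 2)); last by ring.
  rewrite ler_wpM2l //.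
  apply: (@le_trans _ _ ((`|a| * `|f k| + `|g k|) ^+ 2)).
    by rewrite ler_sqr ?nnegrE ?addr_ge0 ?mulr_ge0 // -normrZ ler_normD.
  rewrite -(real_normK (num_real a)) -subr_ge0.
  rewrite (_ : _ - _ = (`|a| * `|f k| - `|g k|) ^+ 2) ?sqr_ge0 //.
  ring.
Qed.

Definition l2_pred (V : hilbertType R) : {pred nat -> V} :=
  fun f => `[< cvgn (series (fun k => `|f k| ^+ 2)) >].

Lemma l2_submod_closed (V : hilbertType R) : submod_closed (@l2_pred V).
Proof.
split=> [|a f g /asboolP cf /asboolP cg]; apply/asboolP.
  rewrite (_ : series _ = cst 0); first exact: is_cvg_cst.
  by apply/funext => n; rewrite /series /= big1 // => k _; rewrite normr0 expr0n.
have E (h : nat -> V) : (fun k => `|h k| ^+ 2) = (fun k => 1 * `|h k| ^+ 2).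
  by apply/funext => k; rewrite mul1r.
by rewrite E; apply: wsummable_lin; rewrite // -E.
Qed.

HB.instance Definition _ (V : hilbertType R) :=
  GRing.isSubmodClosed.Build R (nat -> V) (@l2_pred V) (@l2_submod_closed V).

Record l2 (V : hilbertType R) := L2 {
  l2_fun :> nat -> V ;
  l2P : l2_fun \in @l2_pred V }.

HB.instance Definition _ (V : hilbertType R) := [isSub for @l2_fun V].
HB.instance Definition _ (V : hilbertType R) := [Choice of l2 V by <:].
HB.instance Definition _ (V : hilbertType R) :=
  [SubChoice_isSubLmodule of l2 V by <:].

Definition l2_ip (V : hilbertType R) (f g : l2 V) : R :=
  limn (series (fun k => hdot (f k) (g k))).

Lemma is_cvg_l2_ip (V : hilbertType R) (f g : l2 V) :
  cvgn (series (fun k => hdot (f k) (g k))).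
Proof.
have /asboolP cf := l2P f; have /asboolP cg := l2P g.
have /asboolP cfg := l2P (f + g).
under eq_fun do rewrite hdot_polar.
apply: is_cvg_series_lin; first exact: cfg.
exact: is_cvg_seriesD.
Qed.

Lemma l2_ip_scalarl (V : hilbertType R) (g : l2 V) : scalar (@l2_ip V ^~ g).
Proof.
move=> a x y; rewrite /l2_ip -lim_series_lin; try exact: is_cvg_l2_ip.
by congr (limn (series _)); apply/funext => k; rewrite linearPl.
Qed.

Lemma l2_ip_scalarr (V : hilbertType R) (f : l2 V) : scalar (@l2_ip V f).
Proof.
move=> a x y; rewrite /l2_ip -lim_series_lin; try exact: is_cvg_l2_ip.
by congr (limn (series _)); apply/funext => k; rewrite linearPr.
Qed.

Definition bounded_operator (V : hilbertType R) (A : l2 V -> l2 V) :=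
  exists C : R, forall f, ipnorm (@l2_ip V) (A f) <= C * ipnorm (@l2_ip V) f.

Definition self_adjoint (V : hilbertType R) (A : l2 V -> l2 V) :=
  forall f g, l2_ip f (A g) = l2_ip (A f) g.

Definition positive_definite (V : hilbertType R) (A : l2 V -> l2 V) :=
  forall f, f != 0 -> 0 < l2_ip f (A f).

Definition ipA (V : hilbertType R) (A : l2 V -> l2 V) (f g : l2 V) : R :=
  l2_ip f (A g).

End SquareSummable.

Section TestSequences.
Context {R : realType} (G : gelfand_triple R).

Fixpoint gincl0 (p : nat) : {linear gspace G p -> gspace G 0} :=
  match p with
  | 0 => idfun
  | q.+1 => gincl0 q \o gincl G q
  end.

(* Sequences being indexed from 1 in the definition of the weighted norms, the
   entry [g k] is the one of index [k.+1]. *)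
Definition weighted_sq p (g : nat -> gspace G p) : nat -> R :=
  fun k => k.+1%:R ^+ (2 * p) * `|g k| ^+ 2.

Definition weighted_l2 (p : nat) : set (nat -> gspace G 0) :=
  [set f | exists2 g : nat -> gspace G p,
     f = gincl0 p \o g & cvgn (series (weighted_sq g))].

Definition test_pred : {pred nat -> gspace G 0} :=
  fun f => `[< forall p, weighted_l2 p f >].

Lemma test_submod_closed : submod_closed test_pred.
Proof.
split=> [|a f g /asboolP tf /asboolP tg]; apply/asboolP => p.
  exists 0; first by apply/funext => k /=; rewrite linear0.
  rewrite (_ : series _ = cst 0); first exact: is_cvg_cst.
  apply/funext => n; rewrite /series /= big1 // => k _.
  by rewrite /weighted_sq normr0 expr0n mulr0.
have [f' -> cf] := tf p; have [g' -> cg] := tg p.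
exists (a *: f' + g'); first by apply/funext => k /=; rewrite linearP.
by apply: wsummable_lin => // k; rewrite exprn_ge0.
Qed.

HB.instance Definition _ :=
  GRing.isSubmodClosed.Build R (nat -> gspace G 0) test_pred
    test_submod_closed.

(* [s(N)], the intersection of the weighted l2 spaces *)
Record test := Test {
  test_fun :> nat -> gspace G 0 ;
  testP : test_fun \in test_pred }.

HB.instance Definition _ := [isSub for test_fun].
HB.instance Definition _ := [Choice of test by <:].
HB.instance Definition _ := [SubChoice_isSubLmodule of test by <:].

Definition test_norm (p : nat) (f : test) : R :=
  Num.sqrt (limn (series (weighted_sq
    (xget (0 : nat -> gspace G p) [set g : nat -> gspace G p | test_fun f = gincl0 p \o g])))).

(* The norms increase with [p], so that their balls around [f] form a base of
   the neighborhoods of [f]. *)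
Definition test_nbhs (f : test) : set_system test :=
  filter_from [set pe : nat * R | 0 < pe.2]
    (fun pe => [set g | test_norm pe.1 (g - f) < pe.2]).

Lemma test_l2 (f : test) : (f : nat -> gspace G 0) \in @l2_pred R (gspace G 0).
Proof.
apply/asboolP; have /asboolP /(_ 0%N) [g -> cg] := testP f.
rewrite (_ : (fun _ => _) = weighted_sq g) //.
by apply/funext => k; rewrite /weighted_sq muln0 expr0 mul1r.
Qed.

Definition test_incl_fun (f : test) : l2 (gspace G 0) := L2 (test_l2 f).

Lemma test_incl_linear : linear test_incl_fun.
Proof. by move=> a f g; apply/val_inj. Qed.

HB.instance Definition _ :=
  GRing.isLinear.Build R test (l2 (gspace G 0)) _ test_incl_fun
    test_incl_linear.

Definition test_incl : {linear test -> l2 (gspace G 0)} := test_incl_fun.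

Record dual := Dual {
  dual_fun :> {scalar test} ;
  dual_continuous : forall f, dual_fun @ test_nbhs f --> dual_fun f }.

Lemma dual0_continuous (f : test) :
  (\0 : {scalar test}) @ test_nbhs f --> (\0 : {scalar test}) f.
Proof.
move=> B B0; exists (0%N, 1) => /= [|g _ /=]; first exact: ltr01.
exact: nbhs_singleton.
Qed.

HB.instance Definition _ := gen_eqMixin dual.
HB.instance Definition _ := gen_choiceMixin dual.
HB.instance Definition _ := isPointed.Build dual (Dual dual0_continuous).

Definition cylinder : set (set dual) :=
  \bigcup_(phi in [set: test])
    preimage_set_system setT (fun omega : dual => omega phi : R) measurable.

Definition mdual := g_sigma_algebraType cylinder.

HB.instance Definition _ := Measurable.on mdual.

End TestSequences.

Section WhiteNoise.
Context {R : realType} (G : gelfand_triple R).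
Variables (A : {linear l2 (gspace G 0) -> l2 (gspace G 0)}).

Definition test_ip (phi psi : test G) : R :=
  ipA A (test_incl G phi) (test_incl G psi).

Lemma test_ip_scalarl psi : scalar (test_ip^~ psi).
Proof. by move=> a x y; rewrite /test_ip /ipA linearP l2_ip_scalarl. Qed.

Lemma test_ip_scalarr phi : scalar (test_ip phi).
Proof. by move=> a x y; rewrite /test_ip /ipA !linearP l2_ip_scalarr. Qed.

Definition tau_form : mform (test G) 2 :=
  mbilin test_ip_scalarl test_ip_scalarr.

Definition wick (omega : mdual G) (n : nat) : mform (test G) n :=
  wick_power tau_form (mlin (omega : dual G)) n.

(* real and imaginary part of
   [\int exp (i <phi, omega>) = exp (- 1/2 (phi, phi)_A)] *)
Definition has_gaussian_characteristic (mu : probability (mdual G) R) :=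
  forall phi : test G,
    \int[mu]_omega cos ((omega : dual G) phi) =
      expR (- 2^-1 * test_ip phi phi) /\
    \int[mu]_omega sin ((omega : dual G) phi) = 0.

End WhiteNoise.

Section L2limits.
Context d (T : measurableType d) (R : realType) (mu : probability T R).

Definition L2_cvg (u : nat -> T -> R) (F : T -> R) :=
  [/\ forall k, u k \in Lfun mu 2%:E, F \in Lfun mu 2%:E &
      (fun k => 'N[mu]_2%:E[EFin \o (u k \- F)%R]%E) @ \oo --> 0%E].

Definition generated_sigma_algebra (I : Type) (g : I -> T -> R) : set (set T) :=
  <<s \bigcup_k preimage_set_system setT (g k) measurable >>.

Definition is_condexp (S : set (set T)) (F E : T -> R) :=
  [/\ forall B : set R, measurable B -> S (E @^-1` B),
      mu.-integrable setT (EFin \o E) &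
      forall B, S B ->
        (\int[mu]_(x in B) (E x)%:E = \int[mu]_(x in B) (F x)%:E)%E].

Definition condexp (S : set (set T)) (F : T -> R) : T -> R :=
  xget (cst 0) (is_condexp S F).

End L2limits.

Section WickIntegrals.
Context {R : realType} (G : gelfand_triple R).
Variables (A : {linear l2 (gspace G 0) -> l2 (gspace G 0)})
  (mu : probability (mdual G) R).
Variables (K : hilbertType R) (iA : {linear l2 (gspace G 0) -> K}).

Definition test_emb : {linear test G -> K} := iA \o test_incl G.

(* [L2 (mu)] is handled through representatives, here of [<f, .>], chosen among
   the L2 limits along approximating sequences; all of them are equal almost
   everywhere. *)
Definition pairing (f : K) : mdual G -> R :=
  xget (cst 0) [set X | exists2 phi : nat -> test G,
    (fun k => test_emb (phi k)) @ \oo --> f &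
    L2_cvg mu (fun k omega => (omega : dual G) (phi k)) X].

(* a representative of [< f, :.^(x)n: >] *)
Definition wick_integral n (T : hilbertType R) (i : {linear tensor K n -> T})
    (f : T) : mdual G -> R :=
  xget (cst 0) [set X | exists phi : nat -> tensor (test G) n,
    [/\ forall k, symmetric_tensor (phi k),
        (fun k => i (tensor_map test_emb (phi k))) @ \oo --> f &
        L2_cvg mu (fun k omega => phi k (wick A omega n)) X]].

End WickIntegrals.

(* Main.v *)
Require Import Defs.
From HB Require Import structures.
From mathcomp Require Import all_boot all_order all_algebra.
From mathcomp Require Import fingroup perm ring lra zify.
From mathcomp Require Import all_classical all_reals all_analysis.
From mathcomp Require Import measurable_realfun.

Set Implicit Arguments.
Unset Strict Implicit.
Unset Printing Implicit Defensive.

Import Order.TTheory GRing.Theory Num.Theory.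
Import numFieldNormedType.Exports.

Local Open Scope classical_set_scope.
Local Open Scope ring_scope.

(* On a diagonal tensor v (x) ... (x) v the n-th Wick power of omega is the n-th
   Hermite polynomial of <v, omega> for the variance (v, v)_A. Gaussian
   integration by parts, which is obtained by differentiating the characteristic
   functional, gives the chaos isometry and the formula

     E[<f, :omega^n:> cos(<w, omega> + s)]
       = (f, w (x) ... (x) w)_A E[cos(<w, omega> + s + n pi / 2)].

   If w is in the span of the psi_k, the right-hand side does not change when f is
   replaced by its projection. Hence F and the projected chaos series have the
   same expectation against all the trigonometric functions of the <psi_k, .>,
   and so against the indicators of all the sets of the sigma-algebra that these
   generate. The projected series is measurable for this sigma-algebra, up to a
   null set, because it is a limit of polynomials in the <psi_k, .>. *)

(** * Expectation and square integrable functions *)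

(** The difficulty lies in representatives: [wick_integral], [pairing] and [condexp] are selected by
    [xget], and the [X k] are arbitrary up to null sets. A selected Wick integral has no reason to
    be measurable for the sigma-algebra of the [X k], and [pairing] is linear only almost
    everywhere. Two devices deal with this. The relation [wick_lim] says that a function is a limit
    of Wick sums, so that its properties hold for all representatives at once. The Gaussian calculus
    is done for an abstract family indexed by a vector space, and is used for the test sequences as
    well as for their product with [R^m], whose second factor carries the [X k] themselves. Only the
    characteristic functional of the law is given. Even the integrability of powers has to be
    extracted from it, alternately with integration by parts. Cosines with a phase replace complex
    exponentials, and a derivative adds [pi / 2] to the phase. Explicit polynomials in a cosine,
    approximating its sign, lead from trigonometric functions to indicators. *)

Lemma quadratic_discr (R : realFieldType) (a b c : R) :
  (forall t, 0 <= a + (2 * t * b + t ^+ 2 * c)) -> 0 <= a -> 0 <= c ->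
  b ^+ 2 <= a * c.
Proof.
move=> H a0; rewrite le_eqVlt => /predU1P[c0|c0].
  rewrite -c0 mulr0; have [->|b0] := eqVneq b 0; first by rewrite expr0n.
  (* At this [t] the affine function [a + 2 t b] takes the value [-1]. *)
  have := H (- (a + 1) / (2 * b)); rewrite -c0 mulr0 addr0.
  rewrite (_ : 2 * (- (a + 1) / (2 * b)) * b = - (a + 1)); first by lra.
  by field.
have := H (- b / c).
rewrite [X in 0 <= X](_ : _ = (a * c - b ^+ 2) / c); last by field; rewrite gt_eqF.
by rewrite pmulr_lge0 ?invr_gt0 // subr_ge0.
Qed.

Section Expectation.
Context d (T : measurableType d) (R : realType) (mu : probability T R).
Implicit Types (f g : T -> R) (c : R).

Definition intg f := mu.-integrable setT (EFin \o f).
(** Real-valued, an infinite integral being sent to a default value; the rules for [Ex] therefore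
    carry hypotheses [intg]. *)
Definition Ex f : R := \int[mu]_x f x.

Lemma intg_meas f : intg f -> measurable_fun setT f.
Proof. by move=> /measurable_int/measurable_EFinP. Qed.

Lemma intg_le g f : measurable_fun setT f -> intg g ->
  (forall x, `|f x| <= g x) -> intg f.
Proof.
move=> mf ig fg; apply: (le_integrable _ _ _ ig) => //.
  exact/measurable_EFinP.
by move=> x _ /=; rewrite lee_fin (le_trans (fg x)) // ler_norm.
Qed.

Lemma intg_cst c : intg (fun=> c).
Proof. exact: finite_measure_integrable_cst. Qed.

Lemma intgD f g : intg f -> intg g -> intg (fun x => f x + g x).
Proof. exact: integrableD. Qed.

Lemma intgZ c f : intg f -> intg (fun x => c * f x).
Proof. by move=> /(integrableZl measurableT c). Qed.

Lemma intgB f g : intg f -> intg g -> intg (fun x => f x - g x).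
Proof. exact: integrableB. Qed.

Lemma intg_sum (I : Type) (s : seq I) (h : I -> T -> R) :
  (forall i, intg (h i)) -> intg (fun x => \sum_(i <- s) h i x).
Proof.
move=> ih; elim: s => [|i s IH].
  by under eq_fun do rewrite big_nil; exact: intg_cst.
by under eq_fun do rewrite big_cons; exact: intgD.
Qed.

Lemma ExD f g : intg f -> intg g -> Ex (fun x => f x + g x) = Ex f + Ex g.
Proof. exact: RintegralD. Qed.

Lemma ExB f g : intg f -> intg g -> Ex (fun x => f x - g x) = Ex f - Ex g.
Proof. exact: RintegralB. Qed.

Lemma ExZ c f : intg f -> Ex (fun x => c * f x) = c * Ex f.
Proof. exact: RintegralZl. Qed.

Lemma Ex_cst c : Ex (fun=> c) = c.
Proof. 
rewrite /Ex Rintegral_cst // -[RHS]mulr1; congr (_ * _).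
by rewrite [X in fine X](probability_setT mu).
 Qed.

Lemma Ex_sum (I : Type) (s : seq I) (h : I -> T -> R) :
  (forall i, intg (h i)) ->
  Ex (fun x => \sum_(i <- s) h i x) = \sum_(i <- s) Ex (h i).
Proof.
move=> ih; elim: s => [|i s IH].
  by under eq_fun do rewrite big_nil; rewrite Ex_cst big_nil.
under eq_fun do rewrite big_cons.
by rewrite ExD // ?IH ?big_cons //; exact: intg_sum.
Qed.

Lemma Ex_ge0 f : (forall x, 0 <= f x) -> 0 <= Ex f.
Proof. by move=> f0; exact: Rintegral_ge0. Qed.

Lemma Ex_le f g : intg f -> intg g -> (forall x, f x <= g x) -> Ex f <= Ex g.
Proof. by move=> fi gi fg; exact: le_Rintegral. Qed.

Lemma EFin_Ex f : intg f -> (Ex f)%:E = (\int[mu]_x (f x)%:E)%E.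
Proof.
by move=> fi; rewrite fineK //; exact: (@integrable_fin_num _ _ _ mu setT).
Qed.

Lemma Ex_dominated (u : nat -> T -> R) f g :
  (forall n, measurable_fun setT (u n)) -> measurable_fun setT f ->
  (forall x, u ^~ x @ \oo --> f x) -> intg g ->
  (forall n x, `|u n x| <= g x) ->
  intg f /\ Ex \o u @ \oo --> Ex f.
Proof.
move=> mu_ mf uf ig ug.
have [|||||fi _ c] := @dominated_convergence _ _ _ mu setT measurableT
  (fun n => EFin \o u n) (EFin \o f) (EFin \o g).
- by move=> n; exact/measurable_EFinP.
- exact/measurable_EFinP.
- by apply: aeW => x _; apply: cvg_EFin; [exact: nearW|exact: uf].
- exact: ig.
- by apply: aeW => x n _ /=; rewrite lee_fin.
split=> //; apply: fine_cvg.
by rewrite EFin_Ex.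
Qed.

(** A uniform bound on the expectations makes the limit integrable without a dominating function.
    The Gaussian moments and the L2 limits are both obtained in this way. *)
Lemma Ex_fatou (u : nat -> T -> R) f c :
  (forall n, intg (u n)) -> (forall n x, 0 <= u n x) ->
  measurable_fun setT f -> (forall x, 0 <= f x) ->
  {ae mu, forall x, u ^~ x @ \oo --> f x} -> (forall n, Ex (u n) <= c) ->
  intg f /\ Ex f <= c.
Proof.
move=> iu u0 mf f0 uf uc.
have le : (\int[mu]_x (f x)%:E <= c%:E)%E.
  have -> : (\int[mu]_x (f x)%:E =
      \int[mu]_x limn_einf (fun n => (u n x)%:E))%E.
    apply: ae_eq_integral => //; first exact/measurable_EFinP.
      (* The lower limit is measurable as minus the upper limit of the opposites. *)
      rewrite (_ : (fun x => _) = fun x => (- limn_esup (fun n => - (u n x)%:E))%E).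
        apply: measurableT_comp => //; apply: measurable_fun_limn_esup => n.
        apply: measurableT_comp => //; apply/measurable_EFinP.
        exact: intg_meas.
      apply/funext => x; rewrite -limn_einfN; congr limn_einf.
      by apply/funext => n /=; rewrite opprK.
    apply: filterS uf => x ux _.
    have /cvg_limn_einf_sup[-> _] // : (fun n => (u n x)%:E) @ \oo --> (f x)%:E.
    by apply: cvg_EFin; [exact: nearW|exact: ux].
  have mE n : measurable_fun setT (EFin \o u n).
    by apply/measurable_EFinP; exact: intg_meas.
  apply: (le_trans (fatou mu measurableT mE _)).
    by move=> n x _; rewrite lee_fin.
  rewrite limn_einf_lim.
  apply: lime_le; first exact: is_cvg_einfs.
  apply: nearW => n; apply: ge_ereal_inf => /=.
  by exists (Ex (u n))%:E; [exists n; [exact: leqnn|by rewrite EFin_Ex]|rewrite lee_fin].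
have fi : intg f.
  apply/integrableP; split; first exact/measurable_EFinP.
  under eq_integral do rewrite /= ger0_norm //.
  exact: le_lt_trans le (ltry _).
by split=> //; rewrite -lee_fin EFin_Ex.
Qed.


Definition sqi f := f \in Lfun mu 2%:E.

Lemma sqiP f : sqi f <-> measurable_fun setT f /\ intg (fun x => f x ^+ 2).
Proof.
split=> [fl|[mf fi]].
  split; last exact: Lfun2_integrable_sqr.
  by move: fl; rewrite /sqi inE => /andP[/[!inE]].
rewrite /sqi inE; apply/andP; split; rewrite inE //= /finite_norm unlock.
apply: poweR_lty; case/integrableP: fi => _; apply: le_lt_trans.
rewrite le_eqVlt; apply/orP; left; apply/eqP; apply: eq_integral => x _ /=.
by rewrite powR_mulrn // normrX.
Qed.

Lemma Lnorm2E f : sqi f ->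
  'N[mu]_2%:E[EFin \o f]%E = (Num.sqrt (Ex (fun x => f x ^+ 2)))%:E.
Proof.
move=> /sqiP[mf fi]; rewrite unlock.
rewrite -powR12_sqrt; last by apply: Ex_ge0 => x; exact: sqr_ge0.
rewrite -poweR_EFin EFin_Ex //; congr (_ `^ _)%E.
apply: eq_integral => x _ /=.
by rewrite powR_mulrn // -normrX ger0_norm // sqr_ge0.
Qed.

Lemma sqi_meas f : sqi f -> measurable_fun setT f.
Proof. by move=> /sqiP[]. Qed.

Lemma sqi_sqr f : sqi f -> intg (fun x => f x ^+ 2).
Proof. by move=> /sqiP[]. Qed.

Lemma intgM f g : sqi f -> sqi g -> intg (fun x => f x * g x).
Proof.
move=> /sqiP[mf fi] /sqiP[mg gi].
apply: (@intg_le (fun x => f x ^+ 2 + g x ^+ 2)); last 2 first.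
- exact: intgD.
- move=> x; rewrite normrM -(real_normK (num_real (f x))).
  rewrite -(real_normK (num_real (g x))).
  move: `|f x| `|g x| (normr_ge0 (f x)) (normr_ge0 (g x)) => a b a0 b0.
  have := sqr_ge0 (a - b); have := mulr_ge0 a0 b0; nra.
- exact: measurable_funM.
Qed.

Lemma sqi_le g f : measurable_fun setT f -> sqi g ->
  (forall x, `|f x| <= `|g x|) -> sqi f.
Proof.
move=> mf /sqiP[mg gi] fg; apply/sqiP; split=> //.
apply: (intg_le _ gi); first exact: measurable_funX.
by move=> x; rewrite normrX -(real_normK (num_real (g x))) lerXn2r ?nnegrE.
Qed.

Lemma sqi_cst c : sqi (fun=> c).
Proof. by apply/sqiP; split=> //; exact: intg_cst. Qed.

Lemma sqiZ c f : sqi f -> sqi (fun x => c * f x).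
Proof.
move=> /sqiP[mf fi]; apply/sqiP; split; first exact: measurable_funM.
by under eq_fun do rewrite exprMn; exact: intgZ.
Qed.

Lemma sqiD f g : sqi f -> sqi g -> sqi (fun x => f x + g x).
Proof.
move=> fs gs; have [mf fi] := (sqiP _).1 fs; have [mg gi] := (sqiP _).1 gs.
apply/sqiP; split; first exact: measurable_funD.
rewrite (_ : (fun x => _) = fun x => f x ^+ 2 + (2 * (f x * g x) + g x ^+ 2)).
  by apply: intgD => //; apply: intgD => //; apply: intgZ; exact: intgM.
by apply/funext => x; ring.
Qed.

Lemma sqiB f g : sqi f -> sqi g -> sqi (fun x => f x - g x).
Proof.
move=> fs gs; rewrite (_ : (fun x => _) = fun x => f x + -1 * g x).
  by apply: sqiD => //; exact: sqiZ.
by apply/funext => x; rewrite mulN1r.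
Qed.

Lemma sqi_sum (I : Type) (s : seq I) (h : I -> T -> R) :
  (forall i, sqi (h i)) -> sqi (fun x => \sum_(i <- s) h i x).
Proof.
move=> ih; elim: s => [|i s IH].
  by under eq_fun do rewrite big_nil; exact: sqi_cst.
by under eq_fun do rewrite big_cons; exact: sqiD.
Qed.

Lemma sqi_intg f : sqi f -> intg f.
Proof.
move=> fs; have := intgM fs (sqi_cst 1).
by under eq_fun do rewrite mulr1.
Qed.

Lemma Ex_CS f g : sqi f -> sqi g -> Ex (fun x => f x * g x) ^+ 2 <=
  Ex (fun x => f x ^+ 2) * Ex (fun x => g x ^+ 2).
Proof.
move=> fs gs; have fi := sqi_sqr fs; have gi := sqi_sqr gs.
have fgi := intgM fs gs.
have H t : 0 <= Ex (fun x => f x ^+ 2) + (2 * t * Ex (fun x => f x * g x) +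
    t ^+ 2 * Ex (fun x => g x ^+ 2)).
  rewrite -!ExZ // -!ExD //; try exact: intgZ; last first.
    by apply: intgD; exact: intgZ.
  apply: Ex_ge0 => x; rewrite (_ : _ + _ = (f x + t * g x) ^+ 2) ?sqr_ge0 //.
  ring.
move: H (Ex_ge0 (fun x => sqr_ge0 (f x))) (Ex_ge0 (fun x => sqr_ge0 (g x))).
move: (Ex _) (Ex _) (Ex _) => a b c H a0 c0.
exact: quadratic_discr H a0 c0.
Qed.

Lemma L2_cvgP (u : nat -> T -> R) f : L2_cvg mu u f <->
  [/\ forall k, sqi (u k), sqi f &
    (fun k => Ex (fun x => (u k x - f x) ^+ 2)) @ \oo --> (0 : R)].
Proof.
split=> -[us fs c]; split=> //.
- have ds k : sqi (u k \- f)%R by exact: (sqiB (us k) fs).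
  move: c; under eq_fun do rewrite Lnorm2E //.
  move/fine_cvg => /= c.
  pose r k := Num.sqrt (Ex (fun x => (u k x - f x) ^+ 2)).
  rewrite (_ : (fun k => _) = fun k => r k * r k); last first.
    apply/funext => k; rewrite -expr2 sqr_sqrtr //.
    by apply: Ex_ge0 => x; exact: sqr_ge0.
  have rr : (fun k => r k * r k) @ \oo --> (0 * 0 : R) by apply: cvgM.
  by rewrite mulr0 in rr.
- have ds k : sqi (u k \- f)%R by exact: (sqiB (us k) fs).
  under eq_fun do rewrite Lnorm2E //.
  apply: cvg_EFin; first exact: nearW.
  have := cvg_comp _ _ c (@sqrt_continuous R 0).
  by rewrite sqrtr0.
Qed.

End Expectation.

(** * Completeness of L2 over a sub-sigma-algebra *)

Section SubSigmaAlgebra.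
Context d (T : measurableType d) (R : realType) (mu : probability T R).
Variable g : set (set T).
Hypothesis g_meas : g `<=` measurable.

Definition smeas (f : T -> R) :=
  forall B : set R, measurable B -> <<s g >> (f @^-1` B).

Lemma sub_smeas B : <<s g >> B -> measurable B.
Proof.
move: B; apply: smallest_sub => //.
exact: sigma_algebra_measurable.
Qed.

Lemma smeas_meas f : smeas f -> measurable_fun setT f.
Proof. by move=> fs _ B mB; rewrite setTI; apply: sub_smeas; exact: fs. Qed.

Lemma smeasP f : smeas f <->
  measurable_fun (setT : set (g_sigma_algebraType g)) (f : g_sigma_algebraType g -> R).
Proof.
by split=> [fs _ B mB|fs B mB]; have := fs; rewrite ?setTI; [exact|move/(_ measurableT _ mB); rewrite setTI].
Qed.

(** By monotone convergence the sum of the series is integrable, hence finite almost everywhere. *)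
Lemma series_ae_cvg (w : nat -> T -> R) (c : R) :
  (forall k, intg mu (w k)) -> (forall k x, 0 <= w k x) ->
  (forall n, \sum_(k < n) Ex mu (w k) <= c) ->
  {ae mu, forall x, cvgn (series (w ^~ x))}.
Proof.
move=> iw w0 wc.
pose S x := (\sum_(k <oo) (w k x)%:E)%E.
have mw k : measurable_fun setT (fun x => (w k x)%:E).
  by apply/measurable_EFinP; exact: intg_meas.
have S0 x : (0 <= S x)%E by apply: nneseries_ge0 => k _ _; rewrite lee_fin.
have mS : measurable_fun setT S.
  by apply: ge0_emeasurable_sum => // k x _ _; rewrite lee_fin.
have iS : mu.-integrable setT S.
  apply/integrableP; split=> //.
  under eq_integral do rewrite gee0_abs //.
  rewrite integral_nneseries //; last by move=> k x _; rewrite lee_fin.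
  apply: (@le_lt_trans _ _ c%:E); last exact: ltry.
  apply: lime_le.
    apply: is_cvg_nneseries => k _ _.
    by apply: integral_ge0 => x _; rewrite lee_fin.
  apply: nearW => n; rewrite big_mkord.
  under eq_bigr do rewrite -EFin_Ex //.
  by rewrite sumEFin lee_fin.
have := integrable_ae measurableT iS; apply: filterS => x /(_ I) Sx.
apply: nondecreasing_is_cvgn.
  by apply/nondecreasing_series => k _ _; exact: w0.
exists (fine (S x)) => _ [n _ <-].
rewrite -lee_fin fineK // /series /= -sumEFin.
rewrite /S; apply: nneseries_lim_ge => k _ _; by rewrite lee_fin.
Qed.

Lemma sum_half (n : nat) : \sum_(k < n) (2^-1 : R) ^+ k <= 2.
Proof.
suff : \sum_(k < n) (2^-1 : R) ^+ k = 2 - 2 * 2^-1 ^+ n.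
  by move=> ->; rewrite gerBl mulr_ge0 // exprn_ge0 // invr_ge0.
elim: n => [|n IH]; first by rewrite big_ord0 expr0 mulr1 subrr.
by rewrite big_ord_recr /= IH exprS; field.
Qed.

(** The Riesz-Fischer argument. The limit is built as an upper limit along a subsequence, which
    makes it measurable for [<<s g >>] itself and not merely up to a null set, as [is_condexp]
    demands. *)
Lemma L2_complete (u : nat -> T -> R) :
  (forall k, sqi mu (u k)) -> (forall k, smeas (u k)) ->
  (forall e, 0 < e -> exists N, forall k l, (N <= k)%N -> (N <= l)%N ->
     Ex mu (fun x => (u k x - u l x) ^+ 2) <= e) ->
  exists F, smeas F /\ L2_cvg mu u F.
Proof.
move=> us um uc.
have /choice[N NP] : forall n : nat, exists N, forall k l,
    (N <= k)%N -> (N <= l)%N ->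
    Ex mu (fun x => (u k x - u l x) ^+ 2) <= (2^-1 ^+ n) ^+ 2.
  by move=> n; apply: uc; rewrite exprn_gt0 // exprn_gt0 // invr_gt0.
(* A sum of thresholds exceeds each of them, so consecutive terms of the subsequence are within
   [2^-1 ^+ k] of each other in L2. *)
pose m k := (\sum_(i < k.+1) N i)%N.
have mN n k : (n <= k)%N -> (N n <= m k)%N.
  by move=> nk; rewrite /m (bigD1 (Ordinal (nk : (n < k.+1)%N))) //= leq_addr.
pose w k x := `|u (m k.+1) x - u (m k) x|.
have ds i j : sqi mu (fun x => u i x - u j x) by exact: sqiB.
have ws k : sqi mu (w k).
  apply: (sqi_le _ (ds (m k.+1) (m k))); last by move=> x; rewrite normr_id.
  by apply: measurableT_comp => //; exact: sqi_meas (ds _ _).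
have wE k : Ex mu (w k) <= 2^-1 ^+ k.
  rewrite -ler_sqr ?nnegrE ?exprn_ge0 ?invr_ge0 //; last first.
    by apply: Ex_ge0 => x; exact: normr_ge0.
  apply: (le_trans _ (NP k (m k.+1) (m k) (mN _ _ _) (mN _ _ _))) => //.
  have := Ex_CS (ws k) (sqi_cst mu 1).
  under [X in Ex mu X ^+ 2]eq_fun do rewrite mulr1.
  under [X in _ * Ex mu X]eq_fun do rewrite expr1n.
  rewrite Ex_cst mulr1 => /le_trans; apply; rewrite le_eqVlt; apply/orP; left.
  apply/eqP; congr (Ex mu _); apply/funext => x.
  by rewrite real_normK // num_real.
have vc : {ae mu, forall x, cvgn (fun k => u (m k) x)}.
  have := series_ae_cvg (fun k => sqi_intg (ws k)) _ _.
  move=> /(_ 2) H; have {H} : {ae mu, forall x, cvgn (series (w ^~ x))}.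
    apply: H => [k x|n]; first exact: normr_ge0.
    by apply: le_trans (sum_half n); apply: ler_sum.
  apply: filterS => x wx.
  have /normed_cvg /= : cvgn [normed series (telescope (fun k => u (m k) x))].
    exact: wx.
  rewrite telescopeK => c.
  have -> : (fun k => u (m k) x) =
     (fun k => u (m k) x - u (m 0%N) x + u (m 0%N) x).
    by apply/funext => k; rewrite subrK.
  by apply: is_cvgD => //; exact: is_cvg_cst.
(* The upper limit exists at every point, also where the subsequence diverges, and [fine] makes it
   real. *)
pose F x := fine (limn_esup (fun k => (u (m k) x)%:E)).
have vF : {ae mu, forall x, (fun k => u (m k) x) @ \oo --> F x}.
  apply: filterS vc => x /cvg_ex[l ul].
  suff -> : F x = l by [].
  have /cvg_limn_einf_sup[_ E] : (fun k => (u (m k) x)%:E) @ \oo --> l%:E.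
    by apply: cvg_EFin; [exact: nearW|exact: ul].
  by rewrite /F E.
have Fm : smeas F.
  apply/smeasP; apply: measurableT_comp; first exact: fine_measurable.
  apply: measurable_fun_limn_esup => k; apply/measurable_EFinP.
  exact/smeasP.
have mF := smeas_meas Fm.
(* Fatou's lemma along the subsequence from index [n] on bounds the distance of every late [u k]
   from [F], so that the whole sequence converges. *)
have FP n k : (N n <= k)%N -> intg mu (fun x => (u k x - F x) ^+ 2) /\
    Ex mu (fun x => (u k x - F x) ^+ 2) <= (2^-1 ^+ n) ^+ 2.
  move=> nk.
  apply: (@Ex_fatou _ _ _ _ (fun j x => (u k x - u (m (j + n)%N) x) ^+ 2)).
  - by move=> j; exact: sqi_sqr.
  - by move=> j x; exact: sqr_ge0.
  - by apply: measurable_funX; apply: measurable_funB => //; exact: sqi_meas.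
  - by move=> x; exact: sqr_ge0.
  - apply: filterS vF => x vx.
    have vx' : (fun j => u (m (j + n)%N) x) @ \oo --> F x.
      by rewrite (cvg_shiftn n (fun k => u (m k) x)).
    have c1 : (fun j => u k x - u (m (j + n)%N) x) @ \oo --> u k x - F x.
      by apply: cvgB => //; exact: cvg_cst.
    by under eq_fun do rewrite expr2; rewrite expr2; exact: cvgM.
  - by move=> j; apply: NP => //; apply: mN; rewrite leq_addl.
have sF : sqi mu F.
  have [i0 _] := FP 0%N (N 0%N) (leqnn _).
  have s0 : sqi mu (fun x => u (N 0%N) x - F x).
    apply/sqiP; split=> //; apply: measurable_funB => //; exact: sqi_meas.
  rewrite (_ : F = fun x => u (N 0%N) x - (u (N 0%N) x - F x)).
    exact: sqiB.
  by apply/funext => x; rewrite subKr.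
exists F; split=> //; apply/L2_cvgP; split=> //.
apply/cvgrPdist_le => e e0.
have [n en] : exists n : nat, (2^-1 ^+ n : R) ^+ 2 <= e.
  have q1 : `|2^-1 ^+ 2 : R| < 1.
    by rewrite ger0_norm ?sqr_ge0 // expr_lt1 ?invr_ge0 // invf_lt1 // ltr1n.
  have /cvgrPdist_le /(_ _ e0) [n _ /(_ n (leqnn n))] := cvg_expr q1.
  rewrite /= sub0r normrN ger0_norm ?exprn_ge0 ?sqr_ge0 // => ne.
  by exists n; rewrite exprAC.
exists (N n) => // k /= nk; rewrite sub0r normrN ger0_norm.
  by apply: le_trans en; have [] := FP n k nk.
by apply: Ex_ge0 => x; exact: sqr_ge0.
Qed.
End SubSigmaAlgebra.

(** * Passing to the limit in L2 *)

Section L2Limits.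
Context d (T : measurableType d) (R : realType) (mu : probability T R).
Implicit Types (f g : T -> R).

Lemma sqr_cvg0 (a : nat -> R) :
  (fun k => a k ^+ 2) @ \oo --> (0 : R) -> a @ \oo --> (0 : R).
Proof.
move=> c; apply/norm_cvg0P.
have := cvg_comp _ _ c (@sqrt_continuous R 0).
rewrite sqrtr0 (_ : _ \o _ = fun k => `|a k|) //.
by apply/funext => k /=; rewrite sqrtr_sqr.
Qed.

Lemma cvg_ExM0 (u v : nat -> T -> R) (b : R) :
  (forall k, sqi mu (u k)) -> (forall k, sqi mu (v k)) ->
  (fun k => Ex mu (fun x => u k x ^+ 2)) @ \oo --> (0 : R) ->
  (fun k => Ex mu (fun x => v k x ^+ 2)) @ \oo --> b ->
  (fun k => Ex mu (fun x => u k x * v k x)) @ \oo --> (0 : R).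
Proof.
move=> us vs u0 vb; apply: sqr_cvg0.
have uv0 : (fun k => Ex mu (fun x => u k x ^+ 2) * Ex mu (fun x => v k x ^+ 2))
    @ \oo --> (0 : R).
  by rewrite -[X in _ --> X](mul0r b); exact: cvgM.
apply: (squeeze_cvgr _ (cvg_cst 0) uv0).
by apply: nearW => k; rewrite sqr_ge0 /=; exact: Ex_CS.
Qed.

(** The product is expanded around [f] and [g]: in each error term one factor tends to 0 in L2 and
    the other stays bounded in L2. *)
Lemma L2_cvg_Ex (u v : nat -> T -> R) f g : L2_cvg mu u f -> L2_cvg mu v g ->
  (fun k => Ex mu (fun x => u k x * v k x)) @ \oo -->
    Ex mu (fun x => f x * g x).
Proof.
move=> /L2_cvgP[us fs uf] /L2_cvgP[vs gs vg].
have du k : sqi mu (fun x => u k x - f x) by exact: sqiB.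
have dv k : sqi mu (fun x => v k x - g x) by exact: sqiB.
have E k : Ex mu (fun x => u k x * v k x) =
    Ex mu (fun x => (u k x - f x) * (v k x - g x)) +
    (Ex mu (fun x => (v k x - g x) * f x) +
    (Ex mu (fun x => (u k x - f x) * g x) + Ex mu (fun x => f x * g x))).
  rewrite -!ExD; try exact: intgM.
  - by congr (Ex mu _); apply/funext => x; ring.
  - by apply: intgD; [|apply: intgD]; exact: intgM.
  - by apply: intgD; exact: intgM.
rewrite (funext E).
have c1 := cvg_ExM0 du dv uf vg.
have c2 := cvg_ExM0 dv (fun=> fs) vg (cvg_cst _).
have c3 := cvg_ExM0 du (fun=> gs) uf (cvg_cst _).
rewrite -[X in _ --> X]add0r; apply: cvgD c1 _.
rewrite -[X in _ --> X]add0r; apply: cvgD (c2 _) _.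
rewrite -[X in _ --> X]add0r; apply: cvgD (c3 _) _.
exact: cvg_cst.
Qed.

Lemma L2_cvg_cst f : sqi mu f -> L2_cvg mu (fun=> f) f.
Proof.
move=> fs; apply/L2_cvgP; split=> //.
rewrite (_ : (fun x => _) = fun=> 0).
  exact: cvg_cst.
apply/funext => k; rewrite (_ : (fun x => _) = fun=> 0) ?Ex_cst //.
by apply/funext => x; rewrite subrr expr0n.
Qed.

(** The inequality [(a + b)^2 <= 2 (a^2 + b^2)] stands in for the triangle inequality and keeps
    square roots out. *)
Lemma Ex_sqrB_le f g h : sqi mu f -> sqi mu g -> sqi mu h ->
  Ex mu (fun x => (f x - h x) ^+ 2) <=
  2 * (Ex mu (fun x => (f x - g x) ^+ 2) + Ex mu (fun x => (h x - g x) ^+ 2)).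
Proof.
move=> fs gs hs; have fg := sqi_sqr (sqiB fs gs).
have hg := sqi_sqr (sqiB hs gs).
rewrite -ExD // -ExZ; last exact: intgD.
apply: Ex_le; [exact/sqi_sqr/sqiB|by apply: intgZ; exact: intgD|move=> x].
have := sqr_ge0 (f x - g x + (h x - g x)); nra.
Qed.

Lemma L2_cauchy (u : nat -> T -> R) f : L2_cvg mu u f ->
  forall e, 0 < e -> exists N, forall k l, (N <= k)%N -> (N <= l)%N ->
     Ex mu (fun x => (u k x - u l x) ^+ 2) <= e.
Proof.
move=> /L2_cvgP[us fs /cvgrPdist_le uf] e e0.
have [|N _ NP] := uf (e / 4); first by rewrite divr_gt0.
exists N => k l Nk Nl; apply: (le_trans (Ex_sqrB_le (us k) fs (us l))).
have := NP k Nk; have := NP l Nl; rewrite /= !sub0r !normrN.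
by rewrite !ger0_norm; [lra|apply: Ex_ge0 => x; exact: sqr_ge0..].
Qed.

Lemma L2_cvg_trans (u v : nat -> T -> R) f : L2_cvg mu u f ->
  (forall k, sqi mu (v k)) ->
  (fun k => Ex mu (fun x => (v k x - u k x) ^+ 2)) @ \oo --> (0 : R) ->
  L2_cvg mu v f.
Proof.
move=> /L2_cvgP[us fs uf] vs vu; apply/L2_cvgP; split=> //.
have z : (fun k => 2 * (Ex mu (fun x => (v k x - u k x) ^+ 2) +
    Ex mu (fun x => (u k x - f x) ^+ 2))) @ \oo --> (0 : R).
  rewrite -[X in _ --> X](mulr0 2); apply: cvgM; first exact: cvg_cst.
  by rewrite -[X in _ --> X](addr0 0); exact: cvgD.
apply: (squeeze_cvgr _ (cvg_cst 0) z); apply: nearW => k /=.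
rewrite Ex_ge0 /=; last by move=> x; exact: sqr_ge0.
have := Ex_sqrB_le (vs k) (us k) fs.
congr (_ <= 2 * (_ + Ex mu _)).
by apply/funext => x; rewrite -sqrrN opprB.
Qed.

Lemma ae_eq_Ex f g : measurable_fun setT f -> measurable_fun setT g ->
  f = g %[ae mu] -> Ex mu f = Ex mu g.
Proof.
move=> mf mg fg; congr fine; apply: ae_eq_integral => //.
- exact/measurable_EFinP.
- exact/measurable_EFinP.
- by apply: filterS fg => x fgx /fgx /= ->.
Qed.

Lemma Ex_sqr_eq0 f : sqi mu f -> Ex mu (fun x => f x ^+ 2) = 0 ->
  f = (fun=> 0) %[ae mu].
Proof.
move=> fs f0; have fi := sqi_sqr fs.
have /ae_eq_integral_abs : measurable_fun setT (EFin \o (fun x => f x ^+ 2)).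
  by apply/measurable_EFinP; exact: (intg_meas fi).
move=> /(_ mu measurableT) [+ _].
have -> : (\int[mu]_x `|(EFin \o (fun x => (f x ^+ 2)%R)) x| = 0)%E.
  under eq_integral do rewrite /= ger0_norm ?sqr_ge0 //.
  by rewrite -EFin_Ex // f0.
move=> /(_ erefl); apply: filterS => x H /H /= [].
by move=> /eqP; rewrite sqrf_eq0 => /eqP.
Qed.

Lemma sqi_ae f g : measurable_fun setT f -> f = g %[ae mu] -> sqi mu g ->
  sqi mu f.
Proof.
move=> mf fg gs; have [mg gi] := (sqiP _ _).1 gs; apply/sqiP; split=> //.
apply/integrableP; split.
  by apply/measurable_EFinP; exact: measurable_funX.
case/integrableP: gi => _; apply: le_lt_trans.
rewrite le_eqVlt; apply/orP; left; apply/eqP; apply: ae_eq_integral => //.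
- apply: measurableT_comp => //; apply/measurable_EFinP.
  exact: measurable_funX.
- apply: measurableT_comp => //; apply/measurable_EFinP.
  exact: measurable_funX.
- by apply: filterS fg => x H /H /= ->.
Qed.

End L2Limits.

(** * Fourier uniqueness *)

Lemma bernoulli_ge (R : realType) (x : R) n : 0 <= x -> x <= 1 ->
  1 - n%:R * x <= (1 - x) ^+ n.
Proof.
move=> x0 x1; elim: n => [|n IH]; first by rewrite mul0r subr0 expr0.
rewrite exprS -natr1.
have : (1 - x) * (1 - n%:R * x) <= (1 - x) * (1 - x) ^+ n.
  by rewrite ler_wpM2l // subr_ge0.
apply: le_trans; have := mulr_ge0 (ler0n R n) (mulr_ge0 x0 x0); nra.
Qed.

(** The product [(1 - x)^n (1 + x)^n = (1 - x^2)^n] is at most 1, and Bernoulli's inequality bounds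
    its second factor from below. *)
Lemma bernoulli_le (R : realType) (x : R) n : 0 <= x -> x <= 1 ->
  (1 - x) ^+ n * (1 + n%:R * x) <= 1.
Proof.
move=> x0 x1; have x01 : 0 <= 1 - x by rewrite subr_ge0.
apply: (@le_trans _ _ ((1 - x) ^+ n * (1 + x) ^+ n)).
  rewrite ler_wpM2l ?exprn_ge0 //; elim: n => [|n IH].
    by rewrite mul0r addr0 expr0.
  rewrite exprS -natr1.
  have : (1 + x) * (1 + n%:R * x) <= (1 + x) * (1 + x) ^+ n.
    by rewrite ler_wpM2l // addr_ge0.
  by apply: le_trans; have := mulr_ge0 (ler0n R n) (mulr_ge0 x0 x0); nra.
rewrite -exprMn exprn_ile1 //.
  by apply: mulr_ge0 => //; rewrite addr_ge0.
have := mulr_ge0 x0 x0; nra.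
Qed.

(* By Bernoulli's inequality these polynomials tend to the indicator function of
   [y < 1/2] on the unit interval, away from [y = 1/2]. *)
Definition step_fun {R : realType} (n : nat) (y : R) := (1 - y ^+ n) ^+ (2 ^ n).

Section StepFunction.
Context {R : realType}.
Implicit Types (y : R).

Lemma step_fun_bound n y : 0 <= y -> y <= 1 ->
  0 <= step_fun n y /\ step_fun n y <= 1.
Proof.
move=> y0 y1; have yn : y ^+ n <= 1 by rewrite exprn_ile1.
have yn0 : 0 <= y ^+ n by rewrite exprn_ge0.
split; first by rewrite exprn_ge0 // subr_ge0.
by rewrite exprn_ile1 ?subr_ge0 // gerBl.
Qed.

(** Squeezed between [1 - (2 y)^n] and 1: the outer exponent [2 ^ n] is what turns [y ^ n] into
    [(2 y)^n] in Bernoulli's inequality. *)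
Lemma step_fun_lt y : 0 <= y -> y < 2^-1 ->
  (fun n => step_fun n y) @ \oo --> (1 : R).
Proof.
move=> y0 y2; have y1 : y <= 1 by apply: (le_trans (ltW y2)); rewrite invf_le1 // ler1n.
have q : `|2 * y| < 1 by rewrite ger0_norm ?mulr_ge0 //; lra.
have c : (fun n => 1 - (2 * y) ^+ n) @ \oo --> (1 : R).
  rewrite -[X in _ --> X]subr0; apply: cvgB; first exact: cvg_cst.
  exact: cvg_expr.
apply: (@squeeze_cvgr _ _ _ _ (fun n => 1 - (2 * y) ^+ n) (fun=> 1) _ _ 1 c (cvg_cst _)); apply: nearW => n.
have [_ ->] := step_fun_bound n y0 y1; rewrite andbT.
rewrite exprMn -natrX.
by apply: bernoulli_ge; [rewrite exprn_ge0|rewrite exprn_ile1].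
Qed.

(** The factor [1 + (2 y)^n] in [bernoulli_le] leaves a bound by [(2 y)^-n]. *)
Lemma step_fun_gt y : 2^-1 < y -> y <= 1 ->
  (fun n => step_fun n y) @ \oo --> (0 : R).
Proof.
move=> y2 y1; have y0 : 0 <= y by apply: ltW; apply: lt_trans y2; rewrite invr_gt0.
have y00 : 0 < 2 * y by lra.
have q : `|(2 * y)^-1| < 1.
  by rewrite ger0_norm ?invr_ge0 ?mulr_ge0 // invf_lt1 //; lra.
have c : (fun n => (2 * y)^-1 ^+ n) @ \oo --> (0 : R) by exact: cvg_expr.
apply: (squeeze_cvgr _ (cvg_cst 0) c); apply: nearW => n.
have [-> _] /= := step_fun_bound n y0 y1.
have := @bernoulli_le R (y ^+ n) (2 ^ n) _ _.
rewrite natrX -exprMn => H.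
rewrite exprVn -[leRHS]mul1r ler_pdivlMr ?exprn_gt0 //.
apply: le_trans (H _ _); [|by rewrite exprn_ge0|by rewrite exprn_ile1].
have [s0 _] := step_fun_bound n y0 y1.
by rewrite /step_fun ler_wpM2l // ler_wpDl.
Qed.

(* The difference of two step functions takes the value [0] at [0] for every [n],
   so that the limit is the sign function everywhere. *)
Definition sgn_poly n : {poly R} :=
  (1 - (2^-1 *: (1 - 'X)) ^+ n) ^+ (2 ^ n)
  - (1 - (2^-1 *: (1 + 'X)) ^+ n) ^+ (2 ^ n).

Lemma sgn_polyE n y : (sgn_poly n).[y] =
  step_fun n (2^-1 * (1 - y)) - step_fun n (2^-1 * (1 + y)).
Proof. by rewrite /sgn_poly !(hornerE, horner_exp). Qed.

Lemma sgn_poly_bound n y : `|y| <= 1 -> `|(sgn_poly n).[y]| <= 1.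
Proof.
rewrite ler_norml => /andP[y0 y1]; rewrite sgn_polyE.
have [||a0 a1] := @step_fun_bound n (2^-1 * (1 - y)); try lra.
have [||b0 b1] := @step_fun_bound n (2^-1 * (1 + y)); try lra.
by rewrite ler_norml; apply/andP; split; lra.
Qed.

Lemma sgn_poly_cvg y : `|y| <= 1 ->
  (fun n => (sgn_poly n).[y]) @ \oo --> Num.sg y.
Proof.
rewrite ler_norml => /andP[y0 y1].
rewrite (_ : (fun n => _) = fun n => step_fun n (2^-1 * (1 - y)) -
    step_fun n (2^-1 * (1 + y))); last by apply/funext => n; rewrite sgn_polyE.
have [yl|yg|->] := ltgtP y 0.
- rewrite ltr0_sg // -[X in _ --> X]sub0r.
  apply: cvgB; [apply: step_fun_gt|apply: step_fun_lt]; lra.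
- rewrite gtr0_sg // -[X in _ --> X]subr0.
  apply: cvgB; [apply: step_fun_lt|apply: step_fun_gt]; lra.
- rewrite sgr0 addr0 subr0 (_ : (fun n => _) = fun=> 0); first exact: cvg_cst.
  by apply/funext => n; rewrite subrr.
Qed.

End StepFunction.

(** * One variable: from cosines to half-lines *)

Section Fourier1.
Context d (T : measurableType d) (R : realType) (mu : probability T R).
Variables (Y X : T -> R).
Hypothesis Yi : intg mu Y.
Hypothesis Xm : measurable_fun setT X.
Hypothesis YX : forall s t, Ex mu (fun x => Y x * cos (s * X x + t)) = 0.

Lemma intg_mul_bounded (g : T -> R) : measurable_fun setT g ->
  (forall x, `|g x| <= 1) -> intg mu (fun x => Y x * g x).
Proof.
move=> mg g1; apply: (@intg_le _ _ _ _ (fun x => `|Y x|)).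
- by apply: measurable_funM => //; exact: intg_meas Yi.
- exact: integrable_norm.
- by move=> x; rewrite normrM ler_piMr.
Qed.

Lemma measurable_cos_affine s t : measurable_fun setT (fun x => cos (s * X x + t)).
Proof.
apply: measurableT_comp; last by apply: measurable_funD => //; exact: measurable_funM.
by apply: continuous_measurable_fun; exact: continuous_cos.
Qed.

(** The additional cosine with free frequency and phase makes the induction work: the product
    formula absorbs one power into it, at the frequencies [s' + s] and [s' - s]. *)
Lemma Ex_cos_pow n s t s' t' :
  Ex mu (fun x => Y x * (cos (s * X x + t) ^+ n * cos (s' * X x + t'))) = 0.
Proof.
elim: n s' t' => [|n IH] s' t'.
  by under eq_fun do rewrite expr0 mul1r; exact: YX.
have c1 u v : measurable_fun setT (fun x => cos (s * X x + t) ^+ n * cos (u * X x + v)).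
  apply: measurable_funM; last exact: measurable_cos_affine.
  by apply: measurable_funX; exact: measurable_cos_affine.
have c2 u v x : `|cos (s * X x + t) ^+ n * cos (u * X x + v)| <= 1.
  by rewrite normrM normrX mulr_ile1 ?exprn_ile1 ?exprn_ge0 // cos_max.
rewrite (_ : (fun x => _) = fun x =>
  2^-1 * (Y x * (cos (s * X x + t) ^+ n * cos ((s' + s) * X x + (t' + t)))) +
  2^-1 * (Y x * (cos (s * X x + t) ^+ n * cos ((s' - s) * X x + (t' - t))))).
  by rewrite ExD ?ExZ ?IH ?mulr0 ?addr0 //; try apply: intgZ;
    exact: intg_mul_bounded.
apply/funext => x.
rewrite (_ : (s' + s) * X x + (t' + t) = (s' * X x + t') + (s * X x + t)); last by ring.
rewrite (_ : (s' - s) * X x + (t' - t) = (s' * X x + t') - (s * X x + t)); last by ring.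
by move: (s' * X x + t') (s * X x + t) => a b; rewrite cosD cosB exprS; field.
Qed.

Lemma cos_bounded_pow s t i x : `|cos (s * X x + t) ^+ i| <= 1.
Proof. by rewrite normrX exprn_ile1 // cos_max. Qed.

Lemma Ex_cos_poly (p : {poly R}) s t :
  Ex mu (fun x => Y x * p.[cos (s * X x + t)]) = 0.
Proof.
pose h (i : 'I_(size p)) x := p`_i * (Y x * (cos (s * X x + t) ^+ i)).
have hi i : intg mu (fun x => Y x * (cos (s * X x + t) ^+ i)).
  apply: intg_mul_bounded; last by move=> x; exact: cos_bounded_pow.
  by apply: measurable_funX; exact: measurable_cos_affine.
rewrite (_ : (fun x => _) = fun x => \sum_(i < size p) h i x).
  rewrite Ex_sum => [|i]; last exact: intgZ.
  apply: big1 => i _; rewrite ExZ //.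
  have := Ex_cos_pow i s t 0 0.
  by under eq_fun do rewrite mul0r addr0 cos0 mulr1; move=> ->; rewrite mulr0.
apply/funext => x; rewrite horner_coef mulr_sumr; apply: eq_bigr => i _.
by rewrite mulrCA.
Qed.

Lemma Ex_mul_dominated (u : nat -> T -> R) (g : T -> R) :
  (forall n, measurable_fun setT (u n)) -> measurable_fun setT g ->
  (forall n x, `|u n x| <= 1) -> (forall x, u ^~ x @ \oo --> g x) ->
  (forall n, Ex mu (fun x => Y x * u n x) = 0) ->
  Ex mu (fun x => Y x * g x) = 0.
Proof.
move=> mu_ mg u1 ug u0.
have [|||||_] := @Ex_dominated _ _ _ mu (fun n x => Y x * u n x)
    (fun x => Y x * g x) (fun x => `|Y x|).
- by move=> n; apply: measurable_funM => //; exact: intg_meas Yi.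
- by apply: measurable_funM => //; exact: intg_meas Yi.
- by move=> x; apply: cvgM; [exact: cvg_cst|exact: ug].
- exact: integrable_norm.
- by move=> n x; rewrite normrM ler_piMr.
rewrite (_ : Ex mu \o _ = fun=> 0); last by apply/funext.
by move=> /(cvg_lim (@Rhausdorff R)) <-; rewrite lim_cst.
Qed.

Lemma measurable_sg : measurable_fun setT (@Num.sg R).
Proof.
rewrite (_ : @Num.sg R = \1_`]0, +oo[ \- \1_`]-oo, 0[)%R.
  by apply: measurable_funB; apply: measurable_indic; exact: measurable_itv.
apply/funext => x /=; rewrite !indicE !mem_setE !in_itv /= andbT.
by case: (ltgtP x 0) => [x0|x0|->];
  rewrite ?(ltr0_sg x0) ?(gtr0_sg x0) ?sgr0 ?subr0 ?sub0r ?subrr.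
Qed.

Lemma Ex_sgn_cos s t :
  Ex mu (fun x => Y x * Num.sg (cos (s * X x + t))) = 0.
Proof.
apply: (@Ex_mul_dominated (fun n x => (sgn_poly n).[cos (s * X x + t)])).
- move=> n; apply: (measurableT_comp _ (measurable_cos_affine s t)).
  apply: continuous_measurable_fun; exact: continuous_horner.
- by apply: measurableT_comp (measurable_cos_affine s t); exact: measurable_sg.
- by move=> n x; apply: sgn_poly_bound; exact: cos_max.
- by move=> x; apply: sgn_poly_cvg; exact: cos_max.
- by move=> n; exact: Ex_cos_poly.
Qed.

(* The shift by [1 / (N + 1)] makes the limit at [x = a] be [- 1]. *)
Lemma sg_sin_scaled (a x : R) : (fun N : nat =>
   Num.sg (sin ((x - a - N.+1%:R^-1) / N.+1%:R))) @ \oo -->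
  (2 * \1_`]a, +oo[ x - 1 : R).
Proof.
have pi0 := pi_gt0 R.
have Ei : \1_`]a, +oo[ x = (a < x)%R%:R :> R.
  by rewrite indicE mem_setE in_itv /= andbT.
apply: cvg_near_cst; have [ax|xa] := ltP a x.
- have xa0 : 0 < x - a by rewrite subr_gt0.
  have e0 : 0 < pi / (x - a) by rewrite divr_gt0.
  near=> N; rewrite Ei ax mulr1 (_ : 2 - 1 = 1); last by ring.
  apply: gtr0_sg.
  have N0 : 0 < N.+1%:R^-1 :> R by rewrite invr_gt0.
  have N1 : N.+1%:R^-1 < x - a.
    by near: N; exact: near_infty_natSinv_lt (PosNum xa0).
  have N2 : N.+1%:R^-1 < pi / (x - a).
    by near: N; exact: near_infty_natSinv_lt (PosNum e0).
  (* For large [N] the division by [N + 1] brings the argument between 0 and [pi], where the sine is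
     positive. *)
  apply: sin_gt0_pi; apply/andP; split; first by rewrite mulr_gt0 // subr_gt0.
  apply: (@le_lt_trans _ _ ((x - a) * N.+1%:R^-1)).
    by rewrite ler_wpM2r ?(ltW N0) // gerBl ltW.
  by rewrite mulrC -ltr_pdivlMr.
- have e0 : 0 < pi / (a - x + 1) by rewrite divr_gt0 // ltr_wpDl ?subr_ge0.
  near=> N; rewrite Ei ltNge xa /= mulr0 sub0r.
  apply: ltr0_sg; rewrite -oppr_gt0 -sinN.
  have N0 : 0 < N.+1%:R^-1 :> R by rewrite invr_gt0.
  have N1 : N.+1%:R^-1 <= 1 :> R by rewrite invf_le1 // ler1n.
  have N2 : N.+1%:R^-1 < pi / (a - x + 1).
    by near: N; exact: near_infty_natSinv_lt (PosNum e0).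
  move: (N.+1%:R^-1) N0 N1 N2 => e eg0 N1 N2.
  rewrite -mulNr; apply: sin_gt0_pi; apply/andP; split.
    by rewrite mulr_gt0 //; lra.
  apply: (@le_lt_trans _ _ ((a - x + 1) * e)).
    by rewrite ler_wpM2r ?(ltW eg0) //; lra.
  by rewrite mulrC -ltr_pdivlMr // ltr_wpDl ?subr_ge0.
Unshelve. all: by end_near. Qed.

(** The functions of [sg_sin_scaled] are signs of cosines with a shifted phase, and they tend to
    twice the indicator minus 1. Frequency and phase zero give [Ex mu Y = 0], which removes the
    constant. *)
Lemma Ex_gt a : Ex mu (fun x => Y x * \1_(X @^-1` `]a, +oo[) x) = 0.
Proof.
have m1 : measurable_fun setT (fun x => \1_`]a, +oo[ (X x) : R).
  by apply: measurableT_comp => //; apply: measurable_indic; exact: measurable_itv.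
have : Ex mu (fun x => Y x * (2 * \1_`]a, +oo[ (X x) - 1)) = 0.
  apply: (@Ex_mul_dominated (fun N x =>
      Num.sg (sin ((X x - a - N.+1%:R^-1) / N.+1%:R)))).
  - move=> N; apply: measurableT_comp; first exact: measurable_sg.
    apply: measurableT_comp.
      by apply: continuous_measurable_fun; exact: continuous_sin.
    apply: measurable_funM => //; apply: measurable_funB => //.
    exact: measurable_funB.
  - by apply: measurable_funB => //; exact: measurable_funM.
  - by move=> N x; rewrite normr_sg; case: eqP.
  - by move=> x; exact: sg_sin_scaled.
  - move=> N; have := Ex_sgn_cos N.+1%:R^-1 (- (a + N.+1%:R^-1) / N.+1%:R - pi / 2).
    congr (Ex mu _ = 0); apply/funext => x; congr (_ * Num.sg _).
    rewrite -cosBpihalf; congr cos; ring.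
have := YX 0 0.
under eq_fun do rewrite mul0r addr0 cos0 mulr1.
move=> Y0.
have i1 : intg mu (fun x => Y x * \1_`]a, +oo[ (X x)).
  apply: intg_mul_bounded => // x; rewrite indicE; case: (_ \in _) => /=.
    by rewrite normr1.
  by rewrite normr0.
rewrite (_ : (fun x => Y x * (_ - 1)) = fun x => 2 * (Y x * \1_`]a, +oo[ (X x)) - Y x).
  rewrite ExB ?ExZ //; last exact: intgZ.
  rewrite Y0 subr0 => /eqP; rewrite mulf_eq0 pnatr_eq0 /= => /eqP H.
  exact: H.
by apply/funext => x; ring.
Qed.

End Fourier1.

(** * Several variables: the generated sigma-algebra *)

Section Fourier.
Context d (T : measurableType d) (R : realType) (mu : probability T R).
Context (m : nat) (X : 'I_m -> T -> R).
Hypothesis Xm : forall k, measurable_fun setT (X k).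

(** The phase [s] lets the cosines alone cover the sines and the constants. *)
Definition trig_null (Z : T -> R) := intg mu Z /\
  forall (t : 'I_m -> R) s,
    Ex mu (fun x => Z x * cos (\sum_k t k * X k x + s)) = 0.

Lemma measurable_trig (t : 'I_m -> R) s :
  measurable_fun setT (fun x => cos (\sum_k t k * X k x + s)).
Proof.
apply: measurableT_comp.
  by apply: continuous_measurable_fun; exact: continuous_cos.
apply: measurable_funD => //; apply: measurable_sum => k.
exact: measurable_funM.
Qed.

Lemma intg_trig Z (t : 'I_m -> R) s : intg mu Z ->
  intg mu (fun x => Z x * cos (\sum_k t k * X k x + s)).
Proof.
move=> Zi; apply: intg_mul_bounded => //; first exact: measurable_trig.
by move=> x; exact: cos_max.
Qed.

Lemma intg_indic Z B : measurable B -> intg mu Z ->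
  intg mu (fun x => Z x * \1_B x).
Proof.
move=> mB Zi; apply: intg_mul_bounded => // x.
by rewrite indicE; case: (_ \in _); rewrite ?normr1 ?normr0.
Qed.

Lemma trig_null_lin Z Z' c : trig_null Z -> trig_null Z' ->
  trig_null (fun x => Z x + c * Z' x).
Proof.
move=> [Zi Z0] [Zi' Z0']; split; first by apply: intgD => //; exact: intgZ.
move=> t s; rewrite (_ : (fun x => _) = fun x =>
   Z x * cos (\sum_k t k * X k x + s) + c * (Z' x * cos (\sum_k t k * X k x + s))).
  have i1 := intg_trig t s Zi; have i2 := intg_trig t s Zi'.
  by rewrite ExD ?ExZ ?Z0 ?Z0' ?mulr0 ?addr0 //; exact: intgZ.
by apply/funext => x; ring.
Qed.

(** The one-variable result is applied to [Z] multiplied by a trigonometric function of all the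
    [X j], so that its conclusion is again orthogonality to all of these. *)
Lemma trig_null_gt Z k a : trig_null Z ->
  trig_null (fun x => Z x * \1_(X k @^-1` `]a, +oo[) x).
Proof.
move=> [Zi Z0]; split.
  by apply: intg_indic => //; rewrite -[X in measurable X]setTI; exact: Xm.
move=> t s.
have Yi := intg_trig t s Zi.
(* By the product formula, a further cosine of [X k] only moves the [k]-th frequency by [u] or
   [- u]. *)
have H u v : Ex mu (fun x => Z x * cos (\sum_j t j * X j x + s) *
    cos (u * X k x + v)) = 0.
  have i1 := intg_trig (fun j => t j + u * (j == k)%:R) (s + v) Zi.
  have i2 := intg_trig (fun j => t j - u * (j == k)%:R) (s - v) Zi.
  have E1 w x : \sum_j (t j + w * (j == k)%:R) * X j x =
      \sum_j t j * X j x + w * X k x.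
    rewrite (_ : w * X k x = \sum_j (w * (j == k)%:R * X j x)).
      by rewrite -big_split; apply: eq_bigr => j _; rewrite /= mulrDl.
    rewrite (bigD1 k) //= eqxx mulr1 big1 ?addr0 // => j /negbTE ->.
    by rewrite mulr0 mul0r.
  rewrite (_ : (fun x => _) = fun x =>
    2^-1 * (Z x * cos (\sum_j (t j + u * (j == k)%:R) * X j x + (s + v))) +
    2^-1 * (Z x * cos (\sum_j (t j - u * (j == k)%:R) * X j x + (s - v)))).
    by rewrite ExD ?ExZ ?Z0 ?mulr0 ?addr0 //; exact: intgZ.
  apply/funext => x; rewrite E1.
  under [X in _ = _ + _ * (_ * cos (X + _))]eq_bigr do rewrite -mulNr.
  rewrite E1 mulNr.
  set y := \sum_j _; rewrite (_ : y + u * X k x + (s + v) = (y + s) + (u * X k x + v)); last by ring.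
  rewrite (_ : y - u * X k x + (s - v) = (y + s) - (u * X k x + v)); last by ring.
  by move: (y + s) (u * X k x + v) => p q; rewrite cosD cosB; field.
rewrite -[RHS](Ex_gt Yi (Xm k) H a); congr (Ex mu _).
by apply/funext => x; rewrite mulrAC.
Qed.

(* The sets whose indicators can be multiplied into a function orthogonal to all
   the trigonometric functions of the [X k] form a sigma-algebra; no pi-lambda
   argument is needed. *)
Definition trig_closed (B : set T) :=
  measurable B /\ forall Z, trig_null Z -> trig_null (fun x => Z x * \1_B x).

Lemma trig_closedC B : trig_closed B -> trig_closed (~` B).
Proof.
move=> [mB H]; split; first exact: measurableC.
move=> Z Z0; have := trig_null_lin (-1) Z0 (H Z Z0).
congr (trig_null _); apply/funext => x; rewrite !indicE in_setC.
by case: (_ \in _) => /=; ring.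
Qed.

Lemma trig_closedI A B : trig_closed A -> trig_closed B -> trig_closed (A `&` B).
Proof.
move=> [mA HA] [mB HB]; split; first exact: measurableI.
move=> Z Z0; have := HB _ (HA Z Z0).
by congr (trig_null _); apply/funext => x; rewrite -mulrA !indicE in_setI -natrM mulnb.
Qed.

Lemma trig_closed0 : trig_closed set0.
Proof.
split=> // Z [Zi _]; rewrite (_ : (fun x => _) = fun=> 0).
  split; first exact: intg_cst.
  by move=> t s; under eq_fun do rewrite mul0r; rewrite Ex_cst.
by apply/funext => x; rewrite indic0 mulr0.
Qed.

Lemma trig_closedU A B : trig_closed A -> trig_closed B -> trig_closed (A `|` B).
Proof.
move=> hA hB; rewrite -[_ `|` _]setCK setCU.
by apply: trig_closedC; apply: trig_closedI; exact: trig_closedC.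
Qed.

(** The finite unions pass to the limit by dominated convergence, their indicators being eventually
    constant at each point. *)
Lemma trig_closed_bigcup (F : (set T)^nat) :
  (forall n, trig_closed (F n)) -> trig_closed (\bigcup_n F n).
Proof.
move=> hF; have mF : measurable (\bigcup_n F n).
  by apply: bigcup_measurable => n _; have [] := hF n.
split=> // Z Z0; have [Zi _] := Z0.
have hU n : trig_closed (\big[setU/set0]_(k < n) F k).
  elim: n => [|n IH]; first by rewrite big_ord0; exact: trig_closed0.
  by rewrite big_ord_recr /=; exact: trig_closedU.
split; first exact: intg_indic.
move=> t s; have Yi := intg_trig t s Zi.
rewrite (_ : (fun x => _) = fun x =>
  Z x * cos (\sum_k t k * X k x + s) * \1_(\bigcup_n F n) x).
  apply: (Ex_mul_dominated Yi (u := fun n x => \1_(\big[setU/set0]_(k < n) F k) x)).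
  - by move=> n; apply: measurable_indic; have [] := hU n.
  - exact: measurable_indic.
  - by move=> n x; rewrite indicE; case: (_ \in _); rewrite ?normr1 ?normr0.
  - move=> x; apply: cvg_near_cst.
    have [[k _ Fkx]|nF] := pselect ((\bigcup_n F n) x).
      exists k.+1 => // n /= kn; rewrite !indicE !mem_set //; first by exists k.
      by rewrite -bigcup_mkord; exists k.
    apply: nearW => n; rewrite !indicE !memNset //.
    by move=> H; apply: nF; move: H; rewrite -bigcup_mkord => -[k _ Fk]; exists k.
  - move=> n; have [_ /(_ _ Z0) [_ /(_ t s)]] := hU n.
    by congr (Ex mu _ = 0); apply/funext => x; rewrite mulrAC.
by apply/funext => x; rewrite mulrAC.
Qed.

Lemma trig_closed_preimage k (B : set R) : measurable B -> trig_closed (X k @^-1` B).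
Proof.
rewrite [measurable](RGenOInfty.measurableE R).
move: B; apply: smallest_sub.
  split=> [|A|F].
  - by rewrite preimage_set0; exact: trig_closed0.
  - by rewrite setTD preimage_setC; exact: trig_closedC.
  - by rewrite preimage_bigcup; exact: trig_closed_bigcup.
move=> _ [a ->]; split.
  by rewrite -[X in measurable X]setTI; exact: Xm.
by move=> Z Z0; exact: trig_null_gt.
Qed.

Lemma trig_null_sigma Z : trig_null Z ->
  forall B, generated_sigma_algebra X B -> Ex mu (fun x => Z x * \1_B x) = 0.
Proof.
move=> Z0 B SB; have [_ /(_ Z Z0) [_ /(_ (fun=> 0) 0)]] : trig_closed B.
  move: B SB; apply: smallest_sub.
    split=> [|A|F]; first exact: trig_closed0.
      by rewrite setTD; exact: trig_closedC.
    exact: trig_closed_bigcup.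
  by move=> _ [k _ [C mC <-]]; rewrite setTI; exact: trig_closed_preimage.
congr (Ex mu _ = 0); apply/funext => x.
by rewrite big1 => [|k _]; rewrite ?mul0r ?addr0 ?cos0 ?mulr1.
Qed.

End Fourier.

(** * Gaussian families *)

Section RealTrig.
Context {R : realType}.
Implicit Types (x y s : R).

(** The increments are restricted to [1 / (n + 1)] because dominated convergence is applied to
    sequences. *)
Lemma seq_derive (f : R -> R) (df : R) : is_derive (0 : R) (1 : R) f df ->
  (fun n : nat => n.+1%:R * (f n.+1%:R^-1 - f 0)) @ \oo --> df.
Proof.
move=> [fd fE].
have c0 : (@harmonic R) @ \oo --> 0^'.
  move=> B B0; have {}B0 : nbhs (0 : R) [set y : R | y != 0 -> B y] := B0.
  have H : \forall n \near \oo, (harmonic n : R) != 0 -> B (harmonic n).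
    exact: (cvg_harmonic B0).
  suff : \forall n \near \oo, B (harmonic n : R) by [].
  by apply: filterS H => n; apply; rewrite gt_eqF // harmonic_gt0.
rewrite -fE; have := cvg_comp _ _ c0 fd; apply: cvg_trans.
apply: near_eq_cvg; apply: nearW => n /=.
by rewrite invrK addr0 [_%:A]mulr1.
Qed.

Lemma lipschitz1 (f df : R -> R) : (forall x, is_derive x (1 : R) f (df x)) ->
  (forall x, `|df x| <= 1) -> forall x y, `|f x - f y| <= `|x - y|.
Proof.
move=> fd d1 x y; wlog xy : x y / x <= y.
  by move=> H; case: (leP x y) => [/H//|/ltW /H]; rewrite distrC (distrC y).
have [|c _ E] := @MVT_segment _ f df x y xy (fun z _ => fd z).
  apply: continuous_subspaceT => z.
  by apply: differentiable_continuous; apply/derivable1_diffP; have [] := fd z.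
by rewrite distrC E normrM (distrC x) ler_piMl.
Qed.

Lemma cosB_le x y : `|cos x - cos y| <= `|x - y|.
Proof.
apply: (@lipschitz1 cos (fun x => - sin x)) => z.
by rewrite normrN sin_max.
Qed.

Lemma sinB_le x y : `|sin x - sin y| <= `|x - y|.
Proof. by apply: (@lipschitz1 sin cos) => z; exact: cos_max. Qed.

Lemma sin_le_norm x : `|sin x| <= `|x|.
Proof.
by have := sinB_le x 0; rewrite sin0 !subr0.
Qed.

Lemma one_sub_cos x : 1 - cos x = 2 * sin (x / 2) ^+ 2.
Proof.
rewrite {1}[x]splitr cosD; have := cos2Dsin2 (x / 2).
rewrite -!expr2; move: (cos _ ^+ 2) (sin _ ^+ 2) => c s; lra.
Qed.

Lemma one_sub_cos_le x : 1 - cos x <= x ^+ 2 / 2.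
Proof.
rewrite one_sub_cos; have := sin_le_norm (x / 2).
rewrite -ler_sqr ?nnegrE // !real_normK ?num_real // exprMn.
rewrite exprVn; move: (sin _ ^+ 2) (x ^+ 2) => a b; lra.
Qed.

Lemma one_sub_cos_ge0 x : 0 <= 1 - cos x.
Proof. by rewrite subr_ge0 cos_le1. Qed.

Lemma is_derive_affine x y (h : R) : is_derive h (1 : R) (fun h => x + h * y) y.
Proof.
rewrite (_ : (fun h => _) = cst x + y \*: id); last first.
  by apply/funext => z; rewrite mulrC.
by apply: is_derive_eq; rewrite add0r [_ *: _]mulr1.
Qed.

(** Writing the derivative [- sin] as a cosine with phase [pi / 2] keeps differentiation within the
    family of cosines. *)
Lemma cos_quotient_cvg x y : (fun n : nat =>
  n.+1%:R * (cos (x + n.+1%:R^-1 * y) - cos x)) @ \oo --> y * cos (x + pi / 2).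
Proof.
have H : is_derive (0 : R) (1 : R) (fun h => cos (x + h * y))
    (- sin (x + 0 * y) * y).
  apply: (@is_derive1_comp _ cos (fun h => x + h * y)).
  exact: is_derive_affine.
have := seq_derive H; rewrite mul0r addr0 cosDpihalf mulrN mulNr mulrC.
by [].
Qed.

(** By the half-angle formula the sequence is the square of [2 (n + 1) sin (y / (2 (n + 1)))]. *)
Lemma cos_square_cvg y : (fun n : nat =>
  2 * n.+1%:R ^+ 2 * (1 - cos (n.+1%:R^-1 * y))) @ \oo --> y ^+ 2.
Proof.
have H : is_derive (0 : R) (1 : R) (fun h => sin (0 + h * (y / 2)))
    (cos (0 + 0 * (y / 2)) * (y / 2)).
  apply: (@is_derive1_comp _ sin (fun h => 0 + h * (y / 2))).
  exact: is_derive_affine.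
have {H} := seq_derive H; rewrite mul0r !addr0 cos0 mul1r sin0 => c.
have c2 : (fun n : nat => 2 * (n.+1%:R * (sin (0 + n.+1%:R^-1 * (y / 2)) - 0)))
    @ \oo --> (2 * (y / 2) : R).
  by apply: cvgM => //; exact: cvg_cst.
rewrite (_ : y ^+ 2 = (2 * (y / 2)) * (2 * (y / 2))); last by field.
rewrite (_ : (fun n : nat => _) = fun n : nat =>
   (2 * (n.+1%:R * (sin (0 + n.+1%:R^-1 * (y / 2)) - 0))) *
   (2 * (n.+1%:R * (sin (0 + n.+1%:R^-1 * (y / 2)) - 0)))); first exact: cvgM.
apply/funext => n; rewrite one_sub_cos add0r subr0 -(mulrA _ y); ring.
Qed.

(** For [A], [B], [C] the covariances of [w, w], of [v, w] and of [v, v], the exponent is minus half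
    the variance at [w + h v], where [h = 1 / (n + 1)]. *)
Lemma exp_quotient_cvg (A B C : R) : (fun n : nat =>
  n.+1%:R * (expR (- 2^-1 * (A + n.+1%:R^-1 * (2 * B) + n.+1%:R^-1 ^+ 2 * C)) -
    expR (- 2^-1 * A))) @ \oo --> - B * expR (- 2^-1 * A).
Proof.
pose q h := - 2^-1 * (A + h * (2 * B) + h ^+ 2 * C).
have Hq : is_derive (0 : R) (1 : R) q (- B).
  pose p : {poly R} := (- 2^-1 * A)%:P + (- B) *: 'X + (- 2^-1 * C) *: 'X^2.
  have qp (h : R) : - 2^-1 * (A + h * (2 * B) + h ^+ 2 * C) = p.[h].
    have -> : p.[h] = - 2^-1 * A + - B * h + - 2^-1 * C * h * h.
      by rewrite /p !hornerE.
    by field.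
  rewrite (_ : q = horner p); last exact/funext.
  apply: is_derive_eq.
  by rewrite /p !(derivD, derivC, derivZ, derivX, derivXn) !hornerE.
have H : is_derive (0 : R) (1 : R) (fun h => expR (q h)) (expR (q 0) * - B).
  exact: (@is_derive1_comp _ expR q).
have q0 : q 0 = - 2^-1 * A by rewrite /q mul0r expr0n mul0r !addr0.
by have := seq_derive H; rewrite q0 [_ * - B]mulrC.
Qed.

End RealTrig.

(* Orthogonal for the centered Gaussian law of variance [s]. *)
Fixpoint hermite (R : pzRingType) (s x : R) (n : nat) : R :=
  match n with
  | 0 => 1
  | n1.+1 =>
    match n1 with
    | 0 => x
    | n2.+1 => x * hermite s x n1 - n1%:R * (s * hermite s x n2)
    end
  end.

(** At [n = 0] the predecessor is again 0, but its coefficient vanishes; one recursion thus serves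
    for all [n]. *)
Lemma hermiteS (R : pzRingType) (s x : R) n :
  hermite s x n.+1 = x * hermite s x n - n%:R * (s * hermite s x n.-1).
Proof. by case: n => [|n] //=; rewrite mul0r subr0 mulr1. Qed.

(** * Gaussian integration by parts and Hermite polynomials *)

Section GaussianFamily.
Context d (T : measurableType d) (R : realType) (mu : probability T R).
Context (V : lmodType R) (K : hilbertType R) (J : {linear V -> K}).
Variable X : V -> T -> R.
Hypothesis X_lin : forall a u v x, X (a *: u + v) x = a * X u x + X v x.
Hypothesis X_meas : forall v, measurable_fun setT (X v).
Hypothesis X_cos : forall v,
  Ex mu (fun x => cos (X v x)) = expR (- 2^-1 * hdot (J v) (J v)).
Hypothesis X_sin : forall v, Ex mu (fun x => sin (X v x)) = 0.

Definition cov u v := hdot (J u) (J v).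

Lemma covC u v : cov u v = cov v u.
Proof. exact: hdotC. Qed.

Lemma covDr a u v w : cov w (a *: u + v) = a * cov w u + cov w v.
Proof. by rewrite /cov linearP linearPr. Qed.

Lemma covDl a u v w : cov (a *: u + v) w = a * cov u w + cov v w.
Proof. by rewrite covC covDr !(covC w). Qed.

Lemma cov_ge0 v : 0 <= cov v v.
Proof. by rewrite /cov hdotE sqr_ge0. Qed.

Lemma X0 x : X 0 x = 0.
Proof.
have := X_lin 1 0 0 x; rewrite scaler0 addr0 mul1r => /eqP.
by rewrite -subr_eq subrr eq_sym => /eqP.
Qed.

Lemma cov0 v : cov v 0 = 0.
Proof. by rewrite /cov linear0 linear0r. Qed.

Definition trig_moment (P : T -> R) (w : V) (s : R) :=
  Ex mu (fun x => P x * cos (X w x + s)).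

Local Notation C := trig_moment.

Lemma measurable_cosX w s : measurable_fun setT (fun x => cos (X w x + s)).
Proof.
apply: measurableT_comp; last exact: measurable_funD.
by apply: continuous_measurable_fun; exact: continuous_cos.
Qed.

Lemma intg_cosX P w s : intg mu P -> intg mu (fun x => P x * cos (X w x + s)).
Proof.
move=> Pi; apply: intg_mul_bounded => //; first exact: measurable_cosX.
by move=> x; exact: cos_max.
Qed.

Lemma trig_moment1 w s : C (fun=> 1) w s = cos s * expR (- 2^-1 * cov w w).
Proof.
rewrite /C (_ : (fun x => _) = fun x => cos s * cos (X w x) - sin s * sin (X w x)).
  have ic : intg mu (fun x => cos (X w x)).
    have := intg_cosX w 0 (intg_cst mu 1).
    by under eq_fun do rewrite mul1r addr0.
  have isn : intg mu (fun x => sin (X w x)).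
    have := intg_cosX w (- (pi / 2)) (intg_cst mu 1).
    by under eq_fun do rewrite mul1r cosBpihalf.
  by rewrite ExB ?ExZ ?X_cos ?X_sin ?mulr0 ?subr0 //; exact: intgZ.
by apply/funext => x; rewrite mul1r cosD; ring.
Qed.

Lemma trig_moment_lin P Q a w s : intg mu P -> intg mu Q ->
  C (fun x => P x + a * Q x) w s = C P w s + a * C Q w s.
Proof.
move=> Pi Qi; have i1 := intg_cosX w s Pi; have i2 := intg_cosX w s Qi.
rewrite /C -ExZ // -ExD //; last exact: intgZ.
by congr (Ex mu _); apply/funext => x; ring.
Qed.

(** Differentiation under the expectation in the direction [u]. The cosine is 1-Lipschitz, so the
    quotients are dominated by [|X u x * P x|]. *)
Lemma trig_moment_quotient P u w s : intg mu P ->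
  intg mu (fun x => X u x * P x) ->
  (fun n : nat => n.+1%:R * (C P (n.+1%:R^-1 *: u + w) s - C P w s)) @ \oo -->
  C (fun x => X u x * P x) w (s + pi / 2).
Proof.
move=> Pi uPi.
pose f n x := P x * (n.+1%:R * (cos (X w x + s + n.+1%:R^-1 * X u x) -
   cos (X w x + s))).
have Ef : (fun n => Ex mu (f n)) =
    (fun n : nat => n.+1%:R * (C P (n.+1%:R^-1 *: u + w) s - C P w s)).
  apply/funext => n; rewrite /C -ExB; try exact: intg_cosX.
  rewrite -ExZ; last by apply: intgB; exact: intg_cosX.
  congr (Ex mu _); apply/funext => x; rewrite /f X_lin.
  by rewrite (_ : n.+1%:R^-1 * X u x + X w x + s = X w x + s + n.+1%:R^-1 * X u x); ring.
rewrite -Ef.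
have mP := intg_meas Pi.
have [|||||_ c] := @Ex_dominated _ _ _ mu f
   (fun x => P x * (X u x * cos (X w x + s + pi / 2))) (fun x => `|X u x * P x|).
- move=> n; apply: measurable_funM => //; apply: measurable_funM => //.
  apply: measurable_funB; last exact: measurable_cosX.
  apply: measurableT_comp.
    by apply: continuous_measurable_fun; exact: continuous_cos.
  by apply: measurable_funD; [exact: measurable_funD|exact: measurable_funM].
- apply: measurable_funM => //; apply: measurable_funM => //.
  by have := measurable_cosX w (s + pi / 2); under eq_fun do rewrite addrA.
- move=> x; apply: cvgM; first exact: cvg_cst.
  exact: cos_quotient_cvg.
- exact: integrable_norm.
- move=> n x; rewrite /f normrM [X in _ <= X]normrM mulrC ler_wpM2r //.
  rewrite normrM; have := cosB_le (X w x + s + n.+1%:R^-1 * X u x) (X w x + s).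
  rewrite (_ : X w x + s + _ - _ = n.+1%:R^-1 * X u x); last by ring.
  rewrite normrM (ger0_norm (ler0n R _)) ger0_norm ?invr_ge0 // => H.
  have n0 : 0 < n.+1%:R :> R by rewrite ltr0n.
  by rewrite -ler_pdivlMl.
rewrite (_ : C _ _ _ = Ex mu (fun x => P x * (X u x * cos (X w x + s + pi / 2)))) //.
by congr (Ex mu _); apply/funext => x; rewrite addrA; ring.
Qed.

Lemma trig_moment_cvg P u w s : intg mu P ->
  (fun n : nat => C P (n.+1%:R^-1 *: u + w) s) @ \oo --> C P w s.
Proof.
move=> Pi; have mP := intg_meas Pi.
have [|||||_ c] := @Ex_dominated _ _ _ mu
   (fun n x => P x * cos (X (n.+1%:R^-1 *: u + w) x + s))
   (fun x => P x * cos (X w x + s)) (fun x => `|P x|).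
- by move=> n; apply: measurable_funM => //; exact: measurable_cosX.
- by apply: measurable_funM => //; exact: measurable_cosX.
- move=> x; apply: cvgM; first exact: cvg_cst.
  have c1 : (fun n : nat => X (n.+1%:R^-1 *: u + w) x + s) @ \oo --> X w x + s.
    apply: cvgD; last exact: cvg_cst.
    rewrite (funext (fun n : nat => X_lin n.+1%:R^-1 u w x)).
    rewrite -[X in _ --> X]add0r; apply: cvgD; last exact: cvg_cst.
    rewrite -[X in _ --> X](mul0r (X u x)); apply: cvgM; last exact: cvg_cst.
    exact: cvg_harmonic.
  by apply: (cvg_comp _ _ c1); exact: continuous_cos.
- exact: integrable_norm.
- by move=> n x; rewrite normrM ler_piMr // cos_max.
exact: c.
Qed.

(* [P'] is the derivative of [P] in the direction [v] for Gaussian integration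
   by parts; [v] ranges over an infinite-dimensional space in which functions on
   [T] cannot be differentiated literally. *)
Definition ibp v (P P' : T -> R) := forall w s,
  C (fun x => X v x * P x) w s = C P' w s + cov v w * C P w (s + pi / 2).

(** Both sides are limits of the same difference quotients in the direction [v], the left one under
    the expectation and the right one in the explicit Gaussian formula. *)
Lemma ibp1 v : intg mu (X v) -> ibp v (fun=> 1) (fun=> 0).
Proof.
move=> vi w s.
(* Starting at the phase [s - pi / 2] makes the derivative land on [s]. *)
have := @trig_moment_quotient (fun=> 1) v w (s - pi / 2) (intg_cst mu 1).
rewrite (_ : (fun x => X v x * 1) = X v); last by apply/funext => x; rewrite mulr1.
rewrite subrK => /(_ vi) H.
have /(cvg_unique (@Rhausdorff R) H) -> // : (fun n : nat => n.+1%:R *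
    (C (fun=> 1) (n.+1%:R^-1 *: v + w) (s - pi / 2) -
     C (fun=> 1) w (s - pi / 2))) @ \oo -->
    C (fun=> 0) w s + cov v w * C (fun=> 1) w (s + pi / 2).
have -> : C (fun=> 0) w s = 0.
  rewrite /C (_ : (fun x => _) = fun=> 0) ?Ex_cst //.
  by apply/funext => x; rewrite mul0r.
rewrite !trig_moment1 cosDpihalf cosBpihalf add0r.
rewrite (_ : cov v w * _ = sin s * (- cov v w * expR (- 2^-1 * cov w w))); last by ring.
have := @exp_quotient_cvg R (cov w w) (cov v w) (cov v v).
move=> /(cvgM (cvg_cst (sin s))) H1.
rewrite (_ : (fun n : nat => _) = fun n : nat => sin s * (n.+1%:R *
   (expR (- 2^-1 * (cov w w + n.+1%:R^-1 * (2 * cov v w) +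
     n.+1%:R^-1 ^+ 2 * cov v v)) - expR (- 2^-1 * cov w w)))).
  exact: H1.
apply/funext => n; rewrite trig_moment1 cosBpihalf.
rewrite covDl !covDr (covC w v).
rewrite (_ : n.+1%:R^-1 * (n.+1%:R^-1 * cov v v + cov v w) + _ = cov w w + n.+1%:R^-1 * (2 * cov v w) +
     n.+1%:R^-1 ^+ 2 * cov v v); last by ring.
ring.
Qed.

(** The identity for [P] is differentiated with respect to [w] in the direction [u]. The new term
    [cov v u * P x] comes from the factor [cov v w], which is linear in [w]. *)
Lemma ibp_mul u v P P' : ibp v P P' -> intg mu P -> intg mu P' ->
  intg mu (fun x => X u x * P x) -> intg mu (fun x => X u x * P' x) ->
  intg mu (fun x => X v x * P x) -> intg mu (fun x => X u x * (X v x * P x)) ->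
  ibp v (fun x => X u x * P x) (fun x => X u x * P' x + cov v u * P x).
Proof.
move=> H Pi Pi' uPi uPi' vPi uvPi w s.
have q1 := @trig_moment_quotient _ u w (s - pi / 2) vPi uvPi.
have q2 := @trig_moment_quotient _ u w (s - pi / 2) Pi' uPi'.
have q3 := @trig_moment_quotient _ u w s Pi uPi.
have c4 := @trig_moment_cvg P u w s Pi.
rewrite subrK in q1 q2.
rewrite trig_moment_lin //.
rewrite (_ : (fun x => X v x * (X u x * P x)) = fun x => X u x * (X v x * P x)); last first.
  by apply/funext => x; rewrite mulrCA.
apply: (cvg_unique (@Rhausdorff R) q1).
rewrite (_ : (fun n : nat => _) = fun n : nat =>
  n.+1%:R * (C P' (n.+1%:R^-1 *: u + w) (s - pi / 2) - C P' w (s - pi / 2)) +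
  cov v u * C P (n.+1%:R^-1 *: u + w) s +
  cov v w * (n.+1%:R * (C P (n.+1%:R^-1 *: u + w) s - C P w s))).
  apply: cvgD; first apply: cvgD => //.
  - by apply: cvgM => //; exact: cvg_cst.
  - by apply: cvgM => //; exact: cvg_cst.
apply/funext => n; rewrite !H subrK covDr.
have n0 : n.+1%:R != 0 :> R by rewrite pnatr_eq0.
by field.
Qed.

Lemma ibp_lin v P P' Q Q' a : ibp v P P' -> ibp v Q Q' ->
  intg mu P -> intg mu P' -> intg mu Q -> intg mu Q' ->
  intg mu (fun x => X v x * P x) -> intg mu (fun x => X v x * Q x) ->
  ibp v (fun x => P x + a * Q x) (fun x => P' x + a * Q' x).
Proof.
move=> HP HQ *; move=> w s; rewrite !trig_moment_lin //.
rewrite (_ : (fun x => X v x * _) = fun x => X v x * P x + a * (X v x * Q x)).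
  by rewrite trig_moment_lin // HP HQ; ring.
by apply/funext => x; ring.
Qed.


Lemma intg_pow_le j k (f : T -> R) : (j <= k.*2)%N -> measurable_fun setT f ->
  intg mu (fun x => f x ^+ k.*2) -> intg mu (fun x => f x ^+ j).
Proof.
move=> jk mf fi; apply: (@intg_le _ _ _ _ (fun x => 1 + f x ^+ k.*2)).
- exact: measurable_funX.
- by apply: intgD => //; exact: intg_cst.
- move=> x; rewrite normrX -(ger0_norm (exprn_even_ge0 (f x) _)) ?odd_double //.
  rewrite normrX; have [f1|f1] := leP `|f x| 1.
    by apply: (@le_trans _ _ 1); [rewrite exprn_ile1|rewrite lerDl exprn_ge0].
  apply: (@le_trans _ _ (`|f x| ^+ k.*2)); last by rewrite lerDr.
  by rewrite ler_weXn2l // ltW.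
Qed.

(** The approximants [2 (n + 1)^2 (1 - cos (X v / (n + 1)))] of the square are bounded, so their
    products with [Q] are integrable before the moment in question is known. *)
Lemma intg_sqr_mul v (Q : T -> R) c : intg mu Q -> (forall x, 0 <= Q x) ->
  (forall n : nat, 2 * n.+1%:R ^+ 2 *
    Ex mu (fun x => Q x * (1 - cos (n.+1%:R^-1 * X v x))) <= c) ->
  intg mu (fun x => X v x ^+ 2 * Q x).
Proof.
move=> Qi Q0 Qc; have mQ := intg_meas Qi.
have ui n : intg mu (fun x => Q x * (1 - cos (n.+1%:R^-1 * X v x))).
  have := @intgB _ _ _ mu _ _ Qi (@intg_cosX Q (n.+1%:R^-1 *: v) 0 Qi).
  congr (intg mu _); apply/funext => x.
  by rewrite addr0 -[_ *: v]addr0 X_lin X0 addr0; ring.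
have [||||||//] := @Ex_fatou _ _ _ mu (fun n x => 2 * n.+1%:R ^+ 2 *
   (Q x * (1 - cos (n.+1%:R^-1 * X v x)))) (fun x => X v x ^+ 2 * Q x) c.
- by move=> n; exact: intgZ.
- move=> n x; apply: mulr_ge0; first by rewrite mulr_ge0 // sqr_ge0.
  by rewrite mulr_ge0 // one_sub_cos_ge0.
- by apply: measurable_funM => //; exact: measurable_funX.
- by move=> x; rewrite mulr_ge0 // sqr_ge0.
- apply: aeW => x.
  rewrite (_ : (fun n : nat => _) = fun n : nat =>
    2 * n.+1%:R ^+ 2 * (1 - cos (n.+1%:R^-1 * X v x)) * Q x).
    by apply: cvgM; [exact: cos_square_cvg|exact: cvg_cst].
  by apply/funext => n; ring.
- by move=> n; rewrite ExZ.
Qed.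

Lemma X_scale a v x : X (a *: v) x = a * X v x.
Proof. by rewrite -[_ *: v]addr0 X_lin X0 addr0. Qed.

(* Fatou's lemma along [h = 1 / (k + 1)], as [2 (1 - cos (h X)) / h ^ 2] tends to
   [X ^ 2]; integration by parts bounds the expectations uniformly in [k]. *)
Lemma gaussian_moment_step v n : (0 < n)%N ->
  intg mu (fun x => X v x ^+ n.*2) ->
  ibp v (fun x => X v x ^+ n.*2.-1)
    (fun x => n.*2.-1%:R * cov v v * X v x ^+ n.*2.-2) ->
  intg mu (fun x => X v x ^+ n.+1.*2).
Proof.
case: n => // n _; set N := n.+1.*2 => Ni H.
have Ij j : (j <= N)%N -> intg mu (fun x => X v x ^+ j).
  by move=> jN; apply: (@intg_pow_le _ n.+1).
have i1 : intg mu (fun x => X v x ^+ N.-1) by apply: Ij; rewrite leq_pred.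
have i2 : intg mu (fun x => X v x ^+ N.-2).
  by apply: Ij; rewrite (leq_trans (leq_pred _)) // leq_pred.
(* The bounds [E2] and [E3] below contribute the summands [N.-1%:R / 2] and 1; the factor [h ^+ 2]
   common to both cancels [k.+1%:R ^+ 2]. *)
pose c := (2 * (N.-1%:R / 2 + 1)) * (cov v v * Ex mu (fun x => X v x ^+ N)).
rewrite (_ : (fun x => _) = fun x => X v x ^+ 2 * X v x ^+ N); last first.
  by apply/funext => x; rewrite doubleS -addn2 exprD mulrC.
apply: (@intg_sqr_mul v (fun x => X v x ^+ N) c) => // [x|k].
  by rewrite exprn_even_ge0 // odd_double.
set h := k.+1%:R^-1.
have h0 : 0 < h by rewrite invr_gt0 ltr0n.
have XN x : X v x * X v x ^+ N.-1 = X v x ^+ N by rewrite -exprS.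
have XN2 x : X v x ^+ 2 * X v x ^+ N.-2 = X v x ^+ N by rewrite -exprD.
have Hh : forall w, C (fun x => X v x ^+ N) w 0 =
    N.-1%:R * cov v v * C (fun x => X v x ^+ N.-2) w 0 +
    cov v w * C (fun x => X v x ^+ N.-1) w (pi / 2).
  move=> w; have := H w 0; rewrite add0r => E.
  rewrite (_ : (fun x => X v x ^+ N) = fun x => X v x * X v x ^+ N.-1); last first.
    by apply/funext => x; rewrite XN.
  rewrite E; congr (_ + _).
  by rewrite /C -ExZ; [congr (Ex mu _); apply/funext => x; ring|exact: intg_cosX].
(* The difference of [Hh] at [0] and at [h *: v]: the covariance with [0] vanishes, and the phase
   [pi / 2] turns the cosine into minus the sine. *)
have E1 : Ex mu (fun x => X v x ^+ N * (1 - cos (h * X v x))) =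
  N.-1%:R * cov v v * Ex mu (fun x => X v x ^+ N.-2 * (1 - cos (h * X v x))) +
  h * cov v v * Ex mu (fun x => X v x ^+ N.-1 * sin (h * X v x)).
  have EB j : (j <= N)%N -> Ex mu (fun x => X v x ^+ j * (1 - cos (h * X v x))) =
      C (fun x => X v x ^+ j) 0 0 - C (fun x => X v x ^+ j) (h *: v) 0.
    move=> jN; rewrite /C -ExB; try by apply: intg_cosX; exact: Ij.
    congr (Ex mu _); apply/funext => x.
    by rewrite X0 X_scale !addr0 cos0; ring.
  rewrite !EB //; last by rewrite (leq_trans (leq_pred _)) // leq_pred.
  rewrite !Hh cov0.
  have -> : C (fun x => X v x ^+ N.-1) (h *: v) (pi / 2) =
      - 1 * Ex mu (fun x => X v x ^+ N.-1 * sin (h * X v x)).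
    rewrite -ExZ.
      congr (Ex mu _); apply/funext => x.
      by rewrite cosDpihalf X_scale; ring.
    have := intg_cosX (h *: v) (- (pi / 2)) i1.
    congr (intg mu _); apply/funext => x.
    by rewrite cosBpihalf X_scale.
  have -> : cov v (h *: v) = h * cov v v.
    by rewrite -[h *: v]addr0 covDr cov0 addr0.
  ring.
(* Here and in [E3] each missing power of [X v] is gained together with a factor [h], so that only
   the known moment of order [N] remains. *)
have E2 : Ex mu (fun x => X v x ^+ N.-2 * (1 - cos (h * X v x))) <=
    h ^+ 2 / 2 * Ex mu (fun x => X v x ^+ N).
  rewrite -ExZ //; apply: Ex_le => [||x].
  - have := intgB i2 (intg_cosX (h *: v) 0 i2).
    congr (intg mu _); apply/funext => x.
    by rewrite X_scale addr0; ring.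
  - exact: intgZ.
  - rewrite -XN2 mulrA mulrC ler_wpM2r //.
      by rewrite exprn_even_ge0 // /N doubleS /= odd_double.
    by apply: le_trans (one_sub_cos_le _) _; rewrite exprMn; lra.
have E3 : Ex mu (fun x => X v x ^+ N.-1 * sin (h * X v x)) <=
    h * Ex mu (fun x => X v x ^+ N).
  rewrite -ExZ //; apply: Ex_le => [||x].
  - have := intg_cosX (h *: v) (- (pi / 2)) i1.
    congr (intg mu _); apply/funext => x.
    by rewrite cosBpihalf X_scale.
  - exact: intgZ.
  - apply: (le_trans (ler_norm _)); rewrite normrM.
    apply: (@le_trans _ _ (`|X v x ^+ N.-1| * `|h * X v x|)).
      by rewrite ler_wpM2l // sin_le_norm.
    rewrite normrM (gtr0_norm h0) mulrCA -normrM [_ * X v x]mulrC XN.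
    by rewrite ger0_norm // exprn_even_ge0 // odd_double.
have c0 := cov_ge0 v.
have M0 : 0 <= Ex mu (fun x => X v x ^+ N).
  by apply: Ex_ge0 => x; rewrite exprn_even_ge0 // odd_double.
rewrite E1.
apply: (@le_trans _ _ (2 * k.+1%:R ^+ 2 * (N.-1%:R * cov v v *
   (h ^+ 2 / 2 * Ex mu (fun x => X v x ^+ N)) +
    h * cov v v * (h * Ex mu (fun x => X v x ^+ N))))).
  rewrite ler_wpM2l ?mulr_ge0 ?exprn_ge0 // lerD // ler_wpM2l //.
    by rewrite mulr_ge0.
  by rewrite mulr_ge0 // ltW.
rewrite /c /h le_eqVlt; apply/orP; left; apply/eqP.
have n0 : k.+1%:R != 0 :> R by rewrite pnatr_eq0.
move: (Ex _ _) (cov v v) (N.-1%:R : R) (k.+1%:R : R) n0 => a b p q q0.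
by field.
Qed.

(** The two parts have to be proved together: integration by parts for an odd power yields the next
    even moment, and this moment admits two more factors [X v] in the integration by parts. *)
Lemma gaussian_moments v n : intg mu (fun x => X v x ^+ n.+1.*2) /\
  ibp v (fun x => X v x ^+ n.*2.+1) (fun x => n.*2.+1%:R * cov v v * X v x ^+ n.*2).
Proof.
elim: n => [|n [IH1 IH2]].
  have i2 : intg mu (fun x => X v x ^+ 2).
    (* The characteristic functional gives these expectations exactly, and [1 - exp (- a) <= a]
       leads to the bound [cov v v]. *)
    have := @intg_sqr_mul v (fun=> 1) (cov v v) (intg_cst mu 1) (fun=> ler01).
    rewrite (_ : (fun x => X v x ^+ 2 * 1) = fun x => X v x ^+ 2); last first.
      by apply/funext => x; rewrite mulr1.
    apply => n; set h := n.+1%:R^-1.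
    have -> : Ex mu (fun x => 1 * (1 - cos (h * X v x))) =
        1 - expR (- 2^-1 * (h ^+ 2 * cov v v)).
      have i1 := intg_cst mu 1; have ic := @intg_cosX _ (h *: v) 0 i1.
      have := trig_moment1 (h *: v) 0.
      rewrite cos0 mul1r -[h *: v]addr0 covDr covDl cov0 addr0 covC cov0 addr0.
      rewrite addr0 mulrA -expr2 => <-; rewrite -(Ex_cst mu 1) /C -ExB ?Ex_cst //.
      by congr (Ex mu _); apply/funext => x; rewrite X_scale addr0; ring.
    have c0 := cov_ge0 v.
    have := expR_ge1Dx (- 2^-1 * (h ^+ 2 * cov v v)) => H.
    apply: (@le_trans _ _ (2 * n.+1%:R ^+ 2 * (2^-1 * (h ^+ 2 * cov v v)))).
      by rewrite ler_wpM2l ?mulr_ge0 ?exprn_ge0 //; lra.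
    rewrite /h le_eqVlt; apply/orP; left; apply/eqP.
    have n0 : n.+1%:R != 0 :> R by rewrite pnatr_eq0.
    by move: (n.+1%:R : R) n0 => q q0; field.
  split=> //.
  have i1 : intg mu (X v).
    have := @intg_pow_le 1 1 (X v) isT (X_meas v) i2.
    by congr (intg mu _); apply/funext.
  have i0 c : intg mu (fun x => X v x * c).
    by have := intgZ c i1; congr (intg mu _); apply/funext => x; rewrite mulrC.
  have := @ibp_mul v v _ _ (ibp1 i1) (intg_cst mu 1) (intg_cst mu 0) (i0 1) (i0 0) (i0 1).
  rewrite (_ : (fun x => X v x * (X v x * 1)) = fun x => X v x ^+ 2); last first.
    by apply/funext => x; rewrite mulr1.
  move=> /(_ i2); congr (ibp v _ _); apply/funext => x.
    by rewrite mulr1.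
  by rewrite mulr0 add0r mul1r.
have i4 : intg mu (fun x => X v x ^+ n.+2.*2).
  by apply: gaussian_moment_step.
split=> //.
have Ij j : (j <= n.+2.*2)%N -> intg mu (fun x => X v x ^+ j).
  by move=> jN; apply: (@intg_pow_le _ n.+2).
rewrite !doubleS in Ij IH1 *.
set N := n.*2 in Ij IH1 IH2 *.
have Ic c j : (j <= N.+4)%N -> intg mu (fun x => c * X v x ^+ j).
  by move=> jN; apply: intgZ; exact: Ij.
have I1 j : (j.+1 <= N.+4)%N -> intg mu (fun x => X v x * X v x ^+ j).
  move=> /Ij; congr (intg mu _).
  by apply/funext => x; rewrite exprS.
have I1c c j : (j.+1 <= N.+4)%N -> intg mu (fun x => X v x * (c * X v x ^+ j)).
  move=> /(Ic c); congr (intg mu _).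
  by apply/funext => x; rewrite exprS mulrCA.
have I2 j : (j.+2 <= N.+4)%N -> intg mu (fun x => X v x * (X v x * X v x ^+ j)).
  move=> /Ij; congr (intg mu _).
  by apply/funext => x; rewrite !exprS.
have H2 : ibp v (fun x => X v x ^+ N.+2) (fun x => N.+2%:R * cov v v * X v x ^+ N.+1).
  have := @ibp_mul v v _ _ IH2 (Ij N.+1 ltac:(lia)) (Ic _ N ltac:(lia))
    (I1 N.+1 ltac:(lia)) (I1c _ N ltac:(lia)) (I1 N.+1 ltac:(lia)) (I2 N.+1 ltac:(lia)).
  congr (ibp v _ _); apply/funext => x.
  by rewrite !exprS -[N.+2%:R]natr1; ring.
have := @ibp_mul v v _ _ H2 (Ij N.+2 ltac:(lia)) (Ic _ N.+1 ltac:(lia))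
  (I1 N.+2 ltac:(lia)) (I1c _ N.+1 ltac:(lia)) (I1 N.+2 ltac:(lia)) (I2 N.+2 ltac:(lia)).
congr (ibp v _ _); apply/funext => x.
by rewrite !exprS -[N.+3%:R]natr1; ring.
Qed.

(** An algebra of functions that contains the [X v], hence all polynomials in them; inside it the
    integrability conditions of integration by parts are automatic. *)
Definition all_moments (f : T -> R) :=
  measurable_fun setT f /\ forall n, intg mu (fun x => f x ^+ n.*2).

Lemma all_moments_intg f : all_moments f -> intg mu f.
Proof.
move=> [mf fi]; have := @intg_pow_le 1 1 f isT mf (fi 1%N).
by congr (intg mu _); apply/funext.
Qed.

Lemma all_moments_sqi f : all_moments f -> sqi mu f.
Proof. by move=> [mf fi]; apply/sqiP; split=> //; exact: (fi 1%N). Qed.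

Lemma all_moments_cst c : all_moments (fun=> c).
Proof. by split=> // n; exact: intg_cst. Qed.

Lemma all_moments_X v : all_moments (X v).
Proof.
split=> // -[|n]; last by have [] := gaussian_moments v n.
exact: intg_cst.
Qed.

Lemma all_momentsM f g : all_moments f -> all_moments g ->
  all_moments (fun x => f x * g x).
Proof.
move=> [mf fi] [mg gi]; split=> [|n]; first exact: measurable_funM.
have m (h : T -> R) (k : nat) : measurable_fun setT h -> measurable_fun setT (fun x => h x ^+ k).
  by move=> ?; exact: measurable_funX.
have s (h : T -> R) : measurable_fun setT h -> (forall n, intg mu (fun x => h x ^+ n.*2)) ->
    sqi mu (fun x => h x ^+ n.*2).
  move=> mh hi; apply/sqiP; split; first exact: m.
  have := hi n.*2; congr (intg mu _); apply/funext => x.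
  by rewrite -exprM muln2.
have := intgM (s f mf fi) (s g mg gi).
by congr (intg mu _); apply/funext => x; rewrite exprMn.
Qed.

Lemma all_momentsZ c f : all_moments f -> all_moments (fun x => c * f x).
Proof. by move=> fm; apply: all_momentsM => //; exact: all_moments_cst. Qed.

Lemma all_momentsD f g : all_moments f -> all_moments g ->
  all_moments (fun x => f x + g x).
Proof.
move=> [mf fi] [mg gi]; split=> [|n]; first exact: measurable_funD.
apply: (@intg_le _ _ _ _ (fun x => 2 ^+ n.*2 * (f x ^+ n.*2 + g x ^+ n.*2))).
- by apply: measurable_funX; exact: measurable_funD.
- by apply: intgZ; exact: intgD.
- move=> x; have e (y : R) : y ^+ n.*2 = `|y| ^+ n.*2.
    by rewrite -normrX ger0_norm // exprn_even_ge0 // odd_double.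
  rewrite normrX (e (f x)) (e (g x)).
  apply: (@le_trans _ _ ((`|f x| + `|g x|) ^+ n.*2)).
    by rewrite lerXn2r ?nnegrE ?addr_ge0 // ler_normD.
  wlog fg : f g mf fi mg gi / `|f x| <= `|g x|.
    move=> H; case: (leP `|f x| `|g x|) => [|/ltW] fg; first exact: (H f g).
    by rewrite addrC [X in _ * X]addrC; exact: (H g f).
  apply: (@le_trans _ _ ((2 * `|g x|) ^+ n.*2)).
    by rewrite lerXn2r ?nnegrE ?addr_ge0 ?mulr_ge0 // mulr_natl mulr2n lerD2r.
  by rewrite exprMn ler_wpM2l ?exprn_ge0 // lerDr exprn_ge0.
Qed.

Lemma ibp_mulX u v P P' : all_moments P -> all_moments P' -> ibp v P P' ->
  ibp v (fun x => X u x * P x) (fun x => X u x * P' x + cov v u * P x).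
Proof.
move=> Pm Pm' H; have m w := all_moments_X w.
apply: ibp_mul => //; apply: all_moments_intg => //; try exact: all_momentsM.
by apply: all_momentsM => //; exact: all_momentsM.
Qed.

Lemma ibp_linX v P P' Q Q' a : all_moments P -> all_moments P' ->
  all_moments Q -> all_moments Q' -> ibp v P P' -> ibp v Q Q' ->
  ibp v (fun x => P x + a * Q x) (fun x => P' x + a * Q' x).
Proof.
move=> *; have m w := all_moments_X w.
by apply: ibp_lin => //; apply: all_moments_intg => //; exact: all_momentsM.
Qed.

Lemma ibp_Ex v P P' : ibp v P P' -> Ex mu (fun x => X v x * P x) = Ex mu P'.
Proof.
move=> /(_ 0 0); rewrite cov0 mul0r addr0 /C => H.
rewrite (_ : (fun x => _) = fun x => X v x * P x * cos (X 0 x + 0)).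
  rewrite H; congr (Ex mu _); apply/funext => x.
  by rewrite X0 addr0 cos0 mulr1.
by apply/funext => x; rewrite X0 addr0 cos0 mulr1.
Qed.

Lemma all_moments_hermite s v n : all_moments (fun x => hermite s (X v x) n).
Proof.
elim/ltn_ind: n => -[|n] IH; first exact: all_moments_cst.
rewrite (_ : (fun x => _) = fun x => X v x * hermite s (X v x) n +
    - n%:R * (s * hermite s (X v x) n.-1)).
  apply: all_momentsD.
    by apply: all_momentsM; [exact: all_moments_X|exact: IH].
  by do 2 apply: all_momentsZ; apply: IH; rewrite ltnS leq_pred.
by apply/funext => x; rewrite hermiteS mulNr.
Qed.

(** Induction along the three-term recursion: [ibp_mulX] for its first term and [ibp_linX] for the
    difference reproduce the rule that the [n]-th Hermite polynomial has [n] times the previous one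
    as its derivative. *)
Lemma ibp_hermite v u P P' n : all_moments P -> all_moments P' -> ibp v P P' ->
  ibp v (fun x => hermite (cov u u) (X u x) n * P x)
    (fun x => hermite (cov u u) (X u x) n * P' x +
       n%:R * cov v u * (hermite (cov u u) (X u x) n.-1 * P x)).
Proof.
move=> Pm Pm' HP; set h := fun x => hermite (cov u u) (X u x).
have hm k : all_moments (fun x => h x k) := all_moments_hermite _ _ _.
have hP k : all_moments (fun x => h x k * P x) by exact: all_momentsM.
have hP' k : all_moments (fun x => h x k * P' x) by exact: all_momentsM.
have dm k : all_moments (fun x => h x k * P' x + k%:R * cov v u * (h x k.-1 * P x)).
  by apply: all_momentsD => //; exact: all_momentsZ.
elim/ltn_ind: n => -[|n] IH.
  move: HP; congr (ibp v _ _); apply/funext => x.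
    by rewrite /h /= mul1r.
  by rewrite /h /= !mul0r addr0 mul1r.
have H1 := @ibp_mulX u v _ _ (hP n) (dm n) (IH n (ltnSn n)).
have H2 := IH n.-1; rewrite ltnS leq_pred in H2.
have := ibp_linX (- (n%:R * cov u u)) _ _ (hP n.-1) (dm n.-1) H1 (H2 isT).
move=> H; have {H} := H _ _.
have m1 : all_moments (fun x => X u x * (h x n * P x)).
  by apply: all_momentsM => //; exact: all_moments_X.
move=> /(_ m1) H; have {H} := H _.
have m2 : all_moments (fun x => X u x * (h x n * P' x + n%:R * cov v u * (h x n.-1 * P x)) +
    cov v u * (h x n * P x)).
  apply: all_momentsD; last exact: all_momentsZ.
  by apply: all_momentsM => //; exact: all_moments_X.
move=> /(_ m2); congr (ibp v _ _); apply/funext => x.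
  by rewrite /h hermiteS; ring.
rewrite /h hermiteS; case: n {IH H1 H2 m1 m2} => [|n].
  by rewrite /= !mul0r; ring.
rewrite [n.+1.-1]/= hermiteS -[n.+2%:R]natr1 -[n.+1%:R]natr1.
case: n => [|n]; first by rewrite /= !mul0r; ring.
by rewrite -natr1; ring.
Qed.

(** Integration by parts in the direction [v]: the derivative of the polynomial in [X v] cancels the
    second term of the recursion, and only the derivative of the factor in [X u] is left. *)
Lemma Ex_hermiteM v u n k :
  Ex mu (fun x => hermite (cov v v) (X v x) n.+1 * hermite (cov u u) (X u x) k) =
  k%:R * cov v u *
  Ex mu (fun x => hermite (cov v v) (X v x) n * hermite (cov u u) (X u x) k.-1).
Proof.
set h := fun x => hermite (cov v v) (X v x).
set g := fun x => hermite (cov u u) (X u x).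
have hm j : all_moments (fun x => h x j) := all_moments_hermite _ _ _.
have gm j : all_moments (fun x => g x j) := all_moments_hermite _ _ _.
have hg i j : all_moments (fun x => h x i * g x j) by exact: all_momentsM.
have H0 : ibp v (fun=> 1) (fun=> 0).
  by apply: ibp1; apply: all_moments_intg; exact: all_moments_X.
have H1 := ibp_hermite u k (all_moments_cst 1) (all_moments_cst 0) H0.
have g1 : all_moments (fun x => g x k * 1).
  by apply: all_momentsM => //; exact: all_moments_cst.
have g2 : all_moments (fun x => g x k * 0 + k%:R * cov v u * (g x k.-1 * 1)).
  apply: all_momentsD.
    by apply: all_momentsM => //; exact: all_moments_cst.
  by apply: all_momentsZ; apply: all_momentsM => //; exact: all_moments_cst.
have H2 := ibp_hermite v n g1 g2 H1.
have E := ibp_Ex H2.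
have i1 : intg mu (fun x => X v x * (h x n * (g x k * 1))).
  apply: all_moments_intg; apply: all_momentsM; first exact: all_moments_X.
  exact: all_momentsM.
have i2 : intg mu (fun x => n%:R * cov v v * (h x n.-1 * (g x k * 1))).
  by apply: intgZ; apply: all_moments_intg; exact: all_momentsM.
rewrite (_ : (fun x => h x n.+1 * g x k) = fun x =>
  X v x * (h x n * (g x k * 1)) - n%:R * cov v v * (h x n.-1 * (g x k * 1))).
  rewrite ExB // E ExD //.
    rewrite -(ExZ _ (all_moments_intg (hg n k.-1))); apply: (etrans (addrK _ _)).
    by congr (Ex mu _); apply/funext => x; rewrite /h; ring.
  exact: all_moments_intg (all_momentsM (hm n) g2).
by apply/funext => x; rewrite /h hermiteS; ring.
Qed.

Lemma Ex_hermite v u n k :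
  Ex mu (fun x => hermite (cov v v) (X v x) n * hermite (cov u u) (X u x) k) =
  if n == k then n`!%:R * cov v u ^+ n else 0.
Proof.
elim: n k => [|n IH] [|k].
- by rewrite (_ : (fun x => _) = fun=> 1) ?Ex_cst ?mulr1 //; apply/funext => x; rewrite mulr1.
- rewrite (_ : (fun x => _) = fun x => hermite (cov u u) (X u x) k.+1 * hermite (cov v v) (X v x) 0).
    by rewrite Ex_hermiteM !mul0r.
  by apply/funext => x; rewrite mulrC.
- by rewrite Ex_hermiteM !mul0r.
- rewrite Ex_hermiteM IH eqSS /=; case: eqP => [->|]; last by rewrite mulr0.
  by rewrite factS natrM exprS; ring.
Qed.

(** Each degree costs one integration by parts. The derivative of the Hermite polynomial cancels
    against the recursion, and that of the cosine gives a factor [cov v w] and a phase [pi / 2]. *)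
Lemma trig_hermite v w n s :
  C (fun x => hermite (cov v v) (X v x) n) w s =
  cov v w ^+ n * C (fun=> 1) w (s + n%:R * (pi / 2)).
Proof.
elim: n s => [|n IH] s; first by rewrite mul0r addr0 mul1r.
set h := fun x => hermite (cov v v) (X v x).
have hm j : all_moments (fun x => h x j) := all_moments_hermite _ _ _.
have H0 : ibp v (fun=> 1) (fun=> 0).
  by apply: ibp1; apply: all_moments_intg; exact: all_moments_X.
have H1 := ibp_hermite v n (all_moments_cst 1) (all_moments_cst 0) H0.
have i1 : intg mu (fun x => X v x * (h x n * 1)).
  apply: all_moments_intg; apply: all_momentsM; first exact: all_moments_X.
  by apply: all_momentsM => //; exact: all_moments_cst.
have i2 : intg mu (fun x => h x n.-1) by exact: all_moments_intg.
have h1 j : (fun x => h x j * 1) = fun x => h x j.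
  by apply/funext => x; rewrite mulr1.
rewrite (_ : (fun x => h x n.+1) = fun x =>
  X v x * (h x n * 1) + - (n%:R * cov v v) * h x n.-1).
  rewrite trig_moment_lin // H1.
  rewrite (_ : (fun x => _ * 0 + _) = fun x => 0 + n%:R * cov v v * h x n.-1).
    rewrite trig_moment_lin //; last exact: intg_cst.
    have -> : C (fun=> 0) w s = 0.
      by rewrite /C; under eq_fun do rewrite mul0r; rewrite Ex_cst.
    rewrite h1 IH exprS -[n.+1%:R]natr1.
    rewrite (_ : s + (n%:R + 1) * (pi / 2) = s + pi / 2 + n%:R * (pi / 2)); last by ring.
    ring.
  by apply/funext => x; rewrite mulr0 mulr1.
by apply/funext => x; rewrite /h hermiteS mulr1; ring.
Qed.

End GaussianFamily.

(** * Polarization *)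

Section Polarization.
Context {R : realType} {V : lmodType R}.

Definition fcons (I : Type) n (a : I) (v : 'I_n -> I) : 'I_n.+1 -> I :=
  fun j => if unlift ord0 j is Some k then v k else a.

Lemma fcons_update n (x : V) (v : 'I_n -> V) i y :
  fcons x [eta v with i |-> y] = [eta fcons x v with lift ord0 i |-> y].
Proof.
apply/funext => j; rewrite /fcons /=; case: unliftP => [k|] ->.
  by rewrite (inj_eq lift_inj).
by rewrite (negbTE (neq_lift _ _)).
Qed.

Lemma fcons_update0 n (x z : V) (v : 'I_n -> V) :
  [eta fcons z v with ord0 |-> x] = fcons x v :> ('I_n.+1 -> V).
Proof.
by apply/funext => j; rewrite /fcons /=; case: unliftP => [k|] ->.
Qed.

Lemma mcurry_multilinear n (m : mform V n.+1) x :
  multilinear (fun v : 'I_n -> V => m (fcons x v)).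
Proof. by move=> v i a y z; rewrite !fcons_update mform_multilinear. Qed.

Definition mcurry n (m : mform V n.+1) x : mform V n :=
  MForm (mcurry_multilinear m x).

Lemma mform_fcons_lin n (m : mform V n.+1) (v : 'I_n -> V) a x y :
  m (fcons (a *: x + y) v) = a * m (fcons x v) + m (fcons y v).
Proof.
rewrite -(fcons_update0 (a *: x + y) 0 v) mform_multilinear.
by rewrite !fcons_update0.
Qed.

Lemma mform_fcons_sum n (m : mform V n.+1) (v : 'I_n -> V) (I : Type)
  (r : seq I) (P : pred I) (F : I -> V) :
  m (fcons (\sum_(i <- r | P i) F i) v) = \sum_(i <- r | P i) m (fcons (F i) v).
Proof.
apply: (big_morph (fun x => m (fcons x v))) => [x y|].
  by rewrite -[x]scale1r mform_fcons_lin mul1r scale1r.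
by have := mform_fcons_lin m v (-1) 0 0; rewrite scaler0 addr0 mulN1r addNr.
Qed.

Lemma mform_eq0 n (m : mform V n) (v : 'I_n -> V) i : v i = 0 -> m v = 0.
Proof.
move=> vi; have := mform_multilinear m v i (-1) 0 0.
rewrite scaler0 addr0 mulN1r addNr => <-; congr (m _).
by apply/funext => j /=; case: eqP => // ->.
Qed.

Lemma sum_ffun_cons (I : finType) n (F : ('I_n.+1 -> I) -> R) :
  \sum_(g : {ffun 'I_n.+1 -> I}) F g =
  \sum_(i : I) \sum_(g : {ffun 'I_n -> I}) F (fcons i g).
Proof.
rewrite pair_big /=.
pose h (p : I * {ffun 'I_n -> I}) : {ffun 'I_n.+1 -> I} := [ffun j => fcons p.1 p.2 j].
rewrite (reindex h) /=.
  by apply: eq_bigr => p _; congr F; apply/funext => j; rewrite ffunE.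
exists (fun f : {ffun 'I_n.+1 -> I} => (f ord0, [ffun j => f (lift ord0 j)])) => [[i g] _|f _].
  congr pair; first by rewrite ffunE /fcons /= unlift_none.
  by apply/ffunP => j; rewrite !ffunE /fcons liftK.
by apply/ffunP => j; rewrite ffunE /fcons /=; case: unliftP => [k|] ->; rewrite ?ffunE.
Qed.

Lemma mform_expand (I : finType) n (m : mform V n) (w : 'I_n -> I -> V) :
  m (fun j => \sum_i w j i) =
  \sum_(g : {ffun 'I_n -> I}) m (fun j => w j (g j)).
Proof.
elim: n m w => [|n IH] m w.
  rewrite (big_pred1 [ffun i : 'I_0 => match notF (ltn_ord i) with end]).
    by congr (m _); apply/funext => -[].
  by move=> g; apply/esym/eqP/ffunP => -[].
rewrite (sum_ffun_cons (fun g => m (fun j => w j (g j)))).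
have fE (v : 'I_n.+1 -> V) : v = fcons (v ord0) (fun j => v (lift ord0 j)).
  by apply/funext => j; rewrite /fcons; case: unliftP => [k|] ->.
rewrite [X in m X]fE mform_fcons_sum; apply: eq_bigr => i _.
apply: (etrans (IH (mcurry m (w ord0 i)) (fun j => w (lift ord0 j)))).
apply: eq_bigr => g _; congr (m _); apply/funext => j.
by rewrite /fcons; case: unliftP => [k|] ->.
Qed.

(* Inclusion-exclusion: the maps [g] whose image is contained in [S] are selected
   by the signs exactly when they are onto. *)
Lemma polarization n (m : mform V n) (v : 'I_n -> V) :
  \sum_(S : {set 'I_n}) (\prod_i (if i \in S then 1 else -1)) *
     m (fun=> \sum_(i in S) v i) =
  \sum_(s : 'S_n) m (v \o s).
Proof.
pose im (g : {ffun 'I_n -> 'I_n}) := g @: 'I_n.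
(* Expanding [m] leaves the maps [g] with image inside [S]. The value 0 encodes this condition, so
   that the sum over [S] factors into a product over [i] of [1 + 0] or [1 - 1]. *)
transitivity (\sum_(S : {set 'I_n}) \sum_(g : {ffun 'I_n -> 'I_n})
    (\prod_i (if i \in S then 1 else if i \in im g then 0 else -1)) * m (v \o g)).
  apply: eq_bigr => S _.
  have -> : (fun=> \sum_(i in S) v i) =
      (fun _ : 'I_n => \sum_i if i \in S then v i else 0).
    by apply/funext => _; rewrite big_mkcond.
  rewrite mform_expand mulr_sumr; apply: eq_bigr => g _.
  have [/forallP gS|] := boolP [forall j, g j \in S].
    congr (_ * m _); last by apply/funext => j /=; rewrite gS.
    apply: eq_bigr => i _; case: ifP => // iS; case: imsetP => // -[j _ ij].
    by rewrite ij gS in iS.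
  rewrite negb_forall => /existsP[j gj].
  rewrite (@mform_eq0 _ m _ j) ?(negbTE gj) // mulr0.
  by rewrite (bigD1 (g j)) //= (negbTE gj) imset_f // !mul0r.
rewrite exchange_big /=.
transitivity (\sum_(g : {ffun 'I_n -> 'I_n}) (injectiveb g)%:R * m (v \o g)).
  apply: eq_bigr => g _; rewrite -mulr_suml; congr (_ * _).
  rewrite -(bigA_distr _ _ (fun=> 1) (fun i => if i \in im g then 0 else -1)) /=.
  have [/injectiveP gi|gi] := boolP (injectiveb g).
    apply: big1 => i _; have /codomP[j ->] := injF_onto gi i.
    by rewrite imset_f // addr0.
  have [i img] : exists i, i \notin im g.
    apply/existsP; rewrite -negb_forall; apply: contra gi => /forallP imT.
    have /imset_injP gi : #|im g| == #|'I_n|.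
      by apply/eqP; apply: eq_card => i; rewrite imT inE.
    by apply/injectiveP => j k; exact: gi.
  by rewrite (bigD1 i) //= (negbTE img) subrr mul0r.
rewrite (bigID (fun g : {ffun 'I_n -> 'I_n} => injectiveb g)) /=.
rewrite addrC big1 ?add0r => [|g /negbTE ->]; last by rewrite mul0r.
rewrite (reindex (@pval _)) /=; last first.
  pose in_Sn := insubd (1%g : 'S_n).
  by exists in_Sn => /= g Ug; first apply: val_inj; exact: insubdK.
apply: eq_big => [s|s]; first exact: (valP s).
by move=> ->; rewrite mul1r; congr (m _); apply/funext => j; rewrite /= pvalE.
Qed.

End Polarization.

(** * Symmetric tensors and Wick powers on the diagonal *)

Section SymmetricTensors.
Context {R : realType}.

Lemma mean_perm n (a : R) : (n`!%:R)^-1 * (\sum_(s : 'S_n) a) = a.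
Proof.
by rewrite sumr_const card_Sn -[a *+ _]mulr_natl mulrA mulVf ?mul1r.
Qed.

Lemma lspan_comb (V : lmodType R) (Y : set V) x : lspan Y x ->
  exists2 s : seq (R * V), (forall q, q \in s -> Y q.2) &
    x = \sum_(q <- s) q.1 *: q.2.
Proof.
move: x; apply: smallest_sub; last first.
  move=> y Yy; exists [:: (1, y)] => [q|]; first by rewrite inE => /eqP ->.
  by rewrite big_seq1 scale1r.
split; first by exists [::]; rewrite ?big_nil.
move=> a _ _ [s sY ->] [t tY ->].
exists ([seq (a * q.1, q.2) | q <- s] ++ t) => [q|].
  by rewrite mem_cat => /orP[/mapP[p ps ->]|]; [exact: (sY p)|exact: tY].
rewrite big_cat big_map scaler_sumr; congr (_ + _).
by apply: eq_bigr => q _; rewrite scalerA.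
Qed.

Lemma tensor_combE (V : lmodType R) n (I : Type) (s : seq I) (c : I -> R)
    (t : I -> tensor V n) (m : mform V n) :
  tensor_fun (\sum_(q <- s) c q *: t q) m = \sum_(q <- s) c q * t q m.
Proof.
elim: s => [|q s IH]; first by rewrite !big_nil.
by rewrite !big_cons -IH.
Qed.

Lemma tensor_eq (V : lmodType R) n (t u : tensor V n) :
  (forall m, t m = u m) -> t = u.
Proof. by move=> tu; apply: val_inj; apply/funext. Qed.

Lemma tensor_comb (V : lmodType R) n (t : tensor V n) :
  exists s : seq (R * ('I_n -> V)), t = \sum_(q <- s) q.1 *: pure q.2.
Proof.
have /asboolP /lspan_comb[s sY ts] := tensorP t.
have /choice[w ws] : forall q : R * (mform V n -> R^o),
    exists v : 'I_n -> V, q \in s -> eval_tensor v = q.2.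
  move=> q; case: (boolP (q \in s)) => [/sY[v _ <-]|_]; first by exists v.
  by exists (fun=> 0).
exists [seq (q.1, w q) | q <- s]; apply: tensor_eq => m.
rewrite tensor_combE big_map ts.
have fE (r : seq (R * (mform V n -> R^o))) :
    (\sum_(q <- r) q.1 *: q.2) m = \sum_(q <- r) q.1 * q.2 m.
  by elim: r => [|q r IH]; rewrite ?big_nil // !big_cons -IH.
rewrite fE !big_seq; apply: eq_bigr => q qs.
by rewrite -(ws q qs).
Qed.

(** A symmetric tensor is its own average over permutations, and [polarization] writes the average
    of each pure term through diagonal tensors. Wick powers are thus needed on the diagonal only. *)
Lemma symmetric_tensor_diag (V : lmodType R) n (t : tensor V n) :
  symmetric_tensor t ->
  exists p : seq (R * V), t = \sum_(q <- p) q.1 *: pure (fun _ : 'I_n => q.2).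
Proof.
move=> ts; have [s E] := tensor_comb t.
pose c (S : {set 'I_n}) : R := \prod_i (if i \in S then 1 else -1).
exists [seq ((n`!%:R)^-1 * (q.1 * c J), \sum_(i in J) q.2 i)
  | q <- s, J <- index_enum {set 'I_n}].
apply: tensor_eq => m.
rewrite tensor_combE big_allpairs_dep /=.
have -> : t m = (n`!%:R)^-1 * \sum_(s : 'S_n) t (perm_mform s m).
  under eq_bigr do rewrite ts.
  by rewrite mean_perm.
rewrite (eq_bigr (fun p : 'S_n => \sum_(q <- s) q.1 * m (q.2 \o p))); last first.
  by move=> p _; rewrite E tensor_combE.
rewrite exchange_big /= mulr_sumr; apply: eq_bigr => q _.
rewrite -mulr_sumr -(polarization m q.2) !mulr_sumr.
by apply: eq_bigr => J _; rewrite !mulrA.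
Qed.

Lemma tensor_map_comb (U V : lmodType R) (j : {linear U -> V}) n (p : seq (R * U)) :
  tensor_map j (\sum_(q <- p) q.1 *: pure (fun _ : 'I_n => q.2)) =
  \sum_(q <- p) q.1 *: pure (fun _ : 'I_n => j q.2).
Proof.
apply: tensor_eq => m.
by rewrite /tensor_map /= !tensor_combE.
Qed.

Lemma symmetric_diag (V : lmodType R) n (p : seq (R * V)) :
  symmetric_tensor (\sum_(q <- p) q.1 *: pure (fun _ : 'I_n => q.2)).
Proof.
by move=> s m; rewrite !tensor_combE; apply: eq_bigr => q _.
Qed.

Lemma msym_diag (V : lmodType R) n (F : mform V n) v :
  msym F (fun=> v) = F (fun=> v).
Proof.
rewrite /= (eq_bigr (fun=> F (fun=> v))) //.
exact: mean_perm.
Qed.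

(** Symmetrization has no effect on the diagonal, where the recursion for Wick powers becomes that
    of the Hermite polynomials. *)
Lemma wick_power_diag (V : lmodType R) (tau : mform V 2) (omega : mform V 1) n v :
  wick_power tau omega n (fun=> v) =
  hermite (tau (fun=> v)) (omega (fun=> v)) n.
Proof.
elim/ltn_ind: n => -[|[|n]] IH //.
rewrite hermiteS -!IH //=.
(* A conversion, as [1 + n.+1] and [2 + n] both compute to [n.+2]. *)
change (msym (mtensor omega (wick_power tau omega n.+1)) (fun=> v) -
  n.+1%:R * msym (mtensor tau (wick_power tau omega n)) (fun=> v) =
  omega (fun=> v) * wick_power tau omega n.+1 (fun=> v) -
  n.+1%:R * (tau (fun=> v) * wick_power tau omega n (fun=> v))).
by rewrite !msym_diag.
Qed.

End SymmetricTensors.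

(** * Wick polynomials and chaos *)

Section HilbertSpace.
Context {R : realType} {K : hilbertType R}.
Implicit Types (x y : K).

Lemma hdotB_sqr x y : `|x - y| ^+ 2 = hdot x x - 2 * hdot x y + hdot y y.
Proof.
rewrite -hdotE linearBl /= !linearBr /= (hdotC y x).
move: (hdot x x) (hdot x y) (hdot y y) => a b c; ring.
Qed.

Lemma hdot_suml (I : Type) (s : seq I) (c : I -> R) (a : I -> K) y :
  hdot (\sum_(q <- s) c q *: a q) y = \sum_(q <- s) c q * hdot (a q) y.
Proof.
elim: s => [|q s IH]; first by rewrite !big_nil linear0l.
by rewrite !big_cons linearPl /= IH.
Qed.

Lemma hdot_CS x y : `|hdot x y| <= `|x| * `|y|.
Proof.
rewrite -ler_sqr ?nnegrE ?mulr_ge0 // real_normK ?num_real //.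
rewrite exprMn -!hdotE; apply: quadratic_discr => [t||].
- have := sqr_ge0 `|x - (- t) *: y|; rewrite hdotB_sqr.
  have hZ (a : R) (u v : K) : hdot u (a *: v) = a * hdot u v.
    by rewrite -[a *: v]addr0 linearPr linear0r addr0.
  have hZl (a : R) (u v : K) : hdot (a *: u) v = a * hdot u v.
    by rewrite hdotC hZ hdotC.
  rewrite !(hZ, hZl) => H; move: H.
  move: (hdot x x) (hdot x y) (hdot y y) => a b c.
  by rewrite (_ : _ + _ = a + (2 * t * b + t ^+ 2 * c)) //; ring.
- by rewrite hdotE sqr_ge0.
- by rewrite hdotE sqr_ge0.
Qed.

(** Through [hdot_polar] only the continuity of the norm is needed. *)
Lemma hdot_cvg (u v : nat -> K) x y : u @ \oo --> x -> v @ \oo --> y ->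
  (fun k => hdot (u k) (v k)) @ \oo --> hdot x y.
Proof.
move=> ux vy.
rewrite (_ : (fun k => _) = fun k => 2^-1 * `|u k + v k| ^+ 2 + - 2^-1 * (`|u k| ^+ 2 + `|v k| ^+ 2)); last first.
  by apply/funext => k; exact: hdot_polar.
rewrite hdot_polar.
have sq (w : nat -> K) z : w @ \oo --> z -> (fun k => `|w k| ^+ 2) @ \oo --> `|z| ^+ 2.
  by move=> wz; rewrite !expr2; apply: cvgM; exact: cvg_norm.
apply: cvgD; apply: cvgM; try exact: cvg_cst.
  by apply: sq; exact: cvgD.
by apply: cvgD; exact: sq.
Qed.

Lemma norm_sqr_cvg0 (u : nat -> K) x :
  (fun k => `|u k - x| ^+ 2) @ \oo --> (0 : R) -> u @ \oo --> x.
Proof.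
move=> /sqr_cvg0 c; apply/cvgrPdist_lt => e e0.
move/cvgrPdist_lt: c => /(_ e e0); apply: filterS => k.
by rewrite sub0r normrN normr_id distrC.
Qed.

Lemma closure_seq (S : set K) x : closure S x ->
  exists2 u : nat -> K, forall k, S (u k) & u @ \oo --> x.
Proof.
move=> Sx.
have /choice [u Hu] : forall k : nat, exists y, S y /\ `|y - x| < k.+1%:R^-1.
  move=> k; have [|y [Sy]] := Sx (ball x k.+1%:R^-1).
    by apply: nbhsx_ballx; rewrite invr_gt0.
  by rewrite -ball_normE /= distrC => xy; exists y.
exists u; first by move=> k; have [] := Hu k.
apply/cvgrPdist_lt => e e0; near=> k; rewrite distrC.
have [_ uk] := Hu k; apply: (lt_trans uk).
near: k; exact: near_infty_natSinv_lt (PosNum e0).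
Unshelve. all: by end_near. Qed.

Lemma seq_closure (S : set K) (u : nat -> K) x :
  (forall k, S (u k)) -> u @ \oo --> x -> closure S x.
Proof.
move=> Su ux B /ux [k _ H]; exists (u k); split=> //.
exact: (H k (leqnn k)).
Qed.

Lemma dense_closure (S : set K) x : dense S -> closure S x.
Proof.
move=> dS B; rewrite nbhsE => -[C [oC Cx] CB].
have [||y [Cy Sy]] := dS C; [by exists x|exact: oC|].
by exists y; split=> //; exact: CB.
Qed.

Lemma closure_subspace (S : set K) : Defs.subspace S -> Defs.subspace (closure S).
Proof.
move=> [S0 SD]; split; first exact: subset_closure.
move=> a x y /closure_seq[u Su ux] /closure_seq[v Sv vy].
apply: (@seq_closure _ (fun k => a *: u k + v k)).
  by move=> k; exact: SD.
by apply: cvgD => //; apply: cvgZr.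
Qed.

Lemma cvg_bounded_diff (u : nat -> K) x : u @ \oo --> x -> forall e, 0 < e ->
  exists N, forall k l, (N <= k)%N -> (N <= l)%N -> `|u k - u l| ^+ 2 <= e.
Proof.
move=> /cvgrPdist_le ux e e0.
have s0 : 0 < Num.sqrt e by rewrite sqrtr_gt0.
have [|N _ NP] := ux (Num.sqrt e / 2); first by rewrite divr_gt0.
exists N => k l Nk Nl; rewrite -[e]sqr_sqrtr ?(ltW e0) //.
rewrite lerXn2r ?nnegrE ?sqrtr_ge0 // -(subrKA x) (le_trans (ler_normD _ _)) //.
rewrite (splitr (Num.sqrt e)) lerD //; last exact: NP.
by rewrite distrC; exact: NP.
Qed.

End HilbertSpace.

Section DiagonalTensors.
Context {R : realType} {K : hilbertType R}.
Context (n : nat) (T : hilbertType R) (i : {linear tensor K n -> T}).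
Hypothesis iT : is_hilbert_tensor_power i.

Definition diag (y : K) : T := i (pure (fun=> y)).

Lemma hdot_diag x y : hdot (diag x) (diag y) = hdot x y ^+ n.
Proof. by rewrite iT.1 prodr_const card_ord. Qed.

(** The squared distance of two diagonal tensors is a polynomial in the inner products of the
    vectors, so the tensor map itself needs no estimate. *)
Lemma diag_cvg (u : nat -> K) x : u @ \oo --> x ->
  (fun k => diag (u k)) @ \oo --> diag x.
Proof.
move=> ux; apply: norm_sqr_cvg0.
rewrite (_ : (fun k => _) = fun k => hdot (u k) (u k) ^+ n -
  2 * hdot (u k) x ^+ n + hdot x x ^+ n); last first.
  by apply/funext => k; rewrite hdotB_sqr !hdot_diag.
have pw (f : nat -> R) (a : R) : f @ \oo --> a -> (fun k => f k ^+ n) @ \oo --> a ^+ n.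
  by move=> fa; exact: (continuous_cvg _ (@exprn_continuous R n a) fa).
have c1 := pw _ _ (hdot_cvg ux ux).
have c2 := pw _ _ (hdot_cvg ux (cvg_cst x)).
rewrite (_ : 0 = hdot x x ^+ n - 2 * hdot x x ^+ n + hdot x x ^+ n); last by ring.
apply: cvgD; last exact: cvg_cst.
apply: cvgB => //; apply: cvgM; first exact: cvg_cst.
exact: c2.
Qed.

End DiagonalTensors.

(** * Limits of Wick sums *)

Section WickLimits.
Context d (T : measurableType d) (R : realType) (mu : probability T R).
Context (V : lmodType R) (K : hilbertType R) (J : {linear V -> K}).
Variable X : V -> T -> R.
Hypothesis X_lin : forall a u v x, X (a *: u + v) x = a * X u x + X v x.
Hypothesis X_meas : forall v, measurable_fun setT (X v).
Hypothesis X_cos : forall v,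
  Ex mu (fun x => cos (X v x)) = expR (- 2^-1 * hdot (J v) (J v)).
Hypothesis X_sin : forall v, Ex mu (fun x => sin (X v x)) = 0.
Context (H : nat -> hilbertType R) (i : forall n, {linear tensor K n -> H n}).
Hypothesis iH : forall n, is_hilbert_tensor_power (i n).

(* A linear combination of diagonal tensors is encoded by the list of its
   coefficients and vectors. *)
Definition diag_tensor n (p : seq (R * V)) : H n :=
  \sum_(q <- p) q.1 *: diag (i n) (J q.2).

Definition wick_sum n (p : seq (R * V)) (x : T) : R :=
  \sum_(q <- p) q.1 * hermite (cov J q.2 q.2) (X q.2 x) n.

Lemma sqi_hermite v n : sqi mu (fun x => hermite (cov J v v) (X v x) n).
Proof.
exact: all_moments_sqi (all_moments_hermite X_lin X_meas X_cos X_sin _ _ _).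
Qed.

Lemma sqi_wick_sum n p : sqi mu (wick_sum n p).
Proof.
by apply: sqi_sum => q; apply: sqiZ; exact: sqi_hermite.
Qed.

Lemma Ex_wick_suml n p (g : T -> R) : sqi mu g ->
  Ex mu (fun x => wick_sum n p x * g x) =
  \sum_(q <- p) q.1 * Ex mu (fun x => hermite (cov J q.2 q.2) (X q.2 x) n * g x).
Proof.
move=> gs; rewrite (_ : (fun x => _) = fun x => \sum_(q <- p)
    q.1 * (hermite (cov J q.2 q.2) (X q.2 x) n * g x)).
  rewrite (@Ex_sum _ _ _ _ _ p (fun q x => q.1 * (hermite (cov J q.2 q.2) (X q.2 x) n * g x))).
    by apply: eq_bigr => q _; rewrite ExZ //; exact: intgM (sqi_hermite _ _) gs.
  by move=> q; apply: intgZ; exact: intgM (sqi_hermite _ _) gs.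
by apply/funext => x; rewrite mulr_suml; apply: eq_bigr => q _; rewrite mulrA.
Qed.

Lemma Ex_wick_sumM n k p p' :
  Ex mu (fun x => wick_sum n p x * wick_sum k p' x) =
  if n == k then n`!%:R * hdot (diag_tensor n p) (diag_tensor n p') else 0.
Proof.
rewrite Ex_wick_suml; last exact: sqi_wick_sum.
have E v : Ex mu (fun x => hermite (cov J v v) (X v x) n * wick_sum k p' x) =
    if n == k then n`!%:R * hdot (diag_tensor n p') (diag (i n) (J v)) else 0.
  rewrite (_ : (fun x => _) = fun x => wick_sum k p' x * hermite (cov J v v) (X v x) n).
    rewrite Ex_wick_suml; last exact: sqi_hermite.
    under eq_bigr do rewrite (Ex_hermite X_lin X_meas X_cos X_sin).
    have [->|nk] := eqVneq n k.
      rewrite hdot_suml mulr_sumr; apply: eq_bigr => q _.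
      by rewrite hdot_diag //; rewrite /cov; ring.
    by rewrite big1 // => q _; rewrite mulr0.
  by apply/funext => x; rewrite mulrC.
under eq_bigr do rewrite E.
case: eqP => _; last by rewrite big1 // => q _; rewrite mulr0.
rewrite hdot_suml mulr_sumr; apply: eq_bigr => q _.
by rewrite (hdotC (diag_tensor n p')); ring.
Qed.

Lemma trig_wick_sum n p w s :
  trig_moment mu X (wick_sum n p) w s =
  hdot (diag_tensor n p) (diag (i n) (J w)) *
  trig_moment mu X (fun=> 1) w (s + n%:R * (pi / 2)).
Proof.
rewrite /trig_moment Ex_wick_suml; last first.
  apply: (sqi_le _ (sqi_cst mu 1)); first exact: measurable_cosX.
  by move=> x; rewrite normr1 cos_max.
rewrite hdot_suml mulr_suml; apply: eq_bigr => q _.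
have := trig_hermite X_lin X_meas X_cos X_sin q.2 w n s.
by move=> E; rewrite hdot_diag // -mulrA; congr (_ * _); exact: E.
Qed.

(** A relation and not a function of [f]: what is proved about it holds for every representative, in
    particular for the one that [wick_integral] selects. *)
Definition wick_lim n (f : H n) (Y : T -> R) :=
  exists2 p : nat -> seq (R * V), (fun k => diag_tensor n (p k)) @ \oo --> f &
    L2_cvg mu (fun k => wick_sum n (p k)) Y.

Lemma wick_lim_sqi n (f : H n) Y : wick_lim f Y -> sqi mu Y.
Proof. by move=> [p _ []]. Qed.

Lemma wick_lim_sum n p : wick_lim (diag_tensor n p) (wick_sum n p).
Proof.
exists (fun=> p); first exact: cvg_cst.
by apply: L2_cvg_cst; exact: sqi_wick_sum.
Qed.

Lemma wick_lim_isometry n (f g : H n) Y Z : wick_lim f Y -> wick_lim g Z ->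
  Ex mu (fun x => Y x * Z x) = n`!%:R * hdot f g.
Proof.
move=> [p pf pY] [q qg qZ].
have c : (fun k => Ex mu (fun x => wick_sum n (p k) x * wick_sum n (q k) x))
    @ \oo --> n`!%:R * hdot f g.
  rewrite (funext (fun k => Ex_wick_sumM n n (p k) (q k))) eqxx.
  by apply: cvgM; [exact: cvg_cst|exact: hdot_cvg].
exact: (cvg_unique (@Rhausdorff R) (L2_cvg_Ex pY qZ) c).
Qed.

Lemma wick_lim_ortho n k (f : H n) (g : H k) Y Z : n != k ->
  wick_lim f Y -> wick_lim g Z -> Ex mu (fun x => Y x * Z x) = 0.
Proof.
move=> nk [p pf pY] [q qg qZ].
have c : (fun j => Ex mu (fun x => wick_sum n (p j) x * wick_sum k (q j) x))
    @ \oo --> (0 : R).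
  rewrite (funext (fun j => Ex_wick_sumM n k (p j) (q j))) (negbTE nk).
  exact: cvg_cst.
exact: (cvg_unique (@Rhausdorff R) (L2_cvg_Ex pY qZ) c).
Qed.

Lemma Ex_sqrB (f g : T -> R) : sqi mu f -> sqi mu g ->
  Ex mu (fun x => (f x - g x) ^+ 2) = Ex mu (fun x => f x * f x) -
    2 * Ex mu (fun x => f x * g x) + Ex mu (fun x => g x * g x).
Proof.
move=> fs gs; have ff := intgM fs fs; have fg := intgM fs gs; have gg := intgM gs gs.
rewrite -ExZ // -ExB //; last exact: intgZ.
rewrite -ExD //; last by apply: intgB => //; exact: intgZ.
by congr (Ex mu _); apply/funext => x; ring.
Qed.

Lemma wick_lim_dist n (f g : H n) Y Z : wick_lim f Y -> wick_lim g Z ->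
  Ex mu (fun x => (Y x - Z x) ^+ 2) = n`!%:R * `|f - g| ^+ 2.
Proof.
move=> fY gZ; rewrite Ex_sqrB; [|exact: wick_lim_sqi fY|exact: wick_lim_sqi gZ].
rewrite (wick_lim_isometry fY fY) (wick_lim_isometry fY gZ) (wick_lim_isometry gZ gZ).
by rewrite hdotB_sqr; ring.
Qed.

Lemma wick_lim_trig n (f : H n) Y w s : wick_lim f Y ->
  Ex mu (fun x => Y x * cos (X w x + s)) =
  hdot f (diag (i n) (J w)) * trig_moment mu X (fun=> 1) w (s + n%:R * (pi / 2)).
Proof.
move=> [p pf pY].
have cs : sqi mu (fun x => cos (X w x + s)).
  apply: (sqi_le _ (sqi_cst mu 1)); first exact: measurable_cosX.
  by move=> x; rewrite normr1 cos_max.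
have c : (fun k => Ex mu (fun x => wick_sum n (p k) x * cos (X w x + s)))
    @ \oo --> hdot f (diag (i n) (J w)) *
      trig_moment mu X (fun=> 1) w (s + n%:R * (pi / 2)).
  rewrite (funext (fun k => trig_wick_sum n (p k) w s)).
  by apply: cvgM; [apply: hdot_cvg => //; exact: cvg_cst|exact: cvg_cst].
exact: (cvg_unique (@Rhausdorff R) (L2_cvg_Ex pY (L2_cvg_cst cs)) c).
Qed.

(** Pythagoras' theorem, different orders being orthogonal. *)
Lemma wick_lim_sum_sqr (h : forall n, H n) (Z : nat -> T -> R) (r : seq nat) :
  (forall n, wick_lim (h n) (Z n)) -> uniq r ->
  Ex mu (fun x => (\sum_(n <- r) Z n x) ^+ 2) = \sum_(n <- r) n`!%:R * `|h n| ^+ 2.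
Proof.
move=> hZ; have Zs n := wick_lim_sqi (hZ n).
elim: r => [_|n r IH /= /andP[nr ur]].
  rewrite big_nil (_ : (fun x => _) = fun=> 0) ?Ex_cst //.
  by apply/funext => x; rewrite big_nil expr0n.
have Ss : sqi mu (fun x => \sum_(k <- r) Z k x) by exact: sqi_sum.
rewrite big_cons -IH // -hdotE -(wick_lim_isometry (hZ n) (hZ n)).
have Z0 : Ex mu (fun x => Z n x * \sum_(k <- r) Z k x) = 0.
  rewrite (_ : (fun x => _) = fun x => \sum_(k <- r) Z n x * Z k x); last first.
    by apply/funext => x; rewrite mulr_sumr.
  rewrite (@Ex_sum _ _ _ _ _ r (fun k x => Z n x * Z k x)); last by move=> k; exact: intgM.
  rewrite big_seq; apply: big1 => k kr.
  by apply: (wick_lim_ortho _ (hZ n) (hZ k)); apply: contraNneq nr => ->.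
rewrite (_ : (fun x => _) = fun x => Z n x * Z n x +
    (2 * (Z n x * \sum_(k <- r) Z k x) + (\sum_(k <- r) Z k x) ^+ 2)); last first.
  by apply/funext => x; rewrite big_cons; ring.
have i1 := intgM (Zs n) (Zs n); have i2 := intgM (Zs n) Ss; have i3 := sqi_sqr Ss.
rewrite ExD //; last by apply: intgD => //; exact: intgZ.
by rewrite ExD ?ExZ ?Z0 ?mulr0 ?add0r //; exact: intgZ.
Qed.

Lemma wick_lim_partial_sums (h : forall n, H n) (Z : nat -> T -> R) N M :
  (forall n, wick_lim (h n) (Z n)) -> (N <= M)%N ->
  Ex mu (fun x => (\sum_(n < M) Z n x - \sum_(n < N) Z n x) ^+ 2) =
  \sum_(N <= n < M) n`!%:R * `|h n| ^+ 2.
Proof.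
move=> hZ NM; rewrite -(wick_lim_sum_sqr hZ); last exact: iota_uniq.
congr (Ex mu _); apply/funext => x; congr (_ ^+ 2).
rewrite -!(big_mkord xpredT (fun n => Z n x)) (big_cat_nat (leq0n N) NM) /=.
by rewrite addrAC subrr add0r.
Qed.

Lemma diag_tensor_subspace n : Defs.subspace (range (diag_tensor n)).
Proof.
split; first by exists [::]; rewrite // /diag_tensor big_nil.
move=> a _ _ [p _ <-] [q _ <-].
exists ([seq (a * r.1, r.2) | r <- p] ++ q) => //.
rewrite /diag_tensor big_cat big_map scaler_sumr; congr (_ + _).
by apply: eq_bigr => r _; rewrite scalerA.
Qed.

(** By the isometry, convergent tensors give a Cauchy sequence in L2. Taking all measurable sets for
    [g] yields mere existence; the sets generating the sigma-algebra of the [X k] yield a version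
    measurable for it. *)
Lemma wick_lim_exists_smeas (g : set (set T)) n (f : H n) (p : nat -> seq (R * V)) :
  g `<=` measurable -> (forall k, smeas g (wick_sum n (p k))) ->
  (fun k => diag_tensor n (p k)) @ \oo --> f ->
  exists Y, smeas g Y /\ L2_cvg mu (fun k => wick_sum n (p k)) Y.
Proof.
move=> gm ps pf; apply: L2_complete => //.
- by move=> k; exact: sqi_wick_sum.
- move=> e e0; have f0 : 0 < n`!%:R :> R by rewrite ltr0n fact_gt0.
  have [|N NP] := cvg_bounded_diff pf (e := e / n`!%:R); first by rewrite divr_gt0.
  exists N => k l Nk Nl.
  rewrite (wick_lim_dist (wick_lim_sum n (p k)) (wick_lim_sum n (p l))).
  by rewrite mulrC -ler_pdivlMr // NP.
Qed.

Lemma wick_lim_exists_seq n (f : H n) (p : nat -> seq (R * V)) :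
  (fun k => diag_tensor n (p k)) @ \oo --> f -> exists Y,
    L2_cvg mu (fun k => wick_sum n (p k)) Y.
Proof.
move=> pf; have [||Y [_ pY]] := @wick_lim_exists_smeas measurable n f p _ _ pf.
- by [].
- move=> k B mB; apply: sub_sigma_algebra.
  by rewrite -[X in measurable X]setTI; exact: (sqi_meas (sqi_wick_sum n (p k))).
by exists Y.
Qed.

(** [J] has dense range and [diag] is continuous, so the diagonal tensors of the vectors [J v] span
    a dense subspace of the symmetric tensors. *)
Lemma wick_lim_exists n (f : H n) : dense (range J) ->
  hilbert_symmetric_tensors (i n) f -> exists Y, wick_lim f Y.
Proof.
move=> dJ fs.
have sub : lspan (range (diag (i n))) `<=` closure (range (diag_tensor n)).
  apply: smallest_sub; first exact: closure_subspace (diag_tensor_subspace n).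
  move=> _ [y _ <-]; have [u uJ uy] := closure_seq (dense_closure dJ (x := y)).
  apply: (seq_closure _ (diag_cvg (iH n) uy)) => k.
  have [v _ vu] := uJ k; exists [:: (1, v)] => //.
  by rewrite /diag_tensor big_seq1 scale1r vu.
have : closure (range (diag_tensor n)) f.
  by apply: closed_closure; exact: (closureS sub).
move=> /closure_seq[u ur uf].
have /choice[p pu] : forall k, exists p, diag_tensor n p = u k.
  by move=> k; have [p _ <-] := ur k; exists p.
have pf : (fun k => diag_tensor n (p k)) @ \oo --> f.
  by rewrite (_ : (fun k => _) = u) //; apply/funext.
by have [Y pY] := wick_lim_exists_seq pf; exists Y; exists p.
Qed.

End WickLimits.

(** * Test sequences *)

Section SequenceSpace.
Context {R : realType} {V : hilbertType R}.

Lemma series_finite_support (u : nat -> R) N : (forall k, (N <= k)%N -> u k = 0) ->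
  series u @ \oo --> series u N.
Proof.
move=> u0; apply: cvg_near_cst; exists N => // n /= Nn.
rewrite /series /= (big_cat_nat (leq0n N) Nn) /=.
rewrite [X in _ + X](_ : _ = 0) ?addr0 // big_nat_cond.
by apply: big1 => k /andP[/andP[Nk _] _]; exact: u0.
Qed.

Lemma l2_finite_support (f : nat -> V) N : (forall k, (N <= k)%N -> f k = 0) ->
  f \in @l2_pred R V.
Proof.
move=> f0; apply/asboolP; apply/cvg_ex; eexists.
by apply: (@series_finite_support _ N) => k Nk; rewrite f0 // normr0 expr0n.
Qed.

Definition single_fun (k : nat) (h : V) : nat -> V := fun j => if j == k then h else 0.

Lemma single_support k h j : (k.+1 <= j)%N -> single_fun k h j = 0.
Proof. by rewrite /single_fun => kj; rewrite gtn_eqF. Qed.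

Definition single k h : l2 V := L2 (l2_finite_support (@single_support k h)).

Definition trunc_fun N (f : l2 V) : nat -> V := fun j => if (j < N)%N then f j else 0.

Lemma trunc_support N f j : (N <= j)%N -> trunc_fun N f j = 0.
Proof. by rewrite /trunc_fun ltnNge => ->. Qed.

Definition trunc N f : l2 V := L2 (l2_finite_support (@trunc_support N f)).

Lemma trunc0 f : trunc 0 f = 0.
Proof. by apply: val_inj; apply/funext. Qed.

Lemma truncS N f : trunc N.+1 f = trunc N f + single N (f N).
Proof.
apply: val_inj; apply/funext => j /=; rewrite /trunc_fun.
change ((if (j < N.+1)%N then f j else 0) =
  (if (j < N)%N then f j else 0) + (if j == N then f N else 0)).
by rewrite ltnS leq_eqVlt; case: eqVneq => [->|_] /=; rewrite ?ltnn ?add0r ?addr0.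
Qed.

Lemma l2_ip_single k h : l2_ip (single k h) (single k h) = `|h| ^+ 2.
Proof.
apply: (cvg_lim (@Rhausdorff R)).
have -> : `|h| ^+ 2 = series (fun j => hdot (single k h j) (single k h j)) k.+1.
  rewrite /series /= big_nat_recr //= big_nat_cond big1 => [|j /andP[/andP[_ jk] _]].
    by rewrite add0r /single_fun eqxx hdotE.
  by rewrite /single_fun ltn_eqF // linear0l.
apply: series_finite_support => j kj.
by rewrite /= single_support // linear0l.
Qed.

Lemma l2_ip_trunc_cvg (f : l2 V) :
  (fun N => l2_ip (f - trunc N f) (f - trunc N f)) @ \oo --> (0 : R).
Proof.
pose u k := hdot (f k) (f k).
have uc : series u @ \oo --> limn (series u) := @is_cvg_l2_ip _ _ f f.
have E N : l2_ip (f - trunc N f) (f - trunc N f) = limn (series u) - series u N.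
  apply: (cvg_lim (@Rhausdorff R)).
  have : (fun n => series u n - series u N) @ \oo --> limn (series u) - series u N.
    by apply: cvgB => //; exact: cvg_cst.
  apply: cvg_trans; apply: near_eq_cvg; exists N => // n /= Nn.
  pose v k := hdot ((f - trunc N f) k) ((f - trunc N f) k).
  have v0 : \sum_(0 <= k < N) v k = 0.
    rewrite big_nat_cond; apply: big1 => k /andP[/andP[_ kN] _].
    rewrite /v (_ : (f - trunc N f) k = 0) ?linear0l //.
    by change (f k - trunc_fun N f k = 0); rewrite /trunc_fun kN subrr.
  have vu : \sum_(N <= k < n) v k = \sum_(N <= k < n) u k.
    apply: eq_big_nat => k /andP[Nk _].
    rewrite /v (_ : (f - trunc N f) k = f k) //.
    by change (f k - trunc_fun N f k = f k); rewrite trunc_support // subr0.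
  rewrite /series /= (big_cat_nat (leq0n N) Nn) /= addrAC subrr add0r.
  change (\sum_(N <= k < n) u k = \sum_(0 <= k < n) v k).
  by rewrite (big_cat_nat (leq0n N) Nn) /= v0 vu add0r.
rewrite (funext E) -[X in _ --> X](subrr (limn (series u))).
by apply: cvgB => //; exact: cvg_cst.
Qed.

Lemma l2_ipC (f g : l2 V) : l2_ip f g = l2_ip g f.
Proof. by rewrite /l2_ip; congr (limn (series _)); apply/funext => k; exact: hdotC. Qed.

Lemma l2_ip_ge0 (f : l2 V) : 0 <= l2_ip f f.
Proof.
apply: limr_ge; first exact: is_cvg_l2_ip.
by apply: nearW => n; apply: sumr_ge0 => k _; rewrite hdotE sqr_ge0.
Qed.

Lemma l2_CS (f g : l2 V) : l2_ip f g ^+ 2 <= l2_ip f f * l2_ip g g.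
Proof.
apply: quadratic_discr => [t||]; try exact: l2_ip_ge0.
have := l2_ip_ge0 (t *: g + f).
rewrite l2_ip_scalarl !l2_ip_scalarr (l2_ipC g f).
by move: (l2_ip f f) (l2_ip f g) (l2_ip g g) => a b c; congr (0 <= _); ring.
Qed.

Lemma ipA_le (A : l2 V -> l2 V) : bounded_operator A ->
  exists C, forall f, ipA A f f <= C * l2_ip f f.
Proof.
move=> [C CP]; exists C => f.
have n0 := l2_ip_ge0 f.
apply: (@le_trans _ _ (Num.sqrt (l2_ip f f) * Num.sqrt (l2_ip (A f) (A f)))).
  rewrite -sqrtrM //; apply: (le_trans (ler_norm _)).
  by rewrite -sqrtr_sqr ler_wsqrtr //; exact: l2_CS.
have := CP f; rewrite /ipnorm => H.
apply: (@le_trans _ _ (Num.sqrt (l2_ip f f) * (C * Num.sqrt (l2_ip f f)))).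
  by rewrite ler_wpM2l ?sqrtr_ge0.
by rewrite mulrCA -expr2 sqr_sqrtr.
Qed.

End SequenceSpace.

Section TestDensity.
Context {R : realType} (G : gelfand_triple R).
Variables (A : {linear l2 (gspace G 0) -> l2 (gspace G 0)})
  (K : hilbertType R) (iA : {linear l2 (gspace G 0) -> K}).
Hypothesis A_bounded : bounded_operator A.
Hypothesis K_completion : is_completion (ipA A) iA.

Lemma gincl0_emb p x : gincl0 G p (gemb G p x) = gemb G 0 x.
Proof. by elim: p => //= p IH; rewrite gincl_emb. Qed.

Lemma single_test k (x : nuc G) : single_fun k (gemb G 0 x) \in @test_pred R G.
Proof.
apply/asboolP => p; exists (single_fun k (gemb G p x)).
  apply/funext => j /=; rewrite /single_fun.
  by case: eqP => _; rewrite ?gincl0_emb // linear0.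
apply/cvg_ex; eexists; apply: (@series_finite_support _ _ k.+1) => j kj.
by rewrite /weighted_sq single_support // normr0 expr0n mulr0.
Qed.

Lemma iA_cvg (u : nat -> l2 (gspace G 0)) f :
  (fun k => l2_ip (f - u k) (f - u k)) @ \oo --> (0 : R) ->
  (fun k => iA (u k)) @ \oo --> iA f.
Proof.
move=> uf; have [C CP] := ipA_le A_bounded; apply: norm_sqr_cvg0.
have c : (fun k => C * l2_ip (f - u k) (f - u k)) @ \oo --> (0 : R).
  by rewrite -[X in _ --> X](mulr0 C); apply: cvgM => //; exact: cvg_cst.
apply: (squeeze_cvgr _ (cvg_cst 0) c); apply: nearW => k.
rewrite sqr_ge0 /= distrC -linearB -hdotE K_completion.1.
exact: CP.
Qed.

(** The closure of the range contains the sequences with one nonzero entry, as [nuc G] is dense in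
    [gspace G 0], hence the finite sequences, hence by truncation the image of [l2], which is dense
    in [K]. Boundedness of [A] turns l2 convergence into convergence in [K]. *)
Lemma test_emb_dense : dense (range (test_emb iA)).
Proof.
have S := closure_subspace (S := range (test_emb iA)).
have {S} [S0 SD] : Defs.subspace (closure (range (test_emb iA))).
  apply: S; split; first by exists 0; rewrite ?linear0.
  by move=> a _ _ [x _ <-] [y _ <-]; exists (a *: x + y); rewrite // linearP.
have cl B x : B `<=` closure (range (test_emb iA)) -> closure B x ->
    closure (range (test_emb iA)) x.
  by move=> BS Bx; apply: closed_closure; exact: (closureS BS).
have single_in k h : closure (range (test_emb iA)) (iA (single k h)).
  have [u ur uh] := closure_seq (dense_closure (gemb_completion G 0).2 (x := h)).
  apply: (@seq_closure _ _ _ (fun j => iA (single k (u j)))).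
    move=> j; have [x _ xu] := ur j.
    exists (Test (single_test k x)) => //; rewrite /test_emb /=; congr (iA _).
    by apply: val_inj; rewrite /= xu.
  apply: iA_cvg.
  rewrite (_ : (fun j => _) = fun j => `|h - u j| ^+ 2).
    have c : (fun j => `|h - u j|) @ \oo --> (0 : R).
      rewrite -(normr0 (gspace G 0)) -(subrr h).
      by apply: cvg_norm; apply: cvgB => //; exact: cvg_cst.
    rewrite -[X in _ --> X](mul0r (0 : R)).
    by rewrite (_ : (fun j => _) = fun j => `|h - u j| * `|h - u j|) //; exact: cvgM.
  apply/funext => j; rewrite -(l2_ip_single k); congr (l2_ip _ _);
    by apply: val_inj; apply/funext => l; rewrite /= /single_fun;
      change ((if l == k then h else 0) - (if l == k then u j else 0) =
        if l == k then h - u j else 0); case: eqP => _; rewrite ?subr0.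
have trunc_in N f : closure (range (test_emb iA)) (iA (trunc N f)).
  elim: N => [|N IH]; first by rewrite trunc0 linear0.
  by rewrite truncS linearD -[iA (trunc N f)]scale1r; apply: SD.
have iA_in f : closure (range (test_emb iA)) (iA f).
  apply: closed_closure.
  exact: (seq_closure (trunc_in^~ f) (iA_cvg (l2_ip_trunc_cvg f))).
move=> O [x Ox] oO.
have xc : closure (range (test_emb iA)) x.
  apply: (cl (range iA)); first by move=> _ [f _ <-].
  exact: dense_closure K_completion.2.
have [|y [ry Oy]] := xc O; first by rewrite nbhsE; exists O.
by exists y.
Qed.

End TestDensity.

(** * The projection and its tensor powers *)

Section TensorPowerOperator.
Context {R : realType} {K : hilbertType R} (P : {linear K -> K}).
Hypothesis P_sym : forall x y, hdot (P x) y = hdot x (P y).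
Hypothesis P_idem : forall x, P (P x) = P x.
Context (n : nat) (T : hilbertType R) (i : {linear tensor K n -> T}).
Hypothesis iT : is_hilbert_tensor_power i.
Variable Pn : {linear T -> T}.
Hypothesis PnP : is_tensor_power_operator i P Pn.

Lemma tensor_power_diag y : Pn (diag i y) = diag i (P y).
Proof. by rewrite /diag PnP.2. Qed.

Lemma tensor_power_cvg (u : nat -> T) x : u @ \oo --> x ->
  (fun k => Pn (u k)) @ \oo --> Pn x.
Proof. by move=> ux; apply: (continuous_cvg _ (PnP.1 x) ux). Qed.

Lemma hilbert_tensor_seq (x : T) :
  exists2 t : nat -> tensor K n, True & (fun k => i (t k)) @ \oo --> x.
Proof.
have [u ur ux] := closure_seq (dense_closure iT.2 (x := x)).
have /choice[t tu] : forall k, exists t, i t = u k.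
  by move=> k; have [t _ <-] := ur k; exists t.
by exists t => //; rewrite (_ : (fun k => _) = u) //; apply/funext.
Qed.

Lemma hdot_sumr (I : Type) (s : seq I) (c : I -> R) (a : I -> T) y :
  hdot y (\sum_(q <- s) c q *: a q) = \sum_(q <- s) c q * hdot y (a q).
Proof. by rewrite hdotC hdot_suml; apply: eq_bigr => q _; rewrite hdotC. Qed.

(** Symmetry of [P] is used factor by factor on pure tensors and extended to [T] by linearity,
    density and continuity of [Pn]. *)
Lemma hdot_tensor_power_fixed s w : P w = w ->
  hdot (Pn s) (diag i w) = hdot s (diag i w).
Proof.
move=> Pw; have [t _ ts] := hilbert_tensor_seq s.
have E k : hdot (Pn (i (t k))) (diag i w) = hdot (i (t k)) (diag i w).
  have [p ->] := tensor_comb (t k).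
  rewrite !linear_sum /=.
  under eq_bigr do rewrite !linearZ /= PnP.2.
  under [in RHS]eq_bigr do rewrite !linearZ /=.
  rewrite !hdot_suml; apply: eq_bigr => q _; congr (_ * _).
  rewrite /diag !iT.1; apply: eq_bigr => j _.
  by rewrite /= P_sym Pw.
have c1 := hdot_cvg (tensor_power_cvg ts) (cvg_cst (diag i w)).
have c2 := hdot_cvg ts (cvg_cst (diag i w)).
rewrite (funext E) in c1.
exact: (cvg_unique (@Rhausdorff R) (c1 _) (c2 _)).
Qed.

(** As [P] is symmetric and idempotent, [|Pn s|^2] is the inner product of [s] with [Pn s], and
    Cauchy-Schwarz concludes. The convergence of the projected chaos series rests on this bound. *)
Lemma tensor_power_contraction s : `|Pn s| <= `|s|.
Proof.
have [t _ ts] := hilbert_tensor_seq s.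
have E k : hdot (Pn (i (t k))) (Pn (i (t k))) = hdot (i (t k)) (Pn (i (t k))).
  have [p ->] := tensor_comb (t k).
  have ei : i (\sum_(q <- p) q.1 *: pure q.2) = \sum_(q <- p) q.1 *: i (pure q.2).
    by rewrite linear_sum; apply: eq_bigr => q _; rewrite linearZ.
  have -> : Pn (i (\sum_(q <- p) q.1 *: pure q.2)) =
      \sum_(q <- p) q.1 *: i (pure (P \o q.2)).
    by rewrite ei linear_sum; apply: eq_bigr => q _; rewrite linearZ /= PnP.2.
  rewrite ei.
  rewrite !hdot_suml; apply: eq_bigr => q _; congr (_ * _).
  rewrite !hdot_sumr; apply: eq_bigr => r _; congr (_ * _).
  rewrite !iT.1; apply: eq_bigr => j _.
  by rewrite /= P_sym P_idem.
have H k : `|Pn (i (t k))| <= `|i (t k)|.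
  have := hdot_CS (i (t k)) (Pn (i (t k))).
  rewrite -E hdotE ger0_norm ?sqr_ge0 // expr2.
  have [->|P0] := eqVneq `|Pn (i (t k))| 0; first by rewrite normr_ge0.
  by rewrite ler_pM2r // lt_def P0 normr_ge0.
apply: (ler_cvg_to (cvg_norm (tensor_power_cvg ts)) (cvg_norm ts)).
exact: nearW.
Qed.

Lemma tensor_power_symmetric f : hilbert_symmetric_tensors i f ->
  hilbert_symmetric_tensors i (Pn f).
Proof.
move=> /closure_seq[u us uf]; apply: seq_closure (tensor_power_cvg uf) => k.
have : (lspan (range (diag i)) `<=` [set x | lspan (range (diag i)) (Pn x)]).
  have [S0 SD] := lspan_subspace (range (diag i)).
  apply: smallest_sub.
    split=> /=; first by rewrite linear0.
    by move=> a x y Sx Sy; rewrite linearP; exact: SD.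
  move=> _ [y _ <-] /=; apply: sub_lspan; exists (P y) => //.
  by rewrite tensor_power_diag.
by apply; exact: us.
Qed.

End TensorPowerOperator.

Section OrthogonalProjection.
Context {R : realType} {K : hilbertType R} (m : nat) (psi : 'I_m -> K).
Variable P : {linear K -> K}.
Hypothesis P_projection : is_orthogonal_projection (lspan (range psi)) P.

(** The difference [y - P y] lies in the span and is orthogonal to it. *)
Lemma projection_id y : lspan (range psi) y -> P y = y.
Proof.
move=> Sy; have [SP PO] := P_projection y.
have [S0 SD] := lspan_subspace (range psi).
have : lspan (range psi) (y - P y).
  by rewrite addrC -scaleN1r; exact: SD.
move=> /PO; rewrite hdotE => /eqP; rewrite sqrf_eq0 normr_eq0 subr_eq0.
by move=> /eqP.
Qed.

Lemma projection_idem x : P (P x) = P x.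
Proof. by apply: projection_id; have [] := P_projection x. Qed.

Lemma projection_sym x y : hdot (P x) y = hdot x (P y).
Proof.
have [Sx xO] := P_projection x; have [Sy yO] := P_projection y.
have := xO _ Sy; have := yO _ Sx; rewrite !linearBl /=.
move=> /eqP; rewrite subr_eq0 (hdotC y) => /eqP -> /eqP.
by rewrite subr_eq0 (hdotC (P y)) => /eqP ->.
Qed.

Lemma lspan_family y : lspan (range psi) y ->
  exists c : 'rV[R]_m, y = \sum_k c 0 k *: psi k.
Proof.
move: y; apply: smallest_sub.
  split; first by exists 0; rewrite big1 // => k _; rewrite mxE scale0r.
  move=> a _ _ [c ->] [c' ->]; exists (a *: c + c').
  rewrite scaler_sumr -big_split; apply: eq_bigr => k _.
  by rewrite !mxE scalerDl scalerA.
move=> _ [k _ <-]; exists (delta_mx 0 k).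
rewrite (bigD1 k) //= mxE !eqxx scale1r big1 ?addr0 // => j jk.
by rewrite mxE (negbTE jk) andbF scale0r.
Qed.

Lemma family_lspan (c : 'I_m -> R) : lspan (range psi) (\sum_k c k *: psi k).
Proof.
have [S0 SD] := lspan_subspace (range psi).
apply: (big_ind (lspan (range psi))) => // [x y Sx Sy|k _].
  by rewrite -[x]scale1r; exact: SD.
by rewrite -[_ *: _]addr0; apply: SD => //; apply: sub_lspan; exists k.
Qed.

End OrthogonalProjection.

(** * Conditional expectations *)

Section L2LimitsExtra.
Context d (T : measurableType d) (R : realType) (mu : probability T R).
Implicit Types (f g F : T -> R).

Lemma L2_cvg_ae (u : nat -> T -> R) f g : L2_cvg mu u f ->
  measurable_fun setT g -> g = f %[ae mu] -> L2_cvg mu u g.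
Proof.
move=> /L2_cvgP[us fs uf] mg gf; have gs := sqi_ae mg gf fs.
apply/L2_cvgP; split=> //.
rewrite (_ : (fun k => _) = fun k => Ex mu (fun x => (u k x - f x) ^+ 2)) //.
apply/funext => k; apply: ae_eq_Ex.
- by apply: measurable_funX; apply: measurable_funB => //; exact: sqi_meas.
- by apply: measurable_funX; exact: sqi_meas (sqiB (us k) fs).
- by apply: filterS gf => x H /H /= ->.
Qed.

Lemma L2_cvg_lin (u v : nat -> T -> R) f g c : L2_cvg mu u f -> L2_cvg mu v g ->
  L2_cvg mu (fun k x => u k x + c * v k x) (fun x => f x + c * g x).
Proof.
move=> /L2_cvgP[us fs uf] /L2_cvgP[vs gs vg]; apply/L2_cvgP.
split; [by move=> k; apply: sqiD => //; exact: sqiZ|by apply: sqiD => //; exact: sqiZ|].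
have z : (fun k => 2 * Ex mu (fun x => (u k x - f x) ^+ 2) +
    2 * c ^+ 2 * Ex mu (fun x => (v k x - g x) ^+ 2)) @ \oo --> (0 : R).
  rewrite -[X in _ --> X](addr0 0) -[X in _ --> X + _](mulr0 2).
  rewrite -[X in _ --> _ + X](mulr0 (2 * c ^+ 2)).
  by apply: cvgD; apply: cvgM => //; exact: cvg_cst.
apply: (squeeze_cvgr _ (cvg_cst 0) z); apply: nearW => k.
rewrite Ex_ge0 /=; last by move=> x; exact: sqr_ge0.
have i1 := sqi_sqr (sqiB (us k) fs); have i2 := sqi_sqr (sqiB (vs k) gs).
rewrite -!ExZ // -ExD; try exact: intgZ.
apply: Ex_le => [||x].
- by apply: sqi_sqr; apply: sqiB; apply: sqiD => //; exact: sqiZ.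
- by apply: intgD; exact: intgZ.
- have := sqr_ge0 ((u k x - f x) - c * (v k x - g x)).
  rewrite -subr_ge0 => H; rewrite -subr_ge0; apply: le_trans H _.
  by rewrite le_eqVlt; apply/orP; left; apply/eqP; ring.
Qed.

Lemma L2_cvg_comb (m : nat) (c : 'I_m -> R) (u : 'I_m -> nat -> T -> R)
    (f : 'I_m -> T -> R) : (forall k, L2_cvg mu (u k) (f k)) ->
  L2_cvg mu (fun j x => \sum_k c k * u k j x) (fun x => \sum_k c k * f k x).
Proof.
move=> uf.
suff H (s : seq 'I_m) : L2_cvg mu (fun j x => \sum_(k <- s) c k * u k j x)
    (fun x => \sum_(k <- s) c k * f k x) by exact: H.
elim: s => [|k s IH].
  rewrite (_ : (fun j x => _) = fun _ _ => 0); last first.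
    by apply/funext => j; apply/funext => x; rewrite big_nil.
  rewrite (_ : (fun x => \sum_(k <- [::]) _) = fun=> 0).
    by apply: L2_cvg_cst; exact: sqi_cst.
  by apply/funext => x; rewrite big_nil.
have := L2_cvg_lin (c k) IH (uf k).
congr (L2_cvg mu _ _).
  by apply/funext => j; apply/funext => x; rewrite big_cons addrC.
by apply/funext => x; rewrite big_cons addrC.
Qed.

(** Used with the cosine and the sine to extend the characteristic functional to L2 limits: the
    error [h (u k x) - h (f x)] is dominated in mean square by [u k x - f x]. *)
Lemma L2_cvg_lipschitz (h : R -> R) (u : nat -> T -> R) f :
  (forall x y, `|h x - h y| <= `|x - y|) -> (forall x, `|h x| <= 1) ->
  measurable_fun setT h -> L2_cvg mu u f ->
  (fun k => Ex mu (fun x => h (u k x))) @ \oo --> Ex mu (fun x => h (f x)).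
Proof.
move=> hl h1 mh /L2_cvgP[us fs uf].
have hs g : sqi mu g -> sqi mu (fun x => h (g x)).
  move=> gs; apply: (sqi_le _ (sqi_cst mu 1)).
    by apply: measurableT_comp => //; exact: sqi_meas gs.
  by move=> x; rewrite normr1.
have ds k := sqiB (hs _ (us k)) (hs _ fs).
have c0 : (fun k => Ex mu (fun x => h (u k x) - h (f x))) @ \oo --> (0 : R).
  apply: sqr_cvg0; apply: (squeeze_cvgr _ (cvg_cst 0) uf); apply: nearW => k.
  rewrite sqr_ge0 /=; have := Ex_CS (ds k) (sqi_cst mu 1).
  rewrite (_ : (fun x => _ * 1) = fun x => h (u k x) - h (f x)); last first.
    by apply/funext => x; rewrite mulr1.
  rewrite (_ : (fun x : T => 1 ^+ 2) = fun=> 1); last first.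
    by apply/funext => x; rewrite expr1n.
  rewrite Ex_cst mulr1 => /le_trans; apply.
  apply: Ex_le => [||x]; [exact: sqi_sqr|by apply: sqi_sqr; exact: sqiB|].
  rewrite -real_normK ?num_real // -[leRHS]real_normK ?num_real //.
  by rewrite lerXn2r ?nnegrE.
rewrite (_ : (fun k => _) = fun k => Ex mu (fun x => h (u k x) - h (f x)) +
    Ex mu (fun x => h (f x))).
  by rewrite -[X in _ --> X]add0r; apply: cvgD => //; exact: cvg_cst.
apply/funext => k; rewrite ExB ?subrK //; exact: sqi_intg (hs _ _).
Qed.

Lemma integral_indicE f B : measurable B -> intg mu f ->
  (\int[mu]_(x in B) (f x)%:E)%E = (Ex mu (fun x => f x * \1_B x))%:E.
Proof.
move=> mB fi; rewrite EFin_Ex; last exact: intg_indic.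
rewrite integral_mkcond; apply: eq_integral => x _.
rewrite /patch indicE; case: (x \in B) => /=.
  by rewrite mulr1.
by rewrite mulr0.
Qed.

Variable G : set (set T).
Hypothesis G_meas : G `<=` measurable.

Lemma smeasB f g : smeas G f -> smeas G g -> smeas G (fun x => f x - g x).
Proof. by move=> /smeasP mf /smeasP mg; apply/smeasP; exact: measurable_funB. Qed.

(** The sets where [f - g] is positive and where it is negative belong to the sigma-algebra, so the
    hypothesis makes the expectation of [|f - g|] vanish. *)
Lemma condexp_unique f g : smeas G f -> smeas G g -> intg mu f -> intg mu g ->
  (forall B, <<s G >> B -> Ex mu (fun x => f x * \1_B x) = Ex mu (fun x => g x * \1_B x)) ->
  f = g %[ae mu].
Proof.
move=> Sf Sg fi gi fg; set D := fun x => f x - g x.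
have SD : smeas G D := smeasB Sf Sg.
have Di : intg mu D by exact: intgB.
have D0 B : <<s G >> B -> Ex mu (fun x => D x * \1_B x) = 0.
  move=> SB; have mB := sub_smeas G_meas SB.
  rewrite (_ : (fun x => _) = fun x => f x * \1_B x - g x * \1_B x).
    by rewrite ExB ?fg ?subrr //; exact: intg_indic.
  by apply/funext => x; rewrite mulrBl.
have Sp : <<s G >> (D @^-1` `]0, +oo[) by apply: SD; exact: measurable_itv.
have Sn : <<s G >> (D @^-1` `]-oo, 0[) by apply: SD; exact: measurable_itv.
have E : Ex mu (fun x => `|D x|) = 0.
  rewrite (_ : (fun x => _) = fun x => D x * \1_(D @^-1` `]0, +oo[) x -
     D x * \1_(D @^-1` `]-oo, 0[) x).
    rewrite ExB ?D0 ?subrr //; apply: intg_indic => //; exact: (sub_smeas G_meas).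
  apply/funext => x; rewrite !indicE.
  have -> : (x \in D @^-1` `]0, +oo[) = (0 < D x).
    by apply/idP/idP => [/set_mem|H]; [|apply/mem_set]; rewrite /= in_itv /= andbT.
  have -> : (x \in D @^-1` `]-oo, 0[) = (D x < 0).
    by apply/idP/idP => [/set_mem|H]; [|apply/mem_set]; rewrite /= in_itv.
  case: (ltgtP (D x) 0) => [x0|x0|->].
  - by rewrite ltr0_norm // mulr0 mulr1 sub0r.
  - by rewrite gtr0_norm // mulr0 mulr1 subr0.
  - by rewrite normr0 !mul0r subr0.
have /ae_eq_integral_abs : measurable_fun setT (EFin \o D).
  by apply/measurable_EFinP; exact: (intg_meas Di).
move=> /(_ mu measurableT) [+ _].
have -> : (\int[mu]_x `|(EFin \o D) x| = 0)%E.
  rewrite -(EFin_Ex (f := fun x => `|D x|)) ?E //.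
  exact: (integrable_norm Di).
move=> /(_ erefl); apply: filterS => x H /H /= [].
by move=> /eqP; rewrite subr_eq0 => /eqP.
Qed.

End L2LimitsExtra.

(** * The white noise family *)

Section WhiteNoiseFamily.
Context {R : realType} (G : gelfand_triple R).
Context (A : {linear l2 (gspace G 0) -> l2 (gspace G 0)}).
Hypothesis A_bounded : bounded_operator A.
Variable mu : probability (mdual G) R.
Hypothesis mu_char : has_gaussian_characteristic A mu.
Context (K : hilbertType R) (iA : {linear l2 (gspace G 0) -> K}).
Hypothesis K_completion : is_completion (ipA A) iA.
Context (T : nat -> hilbertType R) (i : forall n, {linear tensor K n -> T n}).
Hypothesis iT : forall n, is_hilbert_tensor_power (i n).

Let J := test_emb iA.

Definition dual_eval (phi : test G) (omega : mdual G) : R := (omega : dual G) phi.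

Lemma dual_eval_lin a u v omega :
  dual_eval (a *: u + v) omega = a * dual_eval u omega + dual_eval v omega.
Proof. by rewrite /dual_eval linearP. Qed.

Lemma dual_eval_meas phi : measurable_fun setT (dual_eval phi).
Proof.
move=> _ B mB; apply: sub_sigma_algebra; exists phi => //.
by exists B.
Qed.

Lemma cov_test phi psi : cov J phi psi = test_ip A phi psi.
Proof. exact: K_completion.1. Qed.

Lemma dual_eval_cos phi : Ex mu (fun omega => cos (dual_eval phi omega)) =
  expR (- 2^-1 * hdot (J phi) (J phi)).
Proof.
rewrite -[hdot _ _]/(cov J phi phi) cov_test; exact: (mu_char phi).1.
Qed.

Lemma dual_eval_sin phi : Ex mu (fun omega => sin (dual_eval phi omega)) = 0.
Proof. exact: (mu_char phi).2. Qed.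

Lemma wick_sumE n (p : seq (R * test G)) omega :
  (\sum_(q <- p) q.1 *: pure (fun _ : 'I_n => q.2)) (wick A omega n) =
  wick_sum J dual_eval n p omega.
Proof.
rewrite tensor_combE; apply: eq_bigr => q _; congr (_ * _).
by rewrite /pure /= /eval_tensor /wick wick_power_diag cov_test.
Qed.

Lemma diag_tensorE n (p : seq (R * test G)) :
  i n (tensor_map J (\sum_(q <- p) q.1 *: pure (fun _ : 'I_n => q.2))) =
  diag_tensor J i n p.
Proof.
rewrite tensor_map_comb linear_sum; apply: eq_bigr => q _.
by rewrite linearZ.
Qed.

(** [xget] returns the default [cst 0] unless some limit exists, so existence is needed before
    anything is known about the selected function. The symmetric tensors that approximate it are
    then rewritten as combinations of diagonal ones. *)
Lemma wick_integral_lim n (f : T n) : hilbert_symmetric_tensors (i n) f ->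
  wick_lim mu J dual_eval i f (wick_integral A mu iA (i n) f).
Proof.
move=> fs.
have [Y [p pf pY]] := wick_lim_exists dual_eval_lin dual_eval_meas dual_eval_cos
  dual_eval_sin iT (test_emb_dense A_bounded K_completion) fs.
have ex : exists X, [set X | exists phi : nat -> tensor (test G) n,
    [/\ forall k, symmetric_tensor (phi k),
        (fun k => i n (tensor_map J (phi k))) @ \oo --> f &
        L2_cvg mu (fun k omega => phi k (wick A omega n)) X]] X.
  exists Y, (fun k => \sum_(q <- p k) q.1 *: pure (fun _ : 'I_n => q.2)); split.
  - by move=> k; exact: symmetric_diag.
  - by rewrite (funext (fun k => diag_tensorE n (p k))).
  - move: pY; congr (L2_cvg mu _ _); apply/funext => k; apply/funext => omega.
    by rewrite wick_sumE.
have [phi [phis phif phiX]] := xgetPex (cst 0) ex.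
have /choice[q qphi] : forall k, exists q : seq (R * test G),
    phi k = \sum_(r <- q) r.1 *: pure (fun _ : 'I_n => r.2).
  by move=> k; exact: symmetric_tensor_diag.
exists q.
  rewrite (_ : (fun k => _) = fun k => i n (tensor_map J (phi k))) //.
  by apply/funext => k; rewrite qphi diag_tensorE.
move: phiX; congr (L2_cvg mu _ _); apply/funext => k; apply/funext => omega.
by rewrite qphi wick_sumE.
Qed.

(** The first Hermite polynomial is the identity, so existence is the case of order 1 of Wick
    limits, with lists of a single vector and coefficient 1. *)
Lemma pairing_lim (y : K) : exists2 phi : nat -> test G,
    (fun k => J (phi k)) @ \oo --> y &
    L2_cvg mu (fun k => dual_eval (phi k)) (pairing mu iA y).
Proof.
have dJ := test_emb_dense A_bounded K_completion.
have [u uJ uy] := closure_seq (dense_closure dJ (x := y)).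
have /choice[phi phiu] : forall k, exists phi, J phi = u k.
  by move=> k; have [phi _ <-] := uJ k; exists phi.
have phiy : (fun k => J (phi k)) @ \oo --> y by rewrite (funext phiu).
pose p k := [:: (1 : R, phi k)].
have pf : (fun k => diag_tensor J i 1 (p k)) @ \oo --> diag (i 1%N) y.
  rewrite (_ : (fun k => _) = fun k => diag (i 1%N) (J (phi k))).
    exact: (diag_cvg (iT 1%N) phiy).
  by apply/funext => k; rewrite /diag_tensor big_seq1 scale1r.
have [Y pY] := wick_lim_exists_seq dual_eval_lin dual_eval_meas dual_eval_cos
  dual_eval_sin iT pf.
have ex : exists X, [set X | exists2 phi : nat -> test G,
    (fun k => J (phi k)) @ \oo --> y &
    L2_cvg mu (fun k omega => (omega : dual G) (phi k)) X] X.
  exists Y, phi => //.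
  move: pY; congr (L2_cvg mu _ _); apply/funext => k; apply/funext => omega.
  by rewrite /wick_sum big_seq1 mul1r.
exact: (xgetPex (cst 0) ex).
Qed.

Context (m : nat) (psi : 'I_m -> K) (X : 'I_m -> mdual G -> R).
Hypothesis X_meas : forall k, measurable_fun setT (X k).
Hypothesis X_rep : forall k, X k = pairing mu iA (psi k) %[ae mu].

(* The representatives [X k] are adjoined to the family [dual_eval] in order to
   have them, and not only their almost everywhere classes, inside a Gaussian
   family that is linear pointwise. *)
Definition ext_emb_fun (v : test G * 'rV[R]_m) : K :=
  J v.1 + \sum_k v.2 0 k *: psi k.

Lemma ext_emb_linear : linear ext_emb_fun.
Proof.
move=> a u v; rewrite /ext_emb_fun (_ : (a *: u + v).1 = a *: u.1 + v.1) //.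
rewrite [J _]linearP scalerDr addrACA; congr (_ + _).
rewrite scaler_sumr -big_split; apply: eq_bigr => k _.
by rewrite !mxE scalerDl scalerA.
Qed.

HB.instance Definition _ := GRing.isLinear.Build R (test G * 'rV[R]_m)%type K _
  ext_emb_fun ext_emb_linear.

Definition ext_emb : {linear (test G * 'rV[R]_m)%type -> K} := ext_emb_fun.

Definition ext_eval (v : test G * 'rV[R]_m) (omega : mdual G) : R :=
  dual_eval v.1 omega + \sum_k v.2 0 k * X k omega.

Lemma ext_eval_lin a u v omega :
  ext_eval (a *: u + v) omega = a * ext_eval u omega + ext_eval v omega.
Proof.
rewrite /ext_eval /= dual_eval_lin mulrDr addrACA; congr (_ + _).
rewrite mulr_sumr -big_split; apply: eq_bigr => k _.
by rewrite !mxE mulrDl mulrA.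
Qed.

Lemma ext_eval_meas v : measurable_fun setT (ext_eval v).
Proof.
apply: measurable_funD; first exact: dual_eval_meas.
by apply: measurable_sum => k; exact: measurable_funM.
Qed.

(** The source of the Gaussian law of the extended family: its members are L2 limits of test
    pairings whose embeddings converge, and so inherit the cosine and sine identities. *)
Lemma ext_eval_lim v : exists2 phi : nat -> test G,
  (fun k => J (phi k)) @ \oo --> ext_emb v &
  L2_cvg mu (fun k => dual_eval (phi k)) (ext_eval v).
Proof.
have /choice[phi phiP] : forall k, exists phi : nat -> test G,
    (fun j => J (phi j)) @ \oo --> psi k /\
    L2_cvg mu (fun j => dual_eval (phi j)) (X k).
  (* [X k] agrees with the selected [pairing] almost everywhere, so it is a limit of the same
     approximants. *)
  move=> k; have [phi p1 p2] := pairing_lim (psi k).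
  by exists phi; split=> //; exact: L2_cvg_ae p2 (X_meas k) (X_rep k).
exists (fun j => v.1 + \sum_k v.2 0 k *: phi k j).
  rewrite (_ : (fun j => _) = fun j => J v.1 + \sum_k v.2 0 k *: J (phi k j)).
    rewrite /ext_emb /= /ext_emb_fun.
    apply: cvgD; first exact: cvg_cst.
    suff sc (s : seq 'I_m) : (fun j => \sum_(k <- s) v.2 0 k *: J (phi k j)) @ \oo -->
        \sum_(k <- s) v.2 0 k *: psi k by exact: sc.
    elim: s => [|k s IH].
      rewrite big_nil (_ : (fun j => _) = fun=> 0); first exact: cvg_cst.
      by apply/funext => j; rewrite big_nil.
    rewrite big_cons (_ : (fun j => _) = fun j => v.2 0 k *: J (phi k j) +
        \sum_(k <- s) v.2 0 k *: J (phi k j)).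
      by apply: cvgD => //; apply: cvgZr; exact: (phiP k).1.
    by apply/funext => j; rewrite big_cons.
  apply/funext => j; rewrite linearD linear_sum; congr (_ + _).
  by apply: eq_bigr => k _; rewrite linearZ.
have vs : sqi mu (dual_eval v.1).
  apply: all_moments_sqi.
  exact: (all_moments_X dual_eval_lin dual_eval_meas dual_eval_cos dual_eval_sin).
have := L2_cvg_lin 1 (L2_cvg_cst vs)
  (L2_cvg_comb (fun k => v.2 0 k) (fun k => (phiP k).2)).
congr (L2_cvg mu _ _).
  apply/funext => j; apply/funext => omega; rewrite mul1r /dual_eval.
  rewrite linearD linear_sum; congr (_ + _); apply: eq_bigr => k _.
  by rewrite linearZ.
by apply/funext => omega; rewrite mul1r.
Qed.

Lemma ext_eval_cos v : Ex mu (fun omega => cos (ext_eval v omega)) =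
  expR (- 2^-1 * hdot (ext_emb v) (ext_emb v)).
Proof.
have [phi phiv phiX] := ext_eval_lim v.
have mc : measurable_fun setT (@cos R).
  by apply: continuous_measurable_fun; exact: continuous_cos.
have c1 := L2_cvg_lipschitz cosB_le (@cos_max R) mc phiX.
rewrite (funext (fun k => dual_eval_cos (phi k))) in c1.
have c2 : (fun k => - 2^-1 * hdot (J (phi k)) (J (phi k))) @ \oo -->
    - 2^-1 * hdot (ext_emb v) (ext_emb v).
  by apply: cvgM; [exact: cvg_cst|exact: hdot_cvg].
exact: (cvg_unique (@Rhausdorff R) c1 (continuous_cvg _ (@continuous_expR R _) c2)).
Qed.

Lemma ext_eval_sin v : Ex mu (fun omega => sin (ext_eval v omega)) = 0.
Proof.
have [phi phiv phiX] := ext_eval_lim v.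
have ms : measurable_fun setT (@sin R).
  by apply: continuous_measurable_fun; exact: continuous_sin.
have c1 := L2_cvg_lipschitz sinB_le (@sin_max R) ms phiX.
rewrite (funext (fun k => dual_eval_sin (phi k))) in c1.
exact: (cvg_unique (@Rhausdorff R) c1 (cvg_cst _)).
Qed.

(** A test sequence [phi] is the member [(phi, 0)] of the extended family, with the same embedding
    and the same evaluation. *)
Lemma wick_integral_ext n (f : T n) : hilbert_symmetric_tensors (i n) f ->
  wick_lim mu ext_emb ext_eval i f (wick_integral A mu iA (i n) f).
Proof.
move=> /wick_integral_lim[p pf pY].
have z (phi : test G) : ext_emb (phi, 0) = J phi.
  rewrite /ext_emb /= /ext_emb_fun big1 ?addr0 // => k _.
  by rewrite mxE scale0r.
have zX (phi : test G) omega : ext_eval (phi, 0) omega = dual_eval phi omega.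
  rewrite /ext_eval big1 ?addr0 // => k _.
  by rewrite mxE mul0r.
exists (fun k => [seq (q.1, (q.2, 0)) | q <- p k]).
  rewrite (_ : (fun k => _) = fun k => diag_tensor J i n (p k)) //.
  apply/funext => k; rewrite /diag_tensor big_map; apply: eq_bigr => q _ /=.
  by rewrite z.
move: pY; congr (L2_cvg mu _ _); apply/funext => k; apply/funext => omega.
rewrite /wick_sum big_map; apply: eq_bigr => q _ /=.
by rewrite /cov z zX.
Qed.

End WhiteNoiseFamily.

(** * Measurability for the generated sigma-algebra *)

Section GeneratedMeasurability.
Context {R : realType} (G : gelfand_triple R) (m : nat).
Variable X : 'I_m -> mdual G -> R.

Definition generators : set (set (mdual G)) :=
  \bigcup_k preimage_set_system setT (X k) measurable.

Lemma measurable_hermite d (T : measurableType d) (f : T -> R) s n :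
  measurable_fun setT f -> measurable_fun setT (fun x => hermite s (f x) n).
Proof.
move=> mf; elim/ltn_ind: n => -[|n] IH; first exact: measurable_cst.
rewrite (_ : (fun x => _) = fun x => f x * hermite s (f x) n -
    n%:R * (s * hermite s (f x) n.-1)); last first.
  by apply/funext => x; rewrite hermiteS.
apply: measurable_funB; first by apply: measurable_funM => //; exact: IH.
by do 2 apply: measurable_funM => //; apply: IH; rewrite ltnS leq_pred.
Qed.

(** With test component 0 only the given representatives [X k] remain, so no null set has to be
    excluded. *)
Lemma smeas_ext_eval (c : 'rV[R]_m) : smeas generators (ext_eval X (0, c)).
Proof.
apply/smeasP.
rewrite (_ : ext_eval X (0, c) = fun omega => \sum_k c 0 k * X k omega); last first.
  by apply/funext => omega; rewrite /ext_eval /dual_eval linear0 add0r.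
apply: measurable_sum => k; apply: measurable_funM => //.
apply/smeasP => B mB; apply: sub_sigma_algebra; exists k => //.
by exists B => //; rewrite setTI.
Qed.

Lemma smeas_wick_sum (K : hilbertType R) (J : {linear (test G * 'rV[R]_m)%type -> K})
    n (c : seq (R * 'rV[R]_m)) :
  smeas generators (wick_sum J (ext_eval X) n [seq (q.1, (0, q.2)) | q <- c]).
Proof.
apply/smeasP.
rewrite (_ : wick_sum _ _ _ _ = fun omega => \sum_(q <- c)
    q.1 * hermite (cov J (0, q.2) (0, q.2)) (ext_eval X (0, q.2) omega) n); last first.
  by apply/funext => omega; rewrite /wick_sum big_map.
apply: measurable_sum => q; apply: measurable_funM => //.
by apply: measurable_hermite; apply/smeasP; exact: smeas_ext_eval.
Qed.

End GeneratedMeasurability.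

(** [P] maps into the span of the [psi k], so a projected diagonal tensor is the diagonal tensor of
    a vector with test component 0. The corresponding Wick sums are polynomials in the [X k]. *)
Lemma projected_diag_tensor (R : realType) (G : gelfand_triple R)
    (K : hilbertType R) (iA : {linear l2 (gspace G 0) -> K}) (m : nat)
    (psi : 'I_m -> K) (P : {linear K -> K}) n (T : nat -> hilbertType R)
    (i : forall n, {linear tensor K n -> T n}) (Pn : {linear T n -> T n}) x :
  is_orthogonal_projection (lspan (range psi)) P ->
  is_tensor_power_operator (i n) P Pn ->
  lspan (range (diag (i n))) x ->
  exists c : seq (R * 'rV[R]_m),
    Pn x = diag_tensor (ext_emb iA psi) i n [seq (q.1, (0, q.2)) | q <- c].
Proof.
move=> PP PnP; move: x; apply: smallest_sub.
  split; first by exists [::]; rewrite linear0 /diag_tensor big_nil.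
  move=> a x y [c xc] [c' yc]; exists ([seq (a * q.1, q.2) | q <- c] ++ c').
  rewrite linearP xc yc /diag_tensor map_cat big_cat -map_comp !big_map scaler_sumr.
  by congr (_ + _); apply: eq_bigr => q _; rewrite scalerA.
move=> _ [y _ <-]; have [Py _] := PP y; have [c Pyc] := lspan_family Py.
exists [:: (1, c)]; rewrite (tensor_power_diag PnP) /diag_tensor big_seq1 scale1r.
congr (diag _ _); rewrite Pyc /ext_emb /= /ext_emb_fun [test_emb iA _]linear0.
by rewrite add0r.
Qed.

Theorem corollary3p10 (R : realType) (G : gelfand_triple R)
  (A : {linear l2 (gspace G 0) -> l2 (gspace G 0)})
  (A_bounded : bounded_operator A)
  (A_self_adjoint : self_adjoint A)
  (A_positive : positive_definite A)
  (mu : probability (mdual G) R)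
  (mu_char : has_gaussian_characteristic A mu)
  (* the completion of l2 (H) for the inner product given by A *)
  (K : hilbertType R) (iA : {linear l2 (gspace G 0) -> K})
  (K_completion : is_completion (ipA A) iA)
  (* its Hilbert space tensor powers *)
  (T : nat -> hilbertType R) (i : forall n, {linear tensor K n -> T n})
  (T_tensor_power : forall n, is_hilbert_tensor_power (i n))
  (* F and its chaos decomposition *)
  (F : mdual G -> R) (F_L2 : F \in Lfun mu 2%:E)
  (f : forall n, T n)
  (f_symmetric : forall n, hilbert_symmetric_tensors (i n) (f n))
  (F_chaos : L2_cvg mu
    (fun N omega => \sum_(n < N) wick_integral A mu iA (i n) (f n) omega) F)
  (m : nat) (m_gt0 : (0 < m)%N)
  (psi : 'I_m -> K) (psi_orthonormal : orthonormal_system psi)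
  (P : {linear K -> K})
  (P_projection : is_orthogonal_projection (lspan (range psi)) P)
  (Pn : forall n, {linear T n -> T n})
  (Pn_tensor_power : forall n, is_tensor_power_operator (i n) P (Pn n))
  (* arbitrary representatives of the random variables <psi_k, .> *)
  (X : 'I_m -> mdual G -> R)
  (X_measurable : forall k, measurable_fun setT (X k))
  (X_representative : forall k, X k = pairing mu iA (psi k) %[ae mu]) :
  L2_cvg mu
    (fun N omega =>
       \sum_(n < N) wick_integral A mu iA (i n) (Pn n (f n)) omega)
    (condexp mu (generated_sigma_algebra X) F).
Proof.
pose I n := wick_integral A mu iA (i n) (f n).
pose I' n := wick_integral A mu iA (i n) (Pn n (f n)).
have Psym x y : hdot (P x) y = hdot x (P y) by exact: projection_sym P_projection x y.
have Pidem x : P (P x) = P x by exact: projection_idem P_projection x.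
have Pnf_symmetric n : hilbert_symmetric_tensors (i n) (Pn n (f n)).
  exact: (tensor_power_symmetric (Pn_tensor_power n)).
pose J := ext_emb iA psi; pose X' := ext_eval X.
have lin := @ext_eval_lin R G m X.
have meas := ext_eval_meas X_measurable.
have ecos := ext_eval_cos A_bounded mu_char K_completion T_tensor_power X_measurable X_representative.
have esin := ext_eval_sin A_bounded mu_char K_completion T_tensor_power X_measurable X_representative.
have ext n g := @wick_integral_ext R G A A_bounded mu mu_char K iA K_completion T i
  T_tensor_power m psi X n g.
have HI n : wick_lim mu J X' i (f n) (I n) by exact: ext.
have HI' n : wick_lim mu J X' i (Pn n (f n)) (I' n) by exact: ext.
have gm : generators X `<=` measurable.
  by move=> _ [k _ [B mB <-]]; exact: X_measurable.
(* [I' n] is only some representative. Projecting the combinations of diagonal tensors that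
   approximate [f n] gives a version [Y n] measurable for the generated sigma-algebra. *)
have /choice[Y YP] : forall n, exists Y, smeas (generators X) Y /\
    wick_lim mu J X' i (Pn n (f n)) Y.
  move=> n; have [u us uf] := closure_seq (f_symmetric n).
  have /choice[c cu] := fun k => @projected_diag_tensor R G K iA m psi P n T i
    (Pn n) (u k) P_projection (Pn_tensor_power n) (us k).
  pose p k := [seq (q.1, (0 : test G, q.2)) | q <- c k].
  have pf : (fun k => diag_tensor J i n (p k)) @ \oo --> Pn n (f n).
    rewrite (_ : (fun k => _) = fun k => Pn n (u k)); last exact/esym/funext.
    exact: (tensor_power_cvg (Pn_tensor_power n)).
  have [|Y [Ys YL]] := wick_lim_exists_smeas lin meas ecos esin T_tensor_power gm _ pf.
    by move=> k; exact: smeas_wick_sum.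
  by exists Y; split=> //; exists p.
have HY n : wick_lim mu J X' i (Pn n (f n)) (Y n) := (YP n).2.
have Is n : sqi mu (I n) := wick_lim_sqi (HI n).
have Is' n : sqi mu (I' n) := wick_lim_sqi (HI' n).
have Ys n : sqi mu (Y n) := wick_lim_sqi (HY n).
pose S N omega := \sum_(n < N) Y n omega.
have Ss N : sqi mu (S N) by apply: sqi_sum => n.
(* By orthogonality of the orders and the contraction property, the partial sums of the [Y n] are at
   least as close to each other as those of the chaos series of [F], which are Cauchy. *)
have [E [ES EL]] : exists E, smeas (generators X) E /\ L2_cvg mu S E.
  apply: L2_complete => //.
    move=> N; apply/smeasP; apply: measurable_sum => n; apply/smeasP.
    exact: (YP n).1.
  move=> e e0; have [N0 HN] := L2_cauchy F_chaos e0.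
  exists N0 => k l.
  wlog kl : k l / (l <= k)%N.
    move=> H k0 l0; case: (leqP l k) => [lk|/ltnW kl]; first exact: H.
    have := H l k kl l0 k0; congr (Ex mu _ <= e).
    by apply/funext => omega; rewrite -sqrrN opprB.
  move=> k0 l0; apply: le_trans (HN k l k0 l0).
  rewrite /S (wick_lim_partial_sums lin meas ecos esin T_tensor_power HY kl).
  rewrite (wick_lim_partial_sums lin meas ecos esin T_tensor_power HI kl).
  apply: ler_sum => n _; rewrite ler_wpM2l // lerXn2r ?nnegrE //.
  exact: (tensor_power_contraction Psym Pidem (T_tensor_power n) (Pn_tensor_power n)).
(* [I' n] and [Y n] are limits for the same tensor, so the isometry puts them at distance 0. *)
have I'E : L2_cvg mu (fun N omega => \sum_(n < N) I' n omega) E.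
  apply: (L2_cvg_trans EL); first by move=> N; apply: sqi_sum => n.
  rewrite (_ : (fun N => _) = fun=> 0); first exact: cvg_cst.
  apply/funext => N.
  have d0 n : I' n = Y n %[ae mu].
    have := wick_lim_dist lin meas ecos esin T_tensor_power (HI' n) (HY n).
    rewrite subrr normr0 expr0n mulr0 => /(Ex_sqr_eq0 (sqiB (Is' n) (Ys n))).
    by apply: filterS => omega H /H /eqP; rewrite subr_eq0 => /eqP.
  rewrite -[RHS](Ex_cst mu 0); apply: ae_eq_Ex => //.
    apply: measurable_funX; apply: sqi_meas; apply: sqiB => //.
    by apply: sqi_sum => n.
  have := ae_foralln d0; apply: filterS => omega H _.
  rewrite /S (eq_bigr (fun n : 'I_N => Y n omega)) ?subrr ?expr0n // => n _.
  exact: H.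
have Es : sqi mu E by case: EL.
have EF : trig_null mu X (fun omega => F omega - E omega).
  split=> [|t s]; first exact: sqi_intg (sqiB F_L2 Es).
  (* [w] encodes the combination of the [psi k] with coefficients [t k]; its embedding is fixed by
     [P], and its evaluation is the same combination of the [X k]. *)
  pose w : test G * 'rV[R]_m := (0, \row_k t k).
  have Xw omega : X' w omega = \sum_k t k * X k omega.
    rewrite /X' /ext_eval /dual_eval linear0 add0r.
    by apply: eq_bigr => k _; rewrite mxE.
  have Jw : P (J w) = J w.
    apply: (projection_id P_projection).
    rewrite /J /ext_emb /= /ext_emb_fun [test_emb iA _]linear0 add0r.
    exact: family_lspan.
  pose g omega := cos (X' w omega + s).
  have gs : sqi mu g.
    apply: (sqi_le _ (sqi_cst mu 1)); first exact: (measurable_cosX meas w s).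
    by move=> omega; rewrite normr1 cos_max.
  have IE (Z : nat -> mdual G -> R) N : (forall n, sqi mu (Z n)) ->
      Ex mu (fun omega => (\sum_(n < N) Z n omega) * g omega) =
      \sum_(n < N) Ex mu (fun omega => Z n omega * g omega).
    move=> Zs; rewrite -(Ex_sum _ (h := fun (n : 'I_N) omega => Z n omega * g omega)).
      by congr (Ex mu _); apply/funext => omega; rewrite mulr_suml.
    by move=> n; exact: intgM.
  have c1 := L2_cvg_Ex F_chaos (L2_cvg_cst gs).
  have c2 := L2_cvg_Ex I'E (L2_cvg_cst gs).
  have E12 N : Ex mu (fun omega => (\sum_(n < N) I n omega) * g omega) =
      Ex mu (fun omega => (\sum_(n < N) I' n omega) * g omega).
    rewrite !IE //; apply: eq_bigr => n _.
    rewrite (wick_lim_trig lin meas ecos esin T_tensor_power w s (HI n)).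
    rewrite (wick_lim_trig lin meas ecos esin T_tensor_power w s (HI' n)).
    by rewrite (hdot_tensor_power_fixed Psym (T_tensor_power n) (Pn_tensor_power n)).
  rewrite (funext E12) in c1.
  have FE : Ex mu (fun omega => F omega * g omega) = Ex mu (fun omega => E omega * g omega).
    exact: (cvg_unique (@Rhausdorff R) c1 c2).
  transitivity (Ex mu (fun omega => F omega * g omega - E omega * g omega)).
    by congr (Ex mu _); apply/funext => omega; rewrite mulrBl /g Xw.
  by rewrite ExB ?FE ?subrr //; exact: intgM.
have Ec : is_condexp mu (generated_sigma_algebra X) F E.
  split=> //; first exact: sqi_intg Es.
  move=> B SB; have mB : measurable B := sub_smeas gm SB.
  rewrite !integral_indicE //; try exact: sqi_intg.
  congr EFin; apply/eqP; rewrite eq_sym -subr_eq0; apply/eqP.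
  rewrite -[RHS](trig_null_sigma X_measurable EF SB).
  rewrite -ExB; try by apply: intg_indic => //; exact: sqi_intg.
  by congr (Ex mu _); apply/funext => omega; rewrite mulrBl.
(* As [E] satisfies [is_condexp], the selected [condexp] does so too and is not an unrelated
   default. By uniqueness it agrees with [E] almost everywhere, which suffices for an L2 limit. *)
have [Cm Ci CB] : is_condexp mu (generated_sigma_algebra X) F
    (condexp mu (generated_sigma_algebra X) F).
  exact: (xgetPex (cst 0) (ex_intro _ E Ec)).
apply: (L2_cvg_ae I'E); first exact: (smeas_meas gm).
apply: (condexp_unique gm) => //; first exact: sqi_intg Es.
move=> B SB; have mB : measurable B := sub_smeas gm SB.
have [_ Ei EB] := Ec.
have := CB B SB; rewrite -(EB B SB) !integral_indicE //.
by case.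
Qed.
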